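(* Let $N$ be a natural number ($N\ge1$) and let $\{\mathcal{P}_n\}_{n=1}^\infty$ be an $N$-Lévy family of pyramids such that $\operatorname{ObsDiam}(\mathcal{P}_n;-\kappa)<+\infty$ for any $\kappa$ with $0<\kappa<1$ and for any $n$. Then we have one of the following (1) and (2). (1) $\{\mathcal{P}_n\}$ is a Lévy family. (2) There is a subsequence $\{\mathcal{P}_{n_i}\}_{i=1}^\infty$ of $\{\mathcal{P}_n\}$ and a sequence of real numbers $t_i$ with $0<t_i\le1$, $i=1,2,\dots$, such that $t_i\mathcal{P}_{n_i}$ converges weakly, as $i\to\infty$, to $\mathcal{P}_X$ for some finite mm-space $X$ with $2\le\#X\le N$.
   Context: An mm-space is a triple $(X,d_X,\mu_X)$ with $(X,d_X)$ a complete separable metric space and $\mu_X$ a Borel probability measure; we always assume $X=\operatorname{supp}\mu_X$. $\mathcal{X}$ is the set of mm-isomorphism classes of mm-spaces (mm-isomorphism: measure-preserving isometry between supports). $Y\prec X$ means there is a $1$-Lipschitz map $f:X\to Y$ with $f_*\mu_X=\mu_Y$. $\#X$ is the number of points of $X$. Box distance: a parameter of $X$ is a Borel map $\varphi:I=[0,1)\to X$ with $\varphi_*\mathcal{L}^1=\mu_X$. $\square(X,Y)$ is the infimum of $\varepsilon\ge0$ such that there are parameters $\varphi$ of $X$, $\psi$ of $Y$ and a Borel set $I_0\subset I$ with $\mathcal{L}^1(I_0)\ge1-\varepsilon$ and $|d_X(\varphi(s),\varphi(t))-d_Y(\psi(s),\psi(t))|\le\varepsilon$ for all $s,t\in I_0$.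 It is a metric on $\mathcal{X}$. A pyramid is a nonempty $\square$-closed subset $\mathcal{P}\subset\mathcal{X}$ such that (i) $X\in\mathcal{P}$ and $Y\prec X$ imply $Y\in\mathcal{P}$; (ii) for any $X,X'\in\mathcal{P}$ there is $Y\in\mathcal{P}$ with $X\prec Y$, $X'\prec Y$. $\mathcal{P}_X=\{X'\in\mathcal{X}\mid X'\prec X\}$ is the pyramid associated with an mm-space $X$. For $t>0$, $tX$ is $X$ with metric $t\,d_X$, and $t\mathcal{P}=\{tX\mid X\in\mathcal{P}\}$. Weak convergence $\mathcal{P}_n\to\mathcal{P}$: $\lim_{n}\square(X,\mathcal{P}_n)=0$ for every $X\in\mathcal{P}$, and $\liminf_n\square(X,\mathcal{P}_n)>0$ for every $X\in\mathcal{X}\setminus\mathcal{P}$, where $\square(X,\mathcal{P}_n)=\inf_{Y\in\mathcal{P}_n}\square(X,Y)$. Observable diameter: for a Borel probability measure $\nu$ on a metric space and $\alpha\in\mathbb{R}$, $\operatorname{diam}(\nu;\alpha)$ is the infimum of $\operatorname{diam}(A)$ over Borel sets $A$ with $\nu(A)\ge\alpha$. For an mm-space $X$ and $\kappa>0$, $\operatorname{ObsDiam}(X;-\kappa)=\sup\{\operatorname{diam}(f_*\mu_X;1-\kappa)\mid f:X\to\mathbb{R}\text{ is }1\text{-Lipschitz}\}$. For a pyramid, $\operatorname{ObsDiam}(\mathcal{P};-\kappa)=\lim_{\delta\to0+}\sup_{X\in\mathcal{P}}\operatorname{ObsDiam}(X;-(\kappa+\delta))\in[0,+\infty]$. Separation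 distance: for an mm-space $X$ and $\kappa_0,\dots,\kappa_N>0$, $N\ge1$, $\operatorname{Sep}(X;\kappa_0,\dots,\kappa_N)$ is the supremum of $\min_{i\ne j}d_X(A_i,A_j)$ over Borel sets $A_0,\dots,A_N\subset X$ with $\mu_X(A_i)\ge\kappa_i$ for all $i$, where $d_X(A,B)=\inf_{x\in A,y\in B}d_X(x,y)$; it is $0$ if no such sets exist. For a pyramid, $\operatorname{Sep}(\mathcal{P};\kappa_0,\dots,\kappa_N)=\lim_{\delta\to0+}\sup_{X\in\mathcal{P}}\operatorname{Sep}(X;\kappa_0-\delta,\dots,\kappa_N-\delta)\in[0,+\infty]$. $\{\mathcal{P}_n\}$ is an $N$-Lévy family if $\lim_{n\to\infty}\operatorname{Sep}(\mathcal{P}_n;\kappa_0,\dots,\kappa_N)=0$ for any $\kappa_0,\dots,\kappa_N>0$ with $\sum_{i=0}^N\kappa_i<1$. A $1$-Lévy family is called a Lévy family. *)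

(* Defs.v *)
From HB Require Import structures.
From mathcomp Require Import all_boot all_order all_algebra.
From mathcomp Require Import all_classical all_reals all_analysis.

Set Implicit Arguments.
Unset Strict Implicit.
Unset Printing Implicit Defensive.

Import Order.TTheory GRing.Theory Num.Theory.
Import numFieldNormedType.Exports.

Local Open Scope classical_set_scope.
Local Open Scope ring_scope.

#[short(type="completeMetricType")]
HB.structure Definition CompleteMetric (R : numDomainType) :=
  {T of Metric R T & Complete T}.

Definition borel (T : topologicalType) : set (set T) := <<s @open T >>.
Notation borelType T := (g_sigma_algebraType (@open T)).

Definition supp (R : realType) (T : topologicalType) (nu : set T -> \bar R) :
  set T := [set x | forall U, open_nbhs x U -> (0 < nu U)%E].

(* The library's completeness and measurability structures come with a
   distinguished point; it plays no role, and a probability space is never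
   empty. *)
Record mmSpace (R : realType) := MMSpace {
  mm_carrier :> completeMetricType R;
  mm_measure : probability (borelType mm_carrier) R;
  mm_separable : exists2 D : set mm_carrier, countable D & dense D;
  mm_full_supp : supp (mm_measure : set mm_carrier -> \bar R) = setT
}.
Arguments mm_measure {R} _.

Definition lip1 (R : realType) (T U : metricType R) (f : T -> U) :=
  forall x y, mdist (f x) (f y) <= mdist x y.

Definition measure_preserving (R : realType) (X Y : mmSpace R)
    (f : X -> Y) :=
  forall B, borel B ->
    pushforward (mm_measure X) (f : borelType X -> borelType Y) B =
    mm_measure Y B.

(* mm_le Y X: Y is dominated by X. *)
Definition mm_le (R : realType) (Y X : mmSpace R) :=
  exists2 f : X -> Y, lip1 f & measure_preserving f.

Definition mm_iso (R : realType) (X Y : mmSpace R) :=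
  exists f : X -> Y, [/\ bijective f,
    forall x y, mdist (f x) (f y) = mdist x y & measure_preserving f].

(* phi is total on R, but only its values on [0, 1[ matter. *)
Definition parameter (R : realType) (X : mmSpace R) (phi : R -> X) :=
  @measurable_fun _ _ (measurableTypeR R) (borelType X) `[0, 1[ phi /\
  forall B, borel B ->
    lebesgue_measure (`[0, 1[ `&` phi @^-1` B) = mm_measure X B.

Definition box (R : realType) (X Y : mmSpace R) : \bar R :=
  ereal_inf [set e%:E | e in [set e : R | 0 <= e /\
    exists (phi : R -> X) (psi : R -> Y) (I0 : set R),
      [/\ parameter phi, parameter psi,
          measurable (I0 : set (measurableTypeR R)) /\ I0 `<=` `[0, 1[,
          ((1 - e)%:E <= lebesgue_measure I0)%E
        & forall s t, I0 s -> I0 t ->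
            `|mdist (phi s) (phi t) - mdist (psi s) (psi t)| <= e]]].

Definition box_to (R : realType) (X : mmSpace R) (P : set (mmSpace R)) :
  \bar R := ereal_inf [set box X Y | Y in P].

Definition box_closed (R : realType) (P : set (mmSpace R)) :=
  forall X, (forall e : R, 0 < e -> exists2 Y, P Y & (box X Y < e%:E)%E) -> P X.

(* Sets of mm-isomorphism classes are represented by predicates on mm-spaces;
   downward closure under mm_le makes a pyramid invariant under
   mm-isomorphism. *)
Definition pyramid (R : realType) (P : set (mmSpace R)) :=
  [/\ P !=set0, box_closed P,
      forall X Y, P X -> mm_le Y X -> P Y
    & forall X X', P X -> P X' ->
        exists Y, [/\ P Y, mm_le X Y & mm_le X' Y]].

Definition pyramid_of (R : realType) (X : mmSpace R) : set (mmSpace R) :=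
  [set X' | mm_le X' X].

Definition scaled (R : realType) (t : {posnum R}) (X : completeMetricType R) :
  Type := X.

Section scaled_metric.
Context (R : realType) (t : {posnum R}) (X : completeMetricType R).
Implicit Types x y z : X.

Let sdist x y : R := t%:num * mdist x y.

Let sdistxx x : sdist x x = 0.
Proof. by rewrite /sdist mdistxx mulr0. Qed.

Let sdist_positivity x y : sdist x y = 0 -> x = y.
Proof.
by move/eqP; rewrite mulf_eq0 gt_eqF//= => /eqP; exact: mdist_positivity.
Qed.

Let sdist_sym x y : sdist x y = sdist y x.
Proof. by rewrite /sdist metric_sym. Qed.

Let sdist_triangle y x z : sdist x z <= sdist x y + sdist y z.
Proof. by rewrite /sdist -mulrDr ler_pM2l// metric_triangle. Qed.

HB.instance Definition _ := Pointed.on (scaled t X).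
HB.instance Definition _ := @isMetric.Build R (scaled t X)
  sdist sdistxx sdist_positivity sdist_sym sdist_triangle.

Lemma mdist_scaledE x y :
  mdist (x : scaled t X) (y : scaled t X) = t%:num * mdist x y.
Proof. by []. Qed.

Lemma nbhs_scaledE x : nbhs (x : scaled t X) = nbhs x.
Proof.
apply/seteqP; split=> A; rewrite -!filter_from_ballE => -[e /= e0 eA].
  exists (e / t%:num); first by rewrite /= divr_gt0.
  move=> y; rewrite ballEmdist/= => xy; apply: eA.
  by rewrite ballEmdist/= mdist_scaledE mulrC -ltr_pdivlMr.
exists (t%:num * e); first by rewrite /= mulr_gt0.
move=> y; rewrite ballEmdist/= mdist_scaledE ltr_pM2l// => xy; apply: eA.
by rewrite ballEmdist.
Qed.

Lemma open_scaledE : @open (scaled t X) = @open X.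
Proof.
by apply/funext => A; rewrite !openE /interior;
  apply/propext; split=> + x => /(_ x); rewrite nbhs_scaledE.
Qed.

Let scaled_complete (F : set_system (scaled t X)) :
  ProperFilter F -> cauchy F -> cvg F.
Proof.
move=> FF Fc.
have : cauchy (F : set_system X).
  apply/cauchy_ballP => e e0.
  have te0 : 0 < t%:num * e by rewrite mulr_gt0.
  move/cauchy_ballP : Fc => /(_ _ te0); apply: filterS => -[x y]/=.
  by rewrite !ballEmdist/= mdist_scaledE ltr_pM2l.
move=> /cauchy_cvg Fl.
apply: (@cvgP _ F (lim (F : set_system X) : scaled t X)).
by rewrite /cvg_to nbhs_scaledE.
Qed.

HB.instance Definition _ := Uniform_isComplete.Build (scaled t X)
  scaled_complete.

End scaled_metric.

Section scaled_mmSpace.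
Context (R : realType) (t : {posnum R}) (X : mmSpace R).

Definition to_scaled (x : borelType X) : borelType (scaled t X) := x.

Let measurable_to_scaled : measurable_fun setT to_scaled.
Proof.
move=> _ B mB; rewrite setTI; move: mB.
by rewrite /measurable/= open_scaledE.
Qed.

HB.instance Definition _ := @isMeasurableFun.Build _ _ _ _
  to_scaled measurable_to_scaled.

Definition scaled_measure : probability (borelType (scaled t X)) R :=
  distribution (mm_measure X) to_scaled.

Let scaled_separable :
  exists2 D : set (scaled t X), countable D & dense D.
Proof.
have [D cD dD] := mm_separable X; exists D => // U U0.
by rewrite open_scaledE; exact: dD.
Qed.

Let scaled_full_supp :
  supp (scaled_measure : set (scaled t X) -> \bar R) = setT.
Proof.
rewrite -(mm_full_supp X); apply/seteqP; split=> x xU U [oU Ux].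
  have oU' : @open (scaled t X) U by rewrite open_scaledE.
  exact: xU.
have oU' : @open X U by move: oU; rewrite open_scaledE.
exact: xU.
Qed.

Definition mm_scale : mmSpace R := MMSpace scaled_separable scaled_full_supp.

End scaled_mmSpace.

Definition pyramid_scale (R : realType) (t : {posnum R})
    (P : set (mmSpace R)) : set (mmSpace R) :=
  [set Y | exists2 X, P X & mm_iso (mm_scale t X) Y].

Definition weakly_converges (R : realType) (Pn : nat -> set (mmSpace R))
    (P : set (mmSpace R)) :=
  (forall X, P X -> box_to X (Pn n) @[n --> \oo] --> 0%E) /\
  (forall X, ~ P X -> (0 < limn_einf (fun n => box_to X (Pn n)))%E).

(* The added 0 makes the diameter of the empty set 0 rather than -oo. *)
Definition diam (R : realType) (T : metricType R) (A : set T) : \bar R :=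
  ereal_sup (0%E |` [set (mdist x y)%:E | x in A & y in A]).

Definition partial_diam (R : realType) (T : metricType R)
    (nu : set T -> \bar R) (alpha : R) : \bar R :=
  ereal_inf [set diam A | A in [set A | borel A /\ (alpha%:E <= nu A)%E]].

(* ObsDiam(X; -kappa); R^o carries the distance |y - x|. *)
Definition obs_diam (R : realType) (X : mmSpace R) (kappa : R) : \bar R :=
  ereal_sup [set partial_diam
      (pushforward (mm_measure X) (f : borelType X -> borelType R^o)
        : set R^o -> \bar R) (1 - kappa)
    | f in [set f : X -> R^o | lip1 f]].

(* ObsDiam(P; -kappa). *)
Definition pyramid_obs_diam (R : realType) (P : set (mmSpace R)) (kappa : R) :
    \bar R :=
  lim (ereal_sup [set obs_diam X (kappa + delta) | X in P]
    @[delta --> 0^'+]).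

Definition set_dist (R : realType) (T : metricType R) (A B : set T) :
  \bar R := ereal_inf [set (mdist x y)%:E | x in A & y in B].

(* Distances being nonnegative, the added 0 only matters when there are no
   admissible sets. *)
Definition sep (R : realType) (X : mmSpace R) (N : nat)
    (kappa : 'I_N.+1 -> R) : \bar R :=
  ereal_sup (0%E |`
    [set \big[mine/+oo%E]_(ij : 'I_N.+1 * 'I_N.+1 | ij.1 != ij.2)
        set_dist (A ij.1) (A ij.2)
    | A in [set A : 'I_N.+1 -> set X |
        forall i, borel (A i) /\ ((kappa i)%:E <= mm_measure X (A i))%E]]).

Definition pyramid_sep (R : realType) (P : set (mmSpace R)) (N : nat)
    (kappa : 'I_N.+1 -> R) : \bar R :=
  lim (ereal_sup [set sep X (fun i => kappa i - delta) | X in P]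
    @[delta --> 0^'+]).

Definition levy_family (R : realType) (N : nat)
    (P : nat -> set (mmSpace R)) :=
  forall kappa : 'I_N.+1 -> R, (forall i, 0 < kappa i) ->
    \sum_i kappa i < 1 -> pyramid_sep (P n) kappa @[n --> \oo] --> 0%E.

(* Main.v *)
From HB Require Import structures.
Require Import Defs.
From mathcomp Require Import all_boot all_order all_algebra.
From mathcomp Require Import all_classical all_reals all_analysis.
From mathcomp Require Import measurable_realfun lra.

                                                                               
                                                                           
                                                                                
                                                                             
                                                                      
                                                                             
                                                                                
                                                                        
                                                                                
                                                                                      
                                                                               
                                                                       
                                                                               
                                                                             
                                                                             
                                                                          
                                                                         
                         

Set Implicit Arguments.
Unset Strict Implicit.
Unset Printing Implicit Defensive.

Import Order.TTheory GRing.Theory Num.Theory.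
Import numFieldNormedType.Exports.

Local Open Scope classical_set_scope.
Local Open Scope ring_scope.

                                       

(** Suppose the family is not a Lévy family. Then there are r, c > 0 such that infinitely many of
    the pyramids contain a space with two Borel sets of mass at least r at distance at least c
    ([has_clusters]), while the N-Lévy condition eventually forbids N+1 such sets, whatever the mass
    and the distance. An ultrafilter on the indices is fixed that contains the indices of the first
    kind. Finiteness of the observable diameter makes the largest distance between two sets of mass
    r, the [width], finite. For some r this width dominates the widths for all other masses up to
    constants ([exists_scale]): otherwise [far_cluster] would add one cluster after another until
    there are N+1. Each pyramid is divided by the maximum of 1 and this width. The largest k for
    which k clusters survive at some fixed mass and distance satisfies 2 <= k <= N, and then no k+1
    clusters survive at any fixed mass and distance ([exists_selection]).

    Since no cluster can be split further, every 1-Lipschitz function is nearly constant on each of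
    the k clusters ([med_concentration]), so a cluster behaves like a point. The distance between
    two clusters is [rho], the supremum over 1-Lipschitz functions of the difference of their
    medians. It is bounded, and it can only grow when clusters are pulled back to a dominating
    space. Clusters that nearly maximise the sum of all [rho] ([exists_good]) therefore have
    distances that are almost final: no dominating space in the pyramid increases them by more than
    a small error. Along a subsequence the distances and the masses converge
    ([exists_good_subsequence]) and define a finite mm-space X with k points ([good_metric_data],
    [exists_finite_mm]).

    Weak convergence has two halves. For X' dominated by X, nearly optimal functions for [rho] yield
    1-Lipschitz coordinates on the space that carries the clusters; the metric they induce is
    smaller than the original one and box-close to X' ([good_box_to_le]). Conversely, let X1 be a
    box-limit of members of the pyramids along a subsequence. It has at most k points. In a common
    dominating space each cluster lies almost entirely over one point of X1, and near maximality of
    [rho] bounds the distances of these points by those of X. Sending clusters to points thus shows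
    that X dominates X1 ([good_dominated]). *)

(** * Real-valued masses of measurable sets *)

Section mass.
Context d (T : measurableType d) (R : realType) (P : probability T R).
Implicit Types A B : set T.

Definition mass A : R := fine (P A).

Lemma massE A : measurable A -> P A = (mass A)%:E.
Proof. by move=> mA; rewrite /mass fineK// fin_num_measure. Qed.

Lemma mass_ge0 A : 0 <= mass A.
Proof. by rewrite /mass fine_ge0. Qed.

Lemma massT : mass setT = 1.
Proof. by rewrite /mass probability_setT. Qed.

Lemma mass0 : mass set0 = 0.
Proof. by rewrite /mass measure0. Qed.

Lemma le_mass A B : measurable A -> measurable B -> A `<=` B ->
  mass A <= mass B.
Proof.
move=> mA mB AB; rewrite -lee_fin -!massE//.
by apply: le_measure => //; rewrite inE.
Qed.

Lemma mass_le1 A : measurable A -> mass A <= 1.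
Proof. by move=> mA; rewrite -massT; apply: le_mass. Qed.

Lemma massU A B : measurable A -> measurable B -> A `&` B = set0 ->
  mass (A `|` B) = mass A + mass B.
Proof.
move=> mA mB AB; apply: EFin_inj; rewrite EFinD -!massE//.
  exact: measureU.
exact: measurableU.
Qed.

Lemma mass_subU A B : measurable A -> measurable B ->
  mass (A `|` B) <= mass A + mass B.
Proof.
move=> mA mB; have -> : A `|` B = A `|` (B `\` A).
  by rewrite setDE setUIr setUCr setIT.
have mBA : measurable (B `\` A) by exact: measurableD.
rewrite massU//; last by rewrite setDE setIC -setIA setICl setI0.
by rewrite lerD2l le_mass.
Qed.

Lemma massD A B : measurable A -> measurable B ->
  mass (A `\` B) = mass A - mass (A `&` B).
Proof.
move=> mA mB; apply/eqP; rewrite eq_sym subr_eq; apply/eqP.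
rewrite -massU//; first by rewrite setUC setUIDK.
- exact: measurableD.
- exact: measurableI.
- by rewrite setDE -setIA [X in _ `&` X]setIC -setIA setICr !setI0.
Qed.

Lemma massC A : measurable A -> mass (~` A) = 1 - mass A.
Proof. by move=> mA; rewrite -setTD massD// massT setTI. Qed.

Lemma mass_bigsetU (I : Type) (r : seq I) (p : pred I) (A : I -> set T) :
  (forall i, measurable (A i)) ->
  mass (\big[setU/set0]_(i <- r | p i) A i) <= \sum_(i <- r | p i) mass (A i).
Proof.
move=> mA; elim: r => [|i r ih]; first by rewrite !big_nil mass0.
rewrite !big_cons; case: ifPn => // _.
rewrite (le_trans (mass_subU _ _))//; last by rewrite lerD2l.
exact: bigsetU_measurable.
Qed.

Lemma mass_bigsetU_disj n (p : pred 'I_n) (A : 'I_n -> set T) :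
  (forall i, measurable (A i)) ->
  (forall i j, i != j -> A i `&` A j = set0) ->
  mass (\big[setU/set0]_(i < n | p i) A i) = \sum_(i < n | p i) mass (A i).
Proof.
move=> mA dA; rewrite big_mkcond [RHS]big_mkcond/=.
pose B i := if p i then A i else set0.
have mB i : measurable (B i) by rewrite /B; case: ifP.
have mU : measurable (\big[setU/set0]_(i < n) B i) by exact: bigsetU_measurable.
apply: EFin_inj; rewrite -/(B _) -massE// measure_semi_additive_ord//.
  rewrite -sumEFin; apply: eq_bigr => i _.
  by apply: etrans (massE (mB i)) _; rewrite /B; case: ifP => //; rewrite mass0.
apply/trivIsetP => i j _ _ ij; rewrite /B.
by case: ifP; rewrite ?set0I//; case: ifP; rewrite ?setI0// => _ _; exact: dA.
Qed.

Lemma mass_bigcup_le (A : (set T)^nat) (c : R) : (forall n, measurable (A n)) ->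
  nondecreasing_seq A -> (forall n, mass (A n) <= c) ->
  mass (\bigcup_n A n) <= c.
Proof.
move=> mA ndA Ac; have mU : measurable (\bigcup_n A n)
  by exact: bigcup_measurable.
rewrite -lee_fin -massE//.
have cA : P (A n) @[n --> \oo] --> P (\bigcup_n A n).
  exact: nondecreasing_cvg_mu.
rewrite -(cvg_lim _ cA)//; apply: lime_le; first by apply/cvg_ex;
  exists (P (\bigcup_n A n)).
by apply: nearW => n; apply: le_trans (_ : ((mass (A n))%:E <= _)%E);
  rewrite ?lee_fin// -massE.
Qed.

Lemma mass_bigcap_ge (A : (set T)^nat) (c : R) : (forall n, measurable (A n)) ->
  nonincreasing_seq A -> (forall n, c <= mass (A n)) ->
  c <= mass (\bigcap_n A n).
Proof.
move=> mA niA cA.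
have mI : measurable (\bigcap_n A n) by exact: bigcap_measurable.
rewrite -[A](_ : (fun n => ~` (~` A n)) = A); last by apply/funext => n;
  rewrite setCK.
rewrite -setC_bigcup massC; last by apply: bigcup_measurable => n _;
  exact: measurableC.
rewrite lerBrDr addrC -lerBrDr; apply: mass_bigcup_le.
- by move=> n; exact: measurableC.
- by move=> m n mn; apply/subsetPset; apply: subsetC; apply/subsetPset;
    exact: niA.
- by move=> n; rewrite massC// lerD2l lerN2.
Qed.

End mass.

                  

(** * Quantiles and the uniform law *)

Lemma exists_nat_gt (R : realType) (x : R) : exists n : nat, x < n%:R.
Proof.
exists (Num.bound `|x|); apply: le_lt_trans (ler_norm x) _.
exact: archi_boundP.
Qed.

Lemma exists_invS_lt (R : realType) (e : R) : 0 < e ->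
  exists n : nat, n.+1%:R^-1 < e.
Proof.
move=> e0; have [n en] := exists_nat_gt e^-1; exists n.
rewrite -[ltRHS]invrK ltf_pV2 ?posrE ?invr_gt0//.
by rewrite (lt_trans en)// ltr_nat.
Qed.

Section quantile.
Context d (T : measurableType d) (R : realType) (P : probability T R).
Variables (A : set T) (f : T -> R).
Hypotheses (mA : measurable A) (mf : forall a, measurable [set x | f x <= a]).

Definition distr_fun a : R := mass P (A `&` [set x | f x <= a]).

Definition quantile s : R := inf [set a | s <= distr_fun a].

Let mAf a : measurable (A `&` [set x | f x <= a]).
Proof. exact: measurableI. Qed.

Lemma le_distr_fun a b : a <= b -> distr_fun a <= distr_fun b.
Proof.
move=> ab; apply: le_mass => //; apply: setIS => x /= /le_trans; exact.
Qed.

Let distr_fun_unbounded s : s < mass P A -> exists n : nat, s <= distr_fun n%:R.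
Proof.
move=> sA; apply/not_existsP => h; move: sA; apply/negP; rewrite -leNgt.
rewrite [X in mass _ X](_ : _ = \bigcup_n (A `&` [set x | f x <= n%:R])).
  apply: mass_bigcup_le => //.
    move=> m n mn; apply/subsetPset; apply: setIS => x /= /le_trans; apply.
    by rewrite ler_nat.
  by move=> n; rewrite leNgt; apply/negP => /ltW; exact: h.
apply/seteqP; split => [x Ax|x [n _ []//]].
by have [n /ltW fn] := exists_nat_gt (f x); exists n.
Qed.

Let distr_fun_small s : 0 < s -> exists n : nat, distr_fun (- n%:R) < s.
Proof.
move=> s0; apply/not_existsP => h; move: s0; apply/negP; rewrite -leNgt.
rewrite -(mass0 P) [X in mass _ X](_ : _ = \bigcap_n (A `&` [set x | f x <= -
  n%:R])).
  apply: mass_bigcap_ge => //.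
    move=> m n mn; apply/subsetPset; apply: setIS => x /= /le_trans; apply.
    by rewrite lerN2 ler_nat.
  by move=> n; rewrite leNgt; apply/negP; exact: h.
apply/esym; rewrite -subset0 => x /= fx.
have [n fn] := exists_nat_gt (- f x).
by have [_ /=] := fx n Logic.I; rewrite lerNr leNgt fn.
Qed.

(** The distribution function is right continuous, so the infimum defining the quantile is attained.
    The bounds on [s] make the set under the infimum nonempty and bounded below. *)
Lemma quantile_le s a : 0 < s < mass P A ->
  (quantile s <= a) = (s <= distr_fun a).
Proof.
move=> /andP[s0 sA].
have hlb : has_lbound [set a | s <= distr_fun a].
  have [n hn] := distr_fun_small s0; exists (- n%:R) => b /= sb.
  rewrite leNgt; apply/negP => /ltW/le_distr_fun/(le_trans sb).
  by rewrite leNgt hn.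
have hin : has_inf [set a | s <= distr_fun a].
  by split => //; have [n hn] := distr_fun_unbounded sA; exists n%:R.
apply/idP/idP => [qa|sa]; last exact: ge_inf.
rewrite /distr_fun.
rewrite (_ : _ `&` _ = \bigcap_n (A `&` [set x | f x <= a + n.+1%:R^-1])).
  apply: mass_bigcap_ge => //.
    move=> m n mn; apply/subsetPset; apply: setIS => x /= /le_trans; apply.
    by rewrite lerD2l lef_pV2 ?posrE// ler_nat.
  move=> n.
  have n0 : 0 < n.+1%:R^-1 :> R by rewrite invr_gt0.
  have [b /= sb bq] := inf_adherent n0 hin.
  rewrite (le_trans sb)// -/(distr_fun _) le_distr_fun// ltW//.
  by rewrite (lt_le_trans bq)// lerD2r.
apply/seteqP; split => [x [Ax fx] n _|x fx].
  by split => //=; rewrite (le_trans fx)// lerDl.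
split; first by have [] := fx 0%N Logic.I.
apply/ler_addgt0Pl => e e0.
have [n ne] := exists_invS_lt e0; have [_ /= h] := fx n Logic.I.
by rewrite (le_trans h)// addrC lerD2r ltW.
Qed.

Lemma quantile_gt s a : 0 < s < mass P A ->
  (a < quantile s) = (distr_fun a < s).
Proof. by move=> s01; rewrite ltNge quantile_le// -ltNge. Qed.

Lemma mass_lt_quantile s : 0 < s < mass P A ->
  mass P (A `&` [set x | f x < quantile s]) <= s.
Proof.
move=> s01; set q := quantile s.
rewrite (_ : _ `&` _ = \bigcup_n (A `&` [set x | f x <= q - n.+1%:R^-1])).
  apply: mass_bigcup_le => //.
    move=> m n mn; apply/subsetPset; apply: setIS => x /= /le_trans; apply.
    by rewrite lerD2l lerN2 lef_pV2 ?posrE// ler_nat.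
  move=> n; rewrite leNgt; apply/negP => /ltW.
  by rewrite -quantile_le// -/q leNgt ltrBlDr ltrDl invr_gt0 ltr0n.
apply/seteqP; split => [x [Ax /= fq]|x [n _ [Ax /= fq]]]; last first.
  by split => //=; rewrite (le_lt_trans fq)// ltrBlDr ltrDl invr_gt0.
have qx0 : 0 < q - f x by rewrite subr_gt0.
have [n nx] := exists_invS_lt qx0; exists n => //.
by split => //=; rewrite lerBrDr -lerBrDl ltW.
Qed.

End quantile.

Section unif01.
Context (R : realType).

Let m01 : measurable (`[0, 1[%classic : set (measurableTypeR R)).
Proof. exact: measurable_itv. Qed.

(** The uniform law is a probability on the whole line carried by [[0, 1[], matching parameters,
    which are total functions on [R]. *)
Definition unif01 : set (measurableTypeR R) -> \bar R :=
  mrestr lebesgue_measure m01.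

HB.instance Definition _ := Measure.on unif01.

Let unif01_setT : unif01 setT = 1%E.
Proof.
by rewrite /unif01 /mrestr setTI lebesgue_measure_itv/= lte01 sube0.
Qed.

HB.instance Definition _ := Measure_isProbability.Build _ _ _ unif01
  unif01_setT.

Lemma unif01E A : unif01 A = lebesgue_measure (`[0, 1[ `&` A).
Proof. by rewrite /unif01 /mrestr setIC. Qed.

End unif01.
Arguments unif01 R A : clear implicits.

Section quantile_transform.
Context d (T : measurableType d) (R : realType) (P : probability T R).
Variables (g : {mfun T >-> measurableTypeR R}).

Let mg a : measurable [set x | g x <= a].
Proof.
rewrite -[X in measurable X]setTI -[X in _ `&` X](preimage_itvNyc g).
by apply: measurable_funPT => //; exact: measurable_itv.
Qed.

Let q (s : measurableTypeR R) : measurableTypeR R :=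
  if (0 < s < 1) then quantile P setT g s else 0.

Let q_gt a : q @^-1` `]a, +oo[ =
  (`]0, 1[ `&` `]distr_fun P setT g a, +oo[) `|`
  (~` `]0, 1[ `&` (if 0 > a then setT else set0)).
Proof.
apply/seteqP; split => s /=; rewrite /q !in_itv/= !andbT.
  case: ifPn => s01.
    by rewrite quantile_gt ?massT// => ?; left.
  by move=> ->; right.
case=> [[s01]|[]]; first by rewrite s01 quantile_gt ?massT.
by move=> /negP/negbTE ->; case: ifP.
Qed.

Let mq : measurable_fun setT q.
Proof.
apply: (measurability _ (RGenOInfty.measurableE R)) => _ [_ [a ->] <-].
rewrite setTI q_gt; apply: measurableU; apply: measurableI => //.
- by apply: measurableC; exact: measurable_itv.
- by case: ifP.
Qed.

(** Inverse transform sampling: the quantile exceeds [a] exactly on the interval from F(a) to 1,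
    whose length is 1 - F(a), and the rays form a generating family stable under intersection. *)
Lemma quantile_transform : exists2 h : measurableTypeR R -> measurableTypeR R,
  measurable_fun setT h &
  forall B, measurable B -> unif01 R (h @^-1` B) = P (g @^-1` B).
Proof.
pose q' : {mfun measurableTypeR R >-> measurableTypeR R} :=
  HB.pack q (isMeasurableFun.Build _ _ _ _ q mq).
exists q => // B mB.
pose m1 := distribution (unif01 R) q'.
pose m2 := distribution P g.
change (m1 B = m2 B).
apply: (@measure_unique _ R (measurableTypeR R) (@RGenOInfty.G R)
  (fun n => `]- n%:R, +oo[%classic) _ _ _ _ m1 m2) => //.
- exact: (RGenOInfty.measurableE R).
- move=> _ _ [a ->] [b ->]; exists (Num.max a b).
  apply/seteqP; split => x; rewrite /= !in_itv/= !andbT gt_max;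
    first by case=> -> ->.
  by move=> /andP[].
- by move=> n; exists (- n%:R).
- rewrite -subTset => x _; have [n xn] := exists_nat_gt (- x).
  by exists n => //=; rewrite in_itv/= andbT ltrNl.
- move=> _ [a ->]; 
  change (unif01 R (q @^-1` `]a, +oo[) = P (g @^-1` `]a, +oo[)).
  rewrite q_gt.
  rewrite [in RHS](_ : _ @^-1` _ = ~` [set x | g x <= a]); last first.
    by apply/seteqP; split => x /=; rewrite in_itv/= andbT ltNge => /negP.
  rewrite massE; last exact: measurableC.
  rewrite massC// -[X in mass P X]setTI -/(distr_fun P setT g a).
  set F := distr_fun P setT g a.
  have F01 : 0 <= F <= 1 by rewrite mass_ge0 mass_le1//; exact: measurableI.
  have /andP[F0 F1] := F01.
  have E1 : lebesgue_measure (`]F, 1[%classic : set R) = (1 - F)%:E.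
    by rewrite lebesgue_measure_itv/= lte_fin; case: ltgtP F1 => // ->;
      rewrite subrr.
  apply/eqP; rewrite eq_le; apply/andP; split; last first.
    rewrite -E1 unif01E; apply: le_measure; rewrite ?inE.
    - exact: measurable_itv.
    - apply: measurableI; first exact: measurable_itv.
      by rewrite -q_gt -[X in measurable X]setTI; apply: mq => //;
        exact: measurable_itv.
    - move=> s /=; rewrite !in_itv/= andbT => /andP[Fs s1].
      by rewrite (le_trans F0 (ltW Fs)) s1 (le_lt_trans F0 Fs) Fs; split => //;
        left.
  (* The point 0, where the quantile has its default value, may belong to the preimage as well, but
     it is null. *)
  rewrite -[leRHS]adde0 -(lebesgue_measure_set1 (0 : R)) -E1 unif01E.
  rewrite (le_trans _ (measureU2 _ _ _))//.
  apply: le_measure; rewrite ?inE.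
  - apply: measurableI; first exact: measurable_itv.
    by rewrite -q_gt -[X in measurable X]setTI; apply: mq => //;
      exact: measurable_itv.
  - by apply: measurableU => //; exact: measurable_itv.
  - move=> s /=; rewrite !in_itv/= andbT => -[/andP[s0 s1]].
    case=> [[_ Fs]|[/negP]]; first by left; rewrite Fs.
    by rewrite s1 andbT -leNgt => s0'; right; apply/eqP; rewrite eq_le s0 s0'.
- by move=> n; rewrite (le_lt_trans (probability_le1 _ _))// ?ltry//;
    exact: measurable_itv.
Qed.
End quantile_transform.

                                

(** * Coding points by real numbers, and existence of parameters *)

Section digits.
Context (R : realType).
Implicit Types (b : nat -> bool) (x : R).

                                                                             
                                                               
(** Binary sequences are written in base 4 with digits 0 and 1 only. The digits after the first
    contribute at most 1/12, so comparison with 1/4 recovers the first digit without the ambiguity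
    of binary expansions. *)
Definition digit_sum b n : R := \sum_(i < n) (b i)%:R / 4 ^+ i.+1.

Definition from_digits b : R := sup (range (digit_sum b)).

Definition digit0 x := 4^-1 <= x.
Definition digit_tail x := 4 * x - (digit0 x)%:R.
Definition digit m x := digit0 (iter m digit_tail x).

Lemma digit_sumS b n :
  digit_sum b n.+1 = (b 0%N)%:R / 4 + digit_sum (b \o S) n / 4.
Proof.
rewrite /digit_sum big_ord_recl expr1 mulr_suml; congr (_ + _).
by apply: eq_bigr => i _; rewrite /= /bump /= add1n -mulrA -invfM -exprSr.
Qed.

Lemma digit_sum_bound b n : 0 <= digit_sum b n <= 3^-1.
Proof.
elim: n b => [|n ih] b; first by rewrite /digit_sum big_ord0; lra.
rewrite digit_sumS; have := ih (b \o S); case: (b 0%N) => /=; lra.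
Qed.

Lemma cvg_digit_sum b : digit_sum b n @[n --> \oo] --> from_digits b.
Proof.
apply: nondecreasing_cvgn.
  apply/nondecreasing_seqP => n; rewrite /digit_sum big_ord_recr lerDl.
  by rewrite divr_ge0// exprn_ge0.
by exists 3^-1 => _ [n _ <-]; have /andP[] := digit_sum_bound b n.
Qed.

Lemma from_digits_bound b : 0 <= from_digits b <= 3^-1.
Proof.
have c := @cvg_digit_sum b; rewrite -(cvg_lim _ c)//; apply/andP; split.
  by apply: limr_ge; [apply/cvg_ex; eexists; exact: c|
    apply: nearW => n; have /andP[] := digit_sum_bound b n].
by apply: limr_le; [apply/cvg_ex; eexists; exact: c|
  apply: nearW => n; have /andP[] := digit_sum_bound b n].
Qed.

Lemma from_digitsS b :
  from_digits b = (b 0%N)%:R / 4 + from_digits (b \o S) / 4.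
Proof.
have := @cvg_digit_sum b; rewrite -cvg_shiftS => c.
have c' : digit_sum b n.+1 @[n --> \oo] -->
    (b 0%N)%:R / 4 + from_digits (b \o S) / 4.
  under eq_fun do rewrite digit_sumS.
  by apply: cvgD; [exact: cvg_cst|apply: cvgM;
    [exact: (@cvg_digit_sum (b \o S))|exact: cvg_cst]].
exact: (cvg_unique _ c c').
Qed.

Lemma digit0_from_digits b : digit0 (from_digits b) = b 0%N.
Proof.
rewrite /digit0 from_digitsS; have := from_digits_bound (b \o S).
case: (b 0%N) => /= h; [apply/idP|apply/negP => ?]; lra.
Qed.

Lemma digit_tail_from_digits b : digit_tail (from_digits b) = from_digits (b \o
  S).
Proof. by rewrite /digit_tail digit0_from_digits from_digitsS; lra. Qed.

Lemma digit_from_digits b m : digit m (from_digits b) = b m.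
Proof.
rewrite /digit; elim: m b => [|m ih] b; first exact: digit0_from_digits.
by rewrite iterSr digit_tail_from_digits ih.
Qed.

Lemma measurable_digit m : measurable [set x : measurableTypeR R | digit m x].
Proof.
have m0 : measurable [set x : measurableTypeR R | digit0 x].
  rewrite (_ : [set x | _] = `[4^-1, +oo[%classic); first exact: measurable_itv.
  by apply/seteqP; split => x; rewrite /= in_itv/= andbT.
have mt : measurable_fun setT (digit_tail : measurableTypeR R ->
  measurableTypeR R).
  apply: measurable_funB; first exact: mulrl_measurable.
  rewrite (_ : (fun x => _) = \1_[set x : measurableTypeR R | digit0 x]).
    exact: measurable_indic.
  apply/funext => x; rewrite indicE; congr (_%:R); congr nat_of_bool.
  by apply/idP/idP; rewrite inE.
have mi : measurable_fun setT (iter m digit_tail : measurableTypeR R ->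
  measurableTypeR R).
  elim: m => [|m ih]; first exact: measurable_id.
  exact: (measurableT_comp mt ih).
by have := mi measurableT _ m0; rewrite setTI.
Qed.

Lemma measurable_from_digits d (T : measurableType d) (b : T -> nat -> bool) :
  (forall m, measurable [set z | b z m]) ->
  measurable_fun setT (fun z => from_digits (b z) : measurableTypeR R).
Proof.
move=> mb; apply: (measurable_fun_cvg (h := fun n z => digit_sum (b z) n)).
  move=> n; rewrite /digit_sum; apply: measurable_sum => i.
  apply: measurable_funM; last exact: measurable_cst.
  rewrite (_ : (fun z : T => (b z i)%:R) = \1_[set x | b x i] :> (T -> R)).
    exact: measurable_indic.
  apply/funext => x; rewrite indicE; congr (_%:R); congr nat_of_bool.
  by apply/idP/idP; rewrite inE.
by move=> z _; exact: cvg_digit_sum.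
Qed.

End digits.

Lemma exists_exp_half_lt (R : realType) (e : R) : 0 < e ->
  exists n : nat, 2^-1 ^+ n < e.
Proof.
move=> e0; have [n ne] := exists_invS_lt e0; exists n.+1.
rewrite (le_lt_trans _ ne)// exprVn lef_pV2 ?posrE ?exprn_gt0 ?ltr0n//.
by rewrite -natrX ler_nat ltnW// ltn_expl.
Qed.

Section countable_valued.
Context d (T : measurableType d).

Lemma measurable_countable_valued2 (u v : T -> nat) (C : nat -> nat -> Prop) :
  (forall k, measurable [set x | u x = k]) ->
  (forall k, measurable [set x | v x = k]) ->
  measurable [set x | C (u x) (v x)].
Proof.
move=> mu mv; rewrite (_ : [set x | _] = \bigcup_a \bigcup_b
    (if pselect (C a b) then [set x | u x = a] `&` [set x | v x = b] else
      set0)).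
  apply: bigcup_measurable => a _; apply: bigcup_measurable => b _.
  case: (pselect (C a b)) => [Cab|nCab] /=; first exact: measurableI.
  exact: measurable0.
apply/seteqP; split => [x /= Cx|x [a _] [b _]]; last first.
  by case: (pselect (C a b)) => [Cab /= [-> ->]|].
by exists (u x) => //; exists (v x) => //; case: pselect.
Qed.

(** Measurable selection of an index: [u x] is the least one that qualifies, and 0 if none does. *)
Lemma measurable_least (e : T -> nat -> bool) :
  (forall m, measurable [set x | e x m]) ->
  exists2 u : T -> nat, (forall k, measurable [set x | u x = k]) &
    forall x, (exists m, e x m) -> e x (u x).
Proof.
move=> me.
pose u x := if pselect (exists m, e x m) is left h then ex_minn h else 0%N.
exists u; last by move=> x h; rewrite /u; case: pselect => // h';
  case: ex_minnP.
have mn (p : pred nat) : measurable (\bigcap_(i in [set i | p i]) ~` [set x | e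
  x i]).
  by apply: bigcap_measurableType => i _; exact: measurableC.
move=> k; rewrite (_ : [set x | _] =
  ([set x | e x k] `&` \bigcap_(i in [set i | (i < k)%N]) ~` [set x | e x i])
    `|`
  (if k == 0%N then \bigcap_(i in [set i | predT i]) ~` [set x | e x i] else
    set0)).
  apply: measurableU; last by case: ifP.
  by apply: measurableI.
apply/seteqP; split => x /=.
  rewrite /u; case: pselect => [h|h] /=.
    case: ex_minnP => m em mmin <-; left; split => // i /= im ei.
    by have := mmin _ ei; rewrite leqNgt im.
  by move=> <- /=; right => i _ /= ei; apply: h; exists i.
case=> [[ek hk]|].
  rewrite /u; case: pselect => [h|h]; last by exfalso; apply: h; exists k.
  case: ex_minnP => m em mmin; apply/eqP; rewrite eqn_leq mmin//= leqNgt.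
  by apply/negP => mk; exact: (hk m mk).
case: ifP => // /eqP -> h; rewrite /u; case: pselect => // -[m em].
by exfalso; exact: (h m).
Qed.

End countable_valued.

Lemma open_mdist_lt (R : realType) (Z : metricType R) (x : Z) (e : R) :
  open [set z | mdist z x < e].
Proof.
rewrite openE => z /= zx; rewrite /interior -filter_from_ballE.
exists (e - mdist z x); first by rewrite /= subr_gt0.
move=> y; rewrite ballEmdist/= metric_sym ltrBrDr; apply: le_lt_trans.
exact: metric_triangle.
Qed.

Lemma dense_sequence (R : realType) (Z : mmSpace R) :
  exists d : nat -> Z, forall z (e : R), 0 < e -> exists j, mdist z (d j) < e.
Proof.
have [D cD dD] := mm_separable Z.
have /countable_injP[f finj] := cD.
exists (fun n => xget point [set z | D z /\ f z = n]) => z e e0.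
have z0 : [set y | mdist y z < e] !=set0 by exists z; rewrite /= mdistxx.
have [y [By Dy]] := dD _ z0 (open_mdist_lt z e).
exists (f y); case: xgetP => [w _ [Dw fw]|/(_ y)]; last by case.
have -> : w = y by apply: finj => //; rewrite inE.
by rewrite metric_sym.
Qed.

Lemma geometric_cauchy_cvg (R : realType) (Z : completeMetricType R)
    (u : nat -> Z) :
  (forall n, mdist (u n) (u n.+1) <= 2 * 2^-1 ^+ n) ->
  exists l, forall n, mdist (u n) l <= 4 * 2^-1 ^+ n.
Proof.
move=> hu.
have hn0 n : 0 < 2^-1 ^+ n :> R by rewrite exprn_gt0.
have step n k : mdist (u n) (u (n + k)%N) <= 4 * (2^-1 ^+ n - 2^-1 ^+ (n + k)).
  elim: k => [|k ih]; first by rewrite addn0 mdistxx subrr mulr0.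
  rewrite (le_trans (metric_triangle _ (u (n + k)%N) _))// addnS.
  have := hu (n + k)%N; have := hn0 (n + k)%N; rewrite exprS; lra.
have hc : cauchy (u @ \oo).
  apply: cauchy_exP => e e0.
  have e4 : 0 < e / 4 by rewrite divr_gt0.
  have [n hn] := exists_exp_half_lt e4.
  exists (u n), n => // m /= nm; rewrite ballEmdist /=.
  rewrite -(subnKC nm) (le_lt_trans (step _ _))//.
  have := hn0 (n + (m - n))%N; have := hn; lra.
have /cvg_ex[l ul] : cvg (u @ \oo) by exact: cauchy_cvg.
exists l => n; apply/ler_addgt0Pl => e e0.
have := ul (ball l e) (nbhsx_ballx _ _ e0) => -[m _ hm].
have /= := hm (maxn m n) (leq_maxl _ _); rewrite ballEmdist/= => hme.
rewrite (le_trans (metric_triangle _ (u (maxn m n)) _))//.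
have := step n (maxn m n - n)%N; rewrite subnKC ?leq_maxr//.
rewrite [mdist _ l]metric_sym.
have := hn0 (maxn m n); move: hme; lra.
Qed.

Section borel_retract.
Context (R : realType) (Z : mmSpace R).

                                                                               
                                                                                
                                                                           
                                                
(** The digits of [g z] record, for all n and j, whether z is within 2^-n of the j-th point of a
    dense sequence. Conversely, [h] reads from a real number a sequence of approximating points and
    takes its limit, which exists by completeness. So Z is a Borel retract of the line, and sampling
    from Z reduces to sampling from a law on the line. *)
Lemma borel_retract : exists (g : borelType Z -> measurableTypeR R)
    (h : measurableTypeR R -> borelType Z),
  [/\ measurable_fun setT g, measurable_fun setT h & cancel g h].
Proof.
have [d dd] := dense_sequence Z.
have hn0 n : 0 < 2^-1 ^+ n :> R by rewrite exprn_gt0.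
have mball (x : Z) (e : R) : measurable ([set z | mdist z x < e] : set
  (borelType Z)).
  by apply: sub_sigma_algebra; exact: open_mdist_lt.
pose b (z : borelType Z) m : bool :=
  if (unpickle m : option (nat * nat)) is Some (n, j)
  then mdist (z : Z) (d j) < 2^-1 ^+ n else false.
pose g z : measurableTypeR R := from_digits R (b z).
have mg : measurable_fun setT g.
  apply: measurable_from_digits => m; rewrite /b.
  case: (unpickle m) => [[n j]|] /=; first exact: mball.
  by rewrite (_ : [set _ | _] = set0)//; apply/seteqP; split.
pose e (n : nat) (x : measurableTypeR R) (j : nat) := digit (pickle (n, j)) x.
have eg n z j : e n (g z) j = (mdist (z : Z) (d j) < 2^-1 ^+ n).
  by rewrite /e /g digit_from_digits /b pickleK.
have me n m : measurable [set x | e n x m] by exact: measurable_digit.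
pose J_ n := cid2 (measurable_least (me n)).
pose J n := s2val (J_ n).
have mJ n k : measurable [set x | J n x = k] by exact: (s2valP (J_ n)).
have eJ n x : (exists m, e n x m) -> e n x (J n x) by exact: (s2valP' (J_ n)).
(* A new approximation is accepted only if it is close to the previous one. This keeps the sequence
   Cauchy for every real [x], also for those that code no point; for codes of points the test always
   succeeds. *)
pose fix K (n : nat) (x : measurableTypeR R) {struct n} : nat := if n is n'.+1
  then
  if mdist (d (K n' x)) (d (J n x)) <= 2 * 2^-1 ^+ n' then J n x else K n' x
  else J 0%N x.
have mK n k : measurable [set x | K n x = k].
  elim: n k => [|n ih] k; first exact: mJ.
  exact: (measurable_countable_valued2 (fun a c =>
    (if mdist (d a) (d c) <= 2 * 2^-1 ^+ n then c else a) = k) ih (mJ n.+1)).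
have hK x n : mdist (d (K n x)) (d (K n.+1 x)) <= 2 * 2^-1 ^+ n.
  by rewrite /=; case: ifP => // _; rewrite mdistxx mulr_ge0// ltW.
pose h_ x := cid (geometric_cauchy_cvg (hK x)).
pose h x : borelType Z := sval (h_ x).
have hP x n : mdist (d (K n x)) (h x : Z) <= 4 * 2^-1 ^+ n
  by exact: (svalP (h_ x)).
exists g, h; split => //.
  apply: (@measurability _ _ (measurableTypeR R) (borelType Z) setT h (@open
    Z)) => // _ [U oU <-]; rewrite setTI.
  (* The limit lies in the open set U exactly when, at some stage n, the ball known to contain the
     limit lies in U; this depends on [K n x] only. *)
  pose A n := [set j | forall y, mdist (d j) y <= 4 * 2^-1 ^+ n -> U y].
  rewrite (_ : h @^-1` U = \bigcup_n [set x | A n (K n x)]).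
    apply: bigcup_measurable => n _.
    exact: (measurable_countable_valued2 (fun a _ => A n a) (mK n) (mK n)).
  apply/seteqP; split => [x Uhx|x [n _ /=]]; last exact.
  have : nbhs (h x : Z) U by apply: open_nbhs_nbhs.
  rewrite -filter_from_ballE => -[r /= r0 rU].
  have r8 : 0 < r / 8 by rewrite divr_gt0.
  have [n hn] := exists_exp_half_lt r8.
  exists n => // y /= dy; apply: rU; rewrite ballEmdist /=.
  rewrite (le_lt_trans (metric_triangle _ (d (K n x)) _))//.
  have := hP x n; rewrite metric_sym; move: hn dy; lra.
move=> z.
have Jz n : mdist (z : Z) (d (J n (g z))) < 2^-1 ^+ n.
  rewrite -eg; apply: eJ; have [j zj] := dd z _ (hn0 n).
  by exists j; rewrite eg.
have Kz n : mdist (z : Z) (d (K n (g z))) < 2^-1 ^+ n.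
  elim: n => [|n ih]; first exact: Jz.
  rewrite /=; case: ifPn; first by move=> _; exact: (Jz n.+1).
  have := metric_triangle (d (K n (g z))) z (d (J n.+1 (g z))).
  rewrite [mdist _ z]metric_sym; have := Jz n.+1; have := hn0 n.
  rewrite exprS; move: ih => /=; set a := mdist _ _; set a' := mdist _ _;
    set a'' := mdist _ _.
  by move=> ????; rewrite -ltNge; lra.
apply/esym/mdist_positivity/eqP; rewrite eq_le mdist_ge0 andbT.
apply/ler_addgt0Pl => r r0; rewrite addr0.
have r8 : 0 < r / 8 by rewrite divr_gt0.
have [n hn] := exists_exp_half_lt r8.
rewrite (le_trans (metric_triangle _ (d (K n (g z))) _))//.
have := hP (g z) n; have := Kz n; move: hn; lra.
Qed.

End borel_retract.

Lemma parameter_unif01 (R : realType) (X : mmSpace R) (phi : R -> X) :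
  measurable_fun setT (phi : measurableTypeR R -> borelType X) ->
  (forall B, borel B -> unif01 R (phi @^-1` B) = mm_measure X B) ->
  parameter phi.
Proof.
move=> mphi hphi; split; first exact: measurable_funTS.
by move=> B bB; rewrite -unif01E hphi.
Qed.

                                                                            
                                                                           
(** The quantile transform produces the law of the code [g], and decoding with [h] turns it into the
    measure of Z. *)
Lemma exists_parameter (R : realType) (Z : mmSpace R) :
  exists2 phi : R -> Z,
    measurable_fun setT (phi : measurableTypeR R -> borelType Z) &
    forall B, borel B -> unif01 R (phi @^-1` B) = mm_measure Z B.
Proof.
have [g [h [mg mh gh]]] := borel_retract Z.
pose g' : {mfun borelType Z >-> measurableTypeR R} :=
  HB.pack g (isMeasurableFun.Build _ _ _ _ g mg).
have [q mq hq] := quantile_transform (mm_measure Z) g'.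
exists (h \o q); first exact: measurableT_comp.
move=> B bB; rewrite comp_preimage hq; last first.
  by have := mh measurableT B bB; rewrite setTI.
congr (mm_measure Z _); rewrite -comp_preimage.
by apply/seteqP; split => z /=; rewrite gh.
Qed.

                                               

(** * Splitting the uniform law into prescribed masses *)

Lemma in_bigsetU (T : Type) (I : finType) (p : pred I) (C : I -> set T) x :
  (\big[setU/set0]_(j | p j) C j) x <-> exists2 j, p j & C j x.
Proof.
split; last by move=> [j pj Cx]; rewrite (bigD1 j)//=; left.
elim/big_ind: _ => [//|A B hA hB [/hA//|/hB//]|j pj Cx]; by exists j.
Qed.

Section splitting.
Context (R : realType).
Notation lam := (unif01 R).
Implicit Types (E : set (measurableTypeR R)).

Lemma unif01_set1 x : mass lam [set x : measurableTypeR R] = 0.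
Proof.
change (fine (unif01 R [set x]) = 0); rewrite unif01E.
rewrite (_ : lebesgue_measure _ = 0%E)//; apply/eqP.
rewrite eq_le measure_ge0 andbT -[leRHS](lebesgue_measure_set1 (x : R)).
apply: le_measure; rewrite ?inE//.
by apply: measurableI => //; exact: measurable_itv.
Qed.

(** The uniform law has no atoms: cutting E at the quantile of the identity leaves exactly the mass
    [a] on the left. *)
Lemma unif01_split E a : measurable E -> 0 <= a <= mass lam E ->
  exists E', [/\ measurable E', E' `<=` E & mass lam E' = a].
Proof.
move=> mE /andP[]; rewrite le_eqVlt => /predU1P[<- _|a0].
  by exists set0; split => //; rewrite mass0.
rewrite le_eqVlt => /predU1P[->|aE]; first by exists E; split.
pose f (x : measurableTypeR R) : R := x.
have mle b : measurable [set x : measurableTypeR R | f x <= b].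
  rewrite (_ : [set _ | _] = `]-oo, b]%classic); first exact: measurable_itv.
  by apply/seteqP; split => x; rewrite /= in_itv.
pose q := quantile lam E f a.
have aq : a <= distr_fun lam E f q by rewrite -(quantile_le mE mle) ?a0.
exists (E `&` [set x | f x <= q]); split => //; first exact: measurableI.
apply/eqP; rewrite eq_le aq andbT.
have hlt : mass lam (E `&` [set x | f x < q]) <= a.
  by apply: mass_lt_quantile => //; rewrite a0.
have mlt : measurable (E `&` [set x | f x < q]).
  apply: measurableI => //; rewrite (_ : [set _ | _] = `]-oo, q[%classic).
    exact: measurable_itv.
  by apply/seteqP; split => x; rewrite /= in_itv.
apply: le_trans hlt; rewrite -[leRHS]addr0 -(unif01_set1 q).
rewrite (le_trans _ (mass_subU _ _ _))//; apply: le_mass => //.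
- exact: measurableI.
- exact: measurableU.
- by move=> x [Ex]; rewrite /= le_eqVlt => /predU1P[|xq]; [right|left].
Qed.

Lemma unif01_family (k : nat) (r : 'I_k -> R) E (s : seq 'I_k) :
  measurable E -> (forall i, 0 <= r i) -> uniq s ->
  \sum_(i <- s) r i <= mass lam E ->
  exists C : 'I_k -> set (measurableTypeR R),
  [/\ forall i, measurable (C i), forall i, C i `<=` E,
      forall i, i \in s -> mass lam (C i) = r i,
      forall i, i \notin s -> C i = set0 &
      forall i j, i != j -> C i `&` C j = set0].
Proof.
move=> mE r0; elim: s => [_ _|i0 s ih /= /andP[i0s us]].
  by exists (fun _ => set0); split => // [i|i j _];
    [exact: sub0set|rewrite set0I].
rewrite big_cons => hE.
have {ih}[|C [mC CE Cr C0 Cd]] := ih us.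
  by apply: le_trans hE; rewrite lerDr.
pose V := \big[setU/set0]_(j < k) C j.
have mV : measurable V by exact: bigsetU_measurable.
have VE : V `<=` E by move=> x /in_bigsetU[j _ /CE].
have mVE : mass lam V = \sum_(j <- s) r j.
  transitivity (\sum_(j <- s) mass lam (C j)); last exact: eq_big_seq.
  rewrite mass_bigsetU_disj//.
  rewrite [RHS]big_uniq//= (bigID (mem s))/= [X in _ + X]big1 ?addr0//.
  by move=> j js; rewrite C0// mass0.
have hr : 0 <= r i0 <= mass lam (E `\` V).
  by rewrite r0 massD// setIidr// mVE lerBrDr.
have [F [mF FE Fr]] := unif01_split (measurableD mE mV) hr.
have FC j : F `&` C j = set0.
  rewrite -subset0 => x [/FE[_ nVx] Cx]; apply: nVx.
  by apply/in_bigsetU; exists j.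
exists (fun i => if i == i0 then F else C i); split.
- by move=> i; case: eqP.
- by move=> i; case: eqP => // _ x /FE[].
- move=> i; rewrite inE; case: eqP => [->//|_ /=]; exact: Cr.
- by move=> i; rewrite inE negb_or; case: eqP => //= _; exact: C0.
- move=> i j ij; case: eqP => [ii|_]; case: eqP => [jj|_] //.
  + by move: ij; rewrite ii jj eqxx.
  + by rewrite setIC.
  + exact: Cd.
Qed.

(** A maximal coupling: a random label of law [w] that agrees with the index of [B i] as often as
    the masses permit. It serves to match a parameter of a finite space with one of a space that has
    clusters of nearly the same masses. *)
Lemma unif01_labels (k : nat) (w : 'I_k -> R)
    (B : 'I_k -> set (measurableTypeR R)) :
  (forall i, 0 <= w i) -> \sum_i w i = 1 -> (forall i, measurable (B i)) ->
  (forall i j, i != j -> B i `&` B j = set0) ->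
  exists phi : R -> 'I_k,
  [/\ forall i, measurable [set x : measurableTypeR R | phi x = i],
      forall i, mass lam [set x | phi x = i] = w i &
      forall i, Num.min (w i) (mass lam (B i)) <=
                mass lam (B i `&` [set x | phi x = i])].
Proof.
move=> w0 w1 mB dB.
have i0 : 'I_k.
  case: k w w0 w1 {B mB dB} => [w _|k _ _ _]; last exact: ord0.
  by rewrite big_ord0 => /eqP; rewrite eq_sym oner_eq0.
have hu i : 0 <= Num.min (w i) (mass lam (B i)) <= mass lam (B i).
  by rewrite le_min w0 mass_ge0 ge_min lexx orbT.
have /choice[B' hB'] i := unif01_split (mB i) (hu i).
have mB' i : measurable (B' i) by have [] := hB' i.
have dB' i j : i != j -> B' i `&` B' j = set0.
  move=> /dB; rewrite -!subset0 => d x [].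
  have [_ s _] := hB' i; have [_ s' _] := hB' j => /s Bi /s' Bj; exact: d.
pose V := \big[setU/set0]_(j < k) B' j.
have mV : measurable V by exact: bigsetU_measurable.
(* The mass that label [i] still lacks; these deficits add up to the mass outside all [B' i], where
   they are then placed. *)
pose r i := w i - Num.min (w i) (mass lam (B i)).
have r0 i : 0 <= r i by rewrite subr_ge0 ge_min lexx.
have [] := @unif01_family k r (~` V) (index_enum 'I_k) _ r0 (index_enum_uniq _).
- exact: measurableC.
- rewrite massC// mass_bigsetU_disj// /r sumrB w1 lerD2l lerN2.
  by apply: ler_sum => i _; have [_ _ ->] := hB' i.
move=> C [mC CV Cr _ dC].
pose L i := B' i `|` C i.
have mL i : measurable (L i) by exact: measurableU.
have BC i j : B' i `&` C j = set0.
  rewrite -subset0 => x [Bx /CV]; apply.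
  by apply/in_bigsetU; exists i.
have Lw i : mass lam (L i) = w i.
  by rewrite massU// Cr ?mem_index_enum// /r; have [_ _ ->] := hB' i;
    rewrite addrC subrK.
have dL i j : i != j -> L i `&` L j = set0.
  move=> ij; rewrite /L setIUl !setIUr dB'// dC// BC [C i `&` _]setIC BC.
  by rewrite !setU0.
pose W := \big[setU/set0]_(j < k) L j.
have mW : measurable W by exact: bigsetU_measurable.
have W1 : mass lam W = 1 by rewrite mass_bigsetU_disj// -[RHS]w1;
  apply: eq_bigr.
(* The default label [i0] is used only off the union of the [L i], on a null set. *)
pose phi x := odflt i0 [pick i | `[< L i x >]].
have phiL i x : L i x -> phi x = i.
  move=> Lx; rewrite /phi; case: pickP => [j /asboolP Lj|/(_ i)/asboolP//] /=.
  apply/eqP; apply/negPn/negP => /dL; rewrite -subset0 => /(_ x); exact.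
have phiE i : [set x | phi x = i] = L i `|` (if i == i0 then ~` W else set0).
  apply/seteqP; split => x /=.
    rewrite /phi; case: pickP => [j /asboolP Lj /= <-|h /= <-]; first by left.
    rewrite eqxx; right; rewrite /W => Wx.
    by have /in_bigsetU[j _ Lj] := Wx; have := h j => /asboolP.
  case=> [/phiL//|]; case: eqP => // -> nW; rewrite /phi;
    case: pickP => //= j /asboolP Lj.
  by exfalso; apply: nW; apply/in_bigsetU; exists j.
have mphi i : measurable [set x : measurableTypeR R | phi x = i].
  by rewrite phiE; apply: measurableU => //; case: ifP => // _;
    exact: measurableC.
exists phi; split => //.
  move=> i; apply/eqP; rewrite eq_le; apply/andP; split.
    rewrite phiE (le_trans (mass_subU _ _ _))//.
      by case: ifP => // _; exact: measurableC.
    by rewrite Lw; case: ifP; rewrite ?massC ?W1 ?subrr ?mass0 ?addr0.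
  by rewrite -Lw; apply: le_mass => // x /phiL.
move=> i; have [_ BB <-] := hB' i.
apply: le_mass => //; first exact: measurableI.
by move=> x Bx; split; [exact: BB|apply: phiL; left].
Qed.

End splitting.

                                

(** * Replacing the metric of an mm-space by a smaller one *)

(** The upper bound makes the identity 1-Lipschitz, so the new space is dominated by the old one.
    The lower bound gives positivity and, together with the upper one, the same topology and the
    same Cauchy filters; hence completeness, separability and full support carry over. *)
Record is_remetric (R : realType) (X : completeMetricType R) (d : X -> X ->
  R) :=
  IsRemetric {
  remetric_sym : forall x y, d x y = d y x;
  remetric_triangle : forall y x z, d x z <= d x y + d y z;
  remetric_le : forall x y, d x y <= mdist x y;
  remetric_ge : exists2 e, 0 < e & forall x y,
    e * Num.min (mdist x y) 1 <= d x y
}.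

Definition remetric (R : realType) (X : completeMetricType R) (d : X -> X -> R)
  (dP : is_remetric d) : Type := X.

Section remetric.
Context (R : realType) (X : completeMetricType R) (d : X -> X -> R).
Variable (dP : is_remetric d).

Let remetricxx x : d x x = 0.
Proof.
have := remetric_le dP x x; rewrite mdistxx => d0.
apply/eqP; rewrite eq_le d0/=.
have [e e0 /(_ x x)] := remetric_ge dP.
by rewrite mdistxx /Num.min ltr01 mulr0.
Qed.

Let remetric_positivity x y : d x y = 0 -> x = y.
Proof.
move=> d0; apply: mdist_positivity; apply/eqP; rewrite eq_le mdist_ge0 andbT.
have [e e0 /(_ x y)] := remetric_ge dP.
by rewrite d0 pmulr_rle0// ge_min (lt_geF ltr01) orbF.
Qed.

HB.instance Definition _ := Pointed.on (remetric dP).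
HB.instance Definition _ := @isMetric.Build R (remetric dP)
  d remetricxx remetric_positivity (remetric_sym dP) (remetric_triangle dP).

Lemma mdist_remetricE (x y : X) : mdist (x : remetric dP) (y : remetric dP) = d
  x y.
Proof. by []. Qed.

Let small_remetric (e : R) : 0 < e -> exists2 r, 0 < r &
  forall x y, d x y < r -> mdist x y < e.
Proof.
move=> e0; have [c c0 cd] := remetric_ge dP.
exists (c * Num.min e 1); first by rewrite mulr_gt0// lt_min e0 ltr01.
move=> x y /(le_lt_trans (cd x y)); rewrite ltr_pM2l// lt_min.
rewrite !gt_min ltxx orbF => /andP[/orP[//|e1] m1]; exact: lt_trans m1 e1.
Qed.

Lemma nbhs_remetricE (x : X) : nbhs (x : remetric dP) = nbhs x.
Proof.
apply/seteqP; split=> A; rewrite -!filter_from_ballE => -[e /= e0 eA].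
  exists e => // y; rewrite ballEmdist/= => xy; apply: eA; rewrite ballEmdist/=.
  rewrite /= (le_lt_trans _ xy)// mdist_remetricE; exact: (remetric_le dP).
have [r r0 re] := small_remetric e0.
by exists r => // y; rewrite ballEmdist/= => /re xy; apply: eA;
  rewrite ballEmdist.
Qed.

Lemma open_remetricE : @open (remetric dP) = @open X.
Proof.
by apply/funext => A; rewrite !openE /interior;
  apply/propext; split=> + x => /(_ x); rewrite nbhs_remetricE.
Qed.

Let remetric_complete (F : set_system (remetric dP)) :
  ProperFilter F -> cauchy F -> cvg F.
Proof.
move=> FF Fc.
have : cauchy (F : set_system X).
  apply/cauchy_ballP => e e0; have [r r0 re] := small_remetric e0.
  move/cauchy_ballP : Fc => /(_ _ r0); apply: filterS => -[x y]/=.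
  by rewrite !ballEmdist/= => /re.
move=> /cauchy_cvg Fl.
apply: (@cvgP _ F (lim (F : set_system X) : remetric dP)).
by rewrite /cvg_to nbhs_remetricE.
Qed.

HB.instance Definition _ := Uniform_isComplete.Build (remetric dP)
  remetric_complete.

End remetric.

Section mm_remetric.
Context (R : realType) (X : mmSpace R) (d : X -> X -> R) (dP : is_remetric d).

Definition to_remetric (x : borelType X) : borelType (remetric dP) := x.

Let measurable_to_remetric : measurable_fun setT to_remetric.
Proof.
move=> _ B mB; rewrite setTI; move: mB.
by rewrite /measurable/= open_remetricE.
Qed.

HB.instance Definition _ := @isMeasurableFun.Build _ _ _ _
  to_remetric measurable_to_remetric.

Definition remetric_measure : probability (borelType (remetric dP)) R :=
  distribution (mm_measure X) to_remetric.

Let remetric_separable :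
  exists2 D : set (remetric dP), countable D & dense D.
Proof.
have [D cD dD] := mm_separable X; exists D => // U U0.
by rewrite open_remetricE; exact: dD.
Qed.

Let remetric_full_supp :
  supp (remetric_measure : set (remetric dP) -> \bar R) = setT.
Proof.
rewrite -(mm_full_supp X); apply/seteqP; split=> x xU U [oU Ux].
  have oU' : @open (remetric dP) U by rewrite open_remetricE.
  exact: xU.
have oU' : @open X U by move: oU; rewrite open_remetricE.
exact: xU.
Qed.

Definition mm_remetric : mmSpace R :=
  MMSpace remetric_separable remetric_full_supp.

Lemma mm_remetric_le : mm_le mm_remetric X.
Proof. by exists (fun x : X => x : mm_remetric) => // x y;
  exact: (remetric_le dP). Qed.

Lemma borel_mm_remetric : @borel mm_remetric = @borel X.
Proof. by rewrite /borel open_remetricE. Qed.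

Lemma mm_remetric_parameter (phi : R -> X) :
  measurable_fun setT (phi : measurableTypeR R -> borelType X) ->
  (forall B, borel B -> unif01 R (phi @^-1` B) = mm_measure X B) ->
  parameter (phi : R -> mm_remetric).
Proof.
move=> mphi hphi; apply: parameter_unif01 => [_ B mB|B bB].
  by apply: mphi => //; move: mB; rewrite /measurable/= open_remetricE.
by rewrite hphi// -borel_mm_remetric.
Qed.

End mm_remetric.

Lemma box_le (R : realType) (X Y : mmSpace R) (e : R) (phi : R ->
  X) (psi : R -> Y)
    (I0 : set (measurableTypeR R)) :
  0 <= e -> parameter phi -> parameter psi -> measurable I0 ->
  1 - e <= mass (unif01 R) I0 ->
  (forall s t, I0 s -> I0 t ->
     `|mdist (phi s) (phi t) - mdist (psi s) (psi t)| <= e) ->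
  (box X Y <= e%:E)%E.
Proof.
move=> e0 pphi ppsi mI hI hd; apply: ereal_inf_lbound; exists e => //;
  split => //.
exists phi, psi, (`[0, 1[%classic `&` I0); split => //.
- by split=> //; apply: measurableI => //; exact: measurable_itv.
- by rewrite -unif01E massE.
- by move=> s t [_ Is] [_ It]; exact: hd.
Qed.

                         

(** * Finite mm-spaces *)

Lemma mass_fiber dT (T : measurableType dT) (R : realType) (P : probability T R)
    (k : nat) (phi : T -> 'I_k) (B : set 'I_k) :
  (forall i, measurable [set x | phi x = i]) ->
  measurable (phi @^-1` B) /\
  mass P (phi @^-1` B) = \sum_(i | `[< B i >]) mass P [set x | phi x = i].
Proof.
move=> mphi.
have -> : phi @^-1` B = \big[setU/set0]_(i < k | `[< B i >]) [set x | phi x =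
  i].
  apply/seteqP; split => x; first by move=> Bx; apply/in_bigsetU;
    exists (phi x) => //; apply/asboolP.
  by move=> /in_bigsetU[i /asboolP Bi /= xi]; rewrite /preimage/= xi.
split; first exact: bigsetU_measurable.
rewrite mass_bigsetU_disj// => i j /eqP ij; rewrite -subset0 => x [/= ? ?].
by apply: ij; congruence.
Qed.

Record finite_metric_data (R : realType) (n : nat) := FiniteMetricData {
  fmd_dist :> 'I_n.+1 -> 'I_n.+1 -> R;
  fmd_xx : forall i, fmd_dist i i = 0;
  fmd_sym : forall i j, fmd_dist i j = fmd_dist j i;
  fmd_triangle : forall j i k, fmd_dist i k <= fmd_dist i j + fmd_dist j k;
  fmd_sep : exists2 c, 0 < c & forall i j, i != j -> c <= fmd_dist i j
}.

                                                                           
                           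
(** A copy of the ordinals below [n.+1] that mentions [d], so that each distance matrix has a type
    of its own to carry its metric structure. *)
Definition finite_metric (R : realType) (n : nat) (d : finite_metric_data R n) :
  Set := {i : nat | (i < n.+1)%N}.

Definition finite_metric_ord (R : realType) (n : nat)
  (d : finite_metric_data R n) (x : finite_metric d) : 'I_n.+1 :=
  Ordinal (svalP x).

Definition finite_metric_pt (R : realType) (n : nat)
  (d : finite_metric_data R n) (i : 'I_n.+1) : finite_metric d :=
  exist _ (i : nat) (ltn_ord i).

Lemma finite_metric_ordK (R : realType) (n : nat) (d : finite_metric_data R n) :
  cancel (@finite_metric_ord R n d) (@finite_metric_pt R n d).
Proof. by move=> x; apply: val_inj. Qed.

Lemma finite_metric_ptK (R : realType) (n : nat) (d : finite_metric_data R n) :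
  cancel (@finite_metric_pt R n d) (@finite_metric_ord R n d).
Proof. by move=> x; apply: val_inj. Qed.

Section finite_metric.
Context (R : realType) (n : nat) (d : finite_metric_data R n).

Let dist (x y : finite_metric d) : R :=
  d (finite_metric_ord x) (finite_metric_ord y).

Let dist_xx x : dist x x = 0. Proof. exact: fmd_xx. Qed.

Let dist_positivity x y : dist x y = 0 -> x = y.
Proof.
have [c c0 cd] := fmd_sep d; rewrite /dist => d0.
apply: (can_inj (@finite_metric_ordK _ _ d)); apply/eqP/negPn/negP => /cd.
by rewrite d0 leNgt c0.
Qed.

Let dist_sym x y : dist x y = dist y x. Proof. exact: fmd_sym. Qed.

Let dist_triangle y x z : dist x z <= dist x y + dist y z.
Proof. exact: fmd_triangle. Qed.

HB.instance Definition _ := Choice.on (finite_metric d).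
HB.instance Definition _ := isPointed.Build (finite_metric d) 
  (finite_metric_pt d ord0).
HB.instance Definition _ := @isMetric.Build R (finite_metric d)
  dist dist_xx dist_positivity dist_sym dist_triangle.

Let ball_single : exists2 c : R, 0 < c & forall x y : finite_metric d,
  ball x c y -> y = x.
Proof.
have [c c0 cd] := fmd_sep d; exists c => // x y; rewrite ballEmdist /= => xy.
apply: (can_inj (@finite_metric_ordK _ _ d)); apply/esym/eqP/negPn/negP => /cd.
by apply/negP; rewrite -ltNge.
Qed.

Lemma open_finite_metric (A : set (finite_metric d)) : open A.
Proof.
rewrite openE => x Ax; rewrite /interior -filter_from_ballE.
by have [c c0 cx] := ball_single; exists c => // y /cx ->.
Qed.

Let finite_metric_complete (F : set_system (finite_metric d)) :
  ProperFilter F -> cauchy F -> cvg F.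
Proof.
move=> FF /cauchyP Fc; have [c c0 cx] := ball_single.
have [x Fx] := Fc _ c0.
apply: (@cvgP _ F x) => A /nbhs_singleton Ax.
by apply: filterS Fx => y /cx ->.
Qed.

HB.instance Definition _ := Uniform_isComplete.Build (finite_metric d)
  finite_metric_complete.

End finite_metric.

Section finite_mm.
Context (R : realType) (n : nat) (d : finite_metric_data R n).
Variables (w : 'I_n.+1 -> R) (w0 : forall i, 0 < w i) (w1 : \sum_i w i = 1).

Lemma measurable_finite_metric (A : set (borelType (finite_metric d)))
  : measurable A.
Proof. by apply: sub_sigma_algebra; exact: open_finite_metric. Qed.

Lemma exists_finite_mm : exists (X : mmSpace R) (e : 'I_n.+1 -> X),
  [/\ bijective e, forall i j, mdist (e i) (e j) = d i j,
      forall A : set X, borel A &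
      forall A : set X, mass (mm_measure X) A = \sum_(i | `[< A (e i) >]) w i].
Proof.
have w0' i : 0 <= w i by exact: ltW.
(* With empty sets to agree with, this is just a random label of law [w]; the measure is its
   distribution. *)
have [||phi [mphi phiw _]] := @unif01_labels R _ w (fun _ => set0) w0' w1.
- by [].
- by move=> *; rewrite set0I.
pose phi' (x : measurableTypeR R) : borelType (finite_metric d) :=
  finite_metric_pt d (phi x).
have mphi' : measurable_fun setT phi'.
  by move=> _ B _; rewrite setTI;
    have [] := mass_fiber (unif01 R) (finite_metric_pt d @^-1` B) mphi.
pose phi'' : {mfun measurableTypeR R >-> borelType (finite_metric d)} :=
  HB.pack phi' (isMeasurableFun.Build _ _ _ _ phi' mphi').
pose mu : probability (borelType (finite_metric d)) R := distribution (unif01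
  R) phi''.
have muE (A : set (finite_metric d)) :
    mass mu A = \sum_(i | `[< A (finite_metric_pt d i) >]) w i.
  rewrite -(eq_bigr _ (fun i _ => phiw i)).
  by have [_ <-] := mass_fiber (unif01 R) (finite_metric_pt d @^-1` A) mphi.
have sep : exists2 D : set (finite_metric d), countable D & dense D.
  exists setT; last by move=> O O0 _; rewrite setIT.
  exact: countableP.
have full : supp (mu : set (finite_metric d) -> \bar R) = setT.
  rewrite -subTset => x _ U [_ Ux].
  rewrite (massE _ (measurable_finite_metric U)) lte_fin muE.
  by rewrite (bigD1 (finite_metric_ord x))/=; [rewrite ltr_wpDr// sumr_ge0|
    apply/asboolP; rewrite finite_metric_ordK].
exists (@MMSpace R (finite_metric d) mu sep full), (@finite_metric_pt _ _ d).
split => //.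
- by exists (@finite_metric_ord _ _ d);
    [exact: finite_metric_ptK|exact: finite_metric_ordK].
- move=> i j; rewrite -[in RHS](finite_metric_ptK d i).
  by rewrite -[in RHS](finite_metric_ptK d j).
- exact: measurable_finite_metric.
Qed.

End finite_mm.

                             

(** * Lipschitz functions, clusters and the median distance *)

Notation mmass X A := (mass (mm_measure X) (A : set (borelType X))).
Notation msr A := (measurable (A : set (borelType _))).

Definition rlip (R : realType) (X : metricType R) (f : X -> R) :=
  forall x y, f x - f y <= mdist x y.

Section rlip.
Context (R : realType) (X : completeMetricType R).
Implicit Types (f g : X -> R) (A : set X).

Lemma rlipN f : rlip f -> rlip (fun x => - f x).
Proof. by move=> lf x y; have := lf y x; rewrite metric_sym; lra. Qed.

Lemma rlip_norm f x y : rlip f -> `|f x - f y| <= mdist x y.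
Proof.
by move=> lf; rewrite ler_norml; have := lf y x; have := lf x y;
  rewrite metric_sym; lra.
Qed.

Lemma open_rlip_gt f a : rlip f -> open [set x | a < f x].
Proof.
move=> lf; rewrite openE => x /= ax; rewrite /interior -filter_from_ballE.
exists (f x - a); first by rewrite /= subr_gt0.
by move=> y; rewrite ballEmdist/=; have := lf x y; lra.
Qed.

Lemma msr_rlip_gt f a : rlip f -> msr [set x | a < f x].
Proof. by move=> lf; apply: sub_sigma_algebra; exact: open_rlip_gt. Qed.

Lemma msr_rlip_lt f a : rlip f -> msr [set x | f x < a].
Proof.
move=> /rlipN /(@msr_rlip_gt _ (- a)).
by rewrite (_ : [set x | _ ] = [set x | f x < a])//; apply/seteqP;
  split => x /=; rewrite ltrN2.
Qed.

Lemma msr_rlip_le f a : rlip f -> msr [set x | f x <= a].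
Proof.
move=> lf; rewrite (_ : [set x | _] = ~` [set x | a < f x]).
  by apply: measurableC; exact: msr_rlip_gt.
by apply/seteqP; split => x /=; rewrite leNgt => /negP.
Qed.

Lemma msr_rlip_ge f a : rlip f -> msr [set x | a <= f x].
Proof.
move=> lf; rewrite (_ : [set x | _] = ~` [set x | f x < a]).
  by apply: measurableC; exact: msr_rlip_lt.
by apply/seteqP; split => x /=; rewrite leNgt => /negP.
Qed.

(** The function is the distance to A. Its last property, that it inherits all lower bounds on
    distances to points of A, is how separation enters later estimates. *)
Lemma exists_dist_fun A : A !=set0 -> exists f : X -> R,
  [/\ rlip f, forall x, A x -> f x = 0, forall x, 0 <= f x &
      forall x c, (forall y, A y -> c <= mdist x y) -> c <= f x].
Proof.
move=> [a Aa]; pose f x := inf [set mdist x y | y in A].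
have fl x : has_lbound [set mdist x y | y in A].
  by exists 0 => _ [y _ <-]; exact: mdist_ge0.
have fn x : [set mdist x y | y in A] !=set0 by exists (mdist x a), a.
have fge x c : (forall y, A y -> c <= mdist x y) -> c <= f x.
  by move=> h; apply: lb_le_inf => // _ [y Ay <-]; exact: h.
have f0 x : 0 <= f x by apply: fge => y _; exact: mdist_ge0.
exists f; split => //.
  move=> x y; suff : f x - mdist x y <= f y by lra.
  apply: fge => z Az; have : f x <= mdist x z by apply: ge_inf => //; exists z.
  by have := metric_triangle x y z; lra.
move=> x Ax; apply/eqP; rewrite eq_le f0 andbT -(mdistxx x).
by apply: ge_inf => //; exists x.
Qed.

End rlip.

Section mm_map.
Context (R : realType).
Implicit Types X Y Z : mmSpace R.

Definition mm_map X Y (p : X -> Y) := lip1 p /\ measure_preserving p.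

Lemma rlip_comp X Y (p : X -> Y) (f : Y -> R) : lip1 p -> rlip f ->
  rlip (f \o p).
Proof. by move=> lp lf x y; rewrite /= (le_trans (lf _ _)). Qed.

Lemma open_lip1_preimage (T U : metricType R) (p : T -> U) (V : set U) :
  lip1 p -> open V -> open (p @^-1` V).
Proof.
move=> lp; rewrite !openE => oV x /= /oV.
rewrite /interior -!filter_from_ballE => -[e e0 eV]; exists e => // y.
rewrite ballEmdist/= => xy; apply: eV; rewrite ballEmdist/=.
exact: le_lt_trans (lp _ _) xy.
Qed.

Lemma borel_preimage (T U : ptopologicalType) (p : T -> U) (B : set U) :
  (forall V, open V -> open (p @^-1` V)) -> borel B -> msr (p @^-1` B).
Proof.
move=> op mB; pose q (x : borelType T) : borelType U := p x.
have mq : measurable_fun setT q.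
  apply: (@measurability _ _ (borelType T) (borelType U) setT q (@open U)) =>
    // _ [V oV <-].
  by rewrite setTI; apply: sub_sigma_algebra; exact: op.
by have := mq measurableT B mB; rewrite setTI.
Qed.

Lemma msr_preimage X Y (p : X -> Y) (B : set Y) :
  lip1 p -> msr B -> msr (p @^-1` B).
Proof. by move=> lp; apply: borel_preimage => V; exact: open_lip1_preimage. Qed.

Lemma mmass_preimage X Y (p : X -> Y) (B : set Y) :
  mm_map p -> msr B -> mmass X (p @^-1` B) = mmass Y B.
Proof. by move=> [lp mp] mB; congr fine; exact: mp. Qed.

End mm_map.

Section separated.
Context (R : realType).
Implicit Types (X Y : mmSpace R) (Q : set (mmSpace R)) (c r : R).

Definition separated X m (A : 'I_m -> set X) r c :=
  [/\ forall i, msr (A i), forall i, r <= mmass X (A i) &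
      forall i j, i != j -> forall x y, A i x -> A j y -> c <= mdist x y].

(** The working form of the statement that the separation distance of the pyramid, for m weights
    equal to [r], is at least [c]. *)
Definition has_clusters Q m r c :=
  exists2 X, Q X & exists A : 'I_m -> set X, separated A r c.

Lemma separated_disj X m (A : 'I_m -> set X) r c i j : 0 < c ->
  separated A r c -> i != j -> A i `&` A j = set0.
Proof.
move=> c0 [_ _ s] ij; rewrite -subset0 => x [Ai Aj].
by have := s _ _ ij x x Ai Aj; rewrite mdistxx leNgt c0.
Qed.

Lemma separated_preimage X Y (p : X -> Y) m (A : 'I_m -> set Y) r c :
  mm_map p -> separated A r c -> separated (fun i => p @^-1` A i) r c.
Proof.
move=> mp [mA rA sA]; split => [i|i|i j ij x y Ax Ay].
- by apply: msr_preimage => //; case: mp.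
- by rewrite mmass_preimage.
- by apply: le_trans (sA _ _ ij _ _ Ax Ay) _; case: mp => lp _; exact: lp.
Qed.

Lemma has_clusters_mono Q m r c r' c' : r' <= r -> c' <= c ->
  has_clusters Q m r c -> has_clusters Q m r' c'.
Proof.
move=> rr cc [X QX [A [mA rA sA]]]; exists X => //; exists A; split => //.
- by move=> i; exact: le_trans rr _.
- by move=> i j ij x y Ax Ay; apply: le_trans cc _; exact: (sA i j).
Qed.

Lemma has_clusters_leq Q m m' r c : (m' <= m)%N -> has_clusters Q m r c ->
  has_clusters Q m' r c.
Proof.
move=> mm [X QX [A [mA rA sA]]]; exists X => //.
exists (fun i => A (widen_ord mm i)); split => // i j ij x y.
by apply: sA; apply: contra ij => /eqP/(congr1 val)/= /val_inj/eqP.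
Qed.

Lemma has_clusters_extend Q m X (A : 'I_m -> set X) (E : set X) r c :
  Q X -> separated A r c -> msr E -> r <= mmass X E ->
  (forall i x y, A i x -> E y -> c <= mdist x y) -> has_clusters Q m.+1 r c.
Proof.
move=> QX [mA rA sA] mE rE sE; exists X => //.
exists (fun i => if unlift ord0 i is Some j then A j else E); split.
- by move=> i; case: unliftP.
- by move=> i; case: unliftP.
- move=> i j; case: unliftP => [i' ->|->]; case: unliftP => [j' ->|->].
  + by rewrite (inj_eq lift_inj) => /sA; exact.
  + by move=> _ x y; exact: sE.
  + by move=> _ x y Ex Ay; rewrite metric_sym; exact: (sE j').
  + by rewrite eqxx.
Qed.

Lemma has_clusters_split Q m X (A : 'I_m -> set X) (E E' : set X) i r c :
  Q X -> separated A r c -> msr E -> msr E' -> E `<=` A i -> E' `<=` A i ->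
  r <= mmass X E -> r <= mmass X E' ->
  (forall x y, E x -> E' y -> c <= mdist x y) -> has_clusters Q m.+1 r c.
Proof.
move=> QX [mA rA sA] mE mE' EA E'A rE rE' EE'.
apply: (@has_clusters_extend Q m X (fun j => if j == i then E else A j) E') =>
  //.
  split=> [j|j|j l jl x y]; [by case: ifP|by case: ifP|].
  case: eqP => [ji|_]; case: eqP => [li|_].
  - by move: jl; rewrite ji li eqxx.
  - by move=> /EA Ax Ay; apply: (sA i l) => //; rewrite -ji.
  - by move=> Ax /EA Ay; apply: (sA j i) => //; rewrite -li.
  - exact: sA.
move=> j x y; case: eqP => [_|/eqP ji]; first exact: EE'.
by move=> Ax /E'A Ay; exact: (sA j i).
Qed.

Lemma has_clusters2 Q X (E E' : set X) r c :
  Q X -> msr E -> msr E' -> r <= mmass X E -> r <= mmass X E' ->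
  (forall x y, E x -> E' y -> c <= mdist x y) -> has_clusters Q 2 r c.
Proof.
move=> QX mE mE' rE rE' EE'.
apply: (@has_clusters_extend Q 1 X (fun _ => E) E') => //.
by split => // i j; rewrite !ord1.
Qed.

End separated.

Section median.
Context (R : realType) (X : mmSpace R).
Implicit Types (A B : set X) (f : X -> R).

(** A median of [f] on A, relative to the mass of A. Being a quantile, it depends only on the
    distribution of [f] on A, which makes it invariant under pullback. *)
Definition med A f : R := quantile (mm_measure X) A f (mmass X A / 2).

Let half A : 0 < mmass X A -> 0 < mmass X A / 2 < mmass X A.
Proof. by move=> A0; apply/andP; split; lra. Qed.

Lemma mass_le_med A f : msr A -> 0 < mmass X A -> rlip f ->
  mmass X A / 2 <= mmass X (A `&` [set x | f x <= med A f]).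
Proof.
move=> mA A0 lf.
have := @quantile_le _ (borelType X) R (mm_measure X) A f mA (fun a =>
  msr_rlip_le a lf)
   (mmass X A / 2) (med A f) (half A0).
by rewrite /med lexx => /esym.
Qed.

Lemma mass_ge_med A f : msr A -> 0 < mmass X A -> rlip f ->
  mmass X A / 2 <= mmass X (A `&` [set x | med A f <= f x]).
Proof.
move=> mA A0 lf.
have := @mass_lt_quantile _ (borelType X) R (mm_measure X) A f mA
   (fun a => msr_rlip_le a lf) (mmass X A / 2) (half A0).
rewrite -/(med A f) => h.
have -> : A `&` [set x | med A f <= f x] = A `\` (A `&` [set x | f x < med A
  f]).
  apply/seteqP; split => x /= [Ax].
    by rewrite leNgt => /negP nf; split => // -[].
  by move=> nf; split => //; rewrite leNgt; apply/negP => ?; exact: nf.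
rewrite massD ?setIA ?setIid//; last by apply: measurableI => //;
  exact: msr_rlip_lt.
by move: h; set u := mass _ _; lra.
Qed.

Lemma med_ge A f a : msr A -> rlip f ->
  mmass X (A `&` [set x | f x < a]) < mmass X A / 2 -> a <= med A f.
Proof.
move=> mA lf h; rewrite leNgt; apply/negP => ma.
have A0 : 0 < mmass X A.
  by have := mass_ge0 (mm_measure X) (A `&` [set x | f x < a]); move: h; lra.
have := mass_le_med mA A0 lf; apply/negP; rewrite -ltNge (le_lt_trans _ h)//.
apply: le_mass.
- by apply: measurableI => //; exact: msr_rlip_le.
- by apply: measurableI => //; exact: msr_rlip_lt.
- by apply: setIS => x /= /le_lt_trans; exact.
Qed.

Lemma med_le A f a : msr A -> rlip f ->
  mmass X (A `&` [set x | a < f x]) < mmass X A / 2 -> med A f <= a.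
Proof.
move=> mA lf h; rewrite leNgt; apply/negP => ma.
have A0 : 0 < mmass X A.
  by have := mass_ge0 (mm_measure X) (A `&` [set x | a < f x]); move: h; lra.
have := mass_ge_med mA A0 lf; apply/negP; rewrite -ltNge (le_lt_trans _ h)//.
apply: le_mass.
- by apply: measurableI => //; exact: msr_rlip_ge.
- by apply: measurableI => //; exact: msr_rlip_gt.
- by apply: setIS => x /=; exact: lt_le_trans.
Qed.

(** The distance between A and B as seen by 1-Lipschitz functions through their medians. Unlike the
    distance of sets it satisfies the triangle inequality ([rho_triangle]), and it ignores small
    parts of A and B. *)
Definition rho A B : R := sup [set `|med A f - med B f| | f in [set f | rlip
  f]].

Lemma rho_sym A B : rho A B = rho B A.
Proof.
by rewrite /rho; congr sup; apply/seteqP; split => _ [f lf <-]; exists f => //;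
  rewrite distrC.
Qed.

Lemma rhoxx A : rho A A = 0.
Proof.
rewrite /rho (_ : image _ _ = [set 0]) ?sup1//.
apply/seteqP; split => [_ [f _ <-]|_ ->]; first by rewrite subrr normr0.
by exists (fun=> 0); [move=> x y; rewrite subr0 mdist_ge0|rewrite subrr normr0].
Qed.

End median.

Section rho.
Context (R : realType) (Q : set (mmSpace R)).

(** If the medians were more than [c] apart, the half of one set below its median and the half of
    the other above its median would be two clusters of mass [r / 2] at distance [c]. So [rho] is a
    supremum of a bounded set. *)
Lemma med_dist_le (X : mmSpace R) (A B : set X) f r c : Q X -> 0 < r ->
  msr A -> msr B -> r <= mmass X A -> r <= mmass X B -> rlip f ->
  ~ has_clusters Q 2 (r / 2) c -> `|med A f - med B f| <= c.
Proof.
move=> QX r0 mA mB rA rB lf ns.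
have A0 := lt_le_trans r0 rA; have B0 := lt_le_trans r0 rB.
rewrite leNgt; apply/negP => h; apply: ns.
have key (E F : set X) : msr E -> msr F -> r <= mmass X E -> r <= mmass X F ->
    c < med F f - med E f -> has_clusters Q 2 (r / 2) c.
  move=> mE mF rE rF hEF.
  apply: (@has_clusters2 _ Q X (E `&` [set x | f x <= med E f])
    (F `&` [set x | med F f <= f x])) => //.
  - by apply: measurableI => //; exact: msr_rlip_le.
  - by apply: measurableI => //; exact: msr_rlip_ge.
  - by have := mass_le_med mE (lt_le_trans r0 rE) lf; apply: le_trans; lra.
  - by have := mass_ge_med mF (lt_le_trans r0 rF) lf; apply: le_trans; lra.
  - by move=> x y [_ /= fx] [_ /= fy]; rewrite metric_sym; have := lf y x; lra.
move: h; rewrite ltr_normr => /orP[h|h]; first exact: (key B A).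
by apply: (key A B) => //; lra.
Qed.

Lemma has_sup_rho (X : mmSpace R) (A B : set X) r c : Q X -> 0 < r ->
  msr A -> msr B -> r <= mmass X A -> r <= mmass X B ->
  ~ has_clusters Q 2 (r / 2) c ->
  has_sup [set `|med A f - med B f| | f in [set f | rlip f]].
Proof.
move=> QX r0 mA mB rA rB ns; split.
  exists `|med A (fun=> 0) - med B (fun=> 0)|, (fun=> 0) => // x y.
  by rewrite subr0 mdist_ge0.
by exists c => _ [f lf <-]; exact: (@med_dist_le X A B f r c).
Qed.

Lemma rho_le (X : mmSpace R) (A B : set X) r c : Q X -> 0 < r ->
  msr A -> msr B -> r <= mmass X A -> r <= mmass X B ->
  ~ has_clusters Q 2 (r / 2) c -> rho A B <= c.
Proof.
move=> QX r0 mA mB rA rB ns.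
have [h _] := has_sup_rho QX r0 mA mB rA rB ns.
by apply: sup_le_ub => // _ [f lf <-]; exact: (@med_dist_le X A B f r c).
Qed.

Lemma med_le_rho (X : mmSpace R) (A B : set X) f r c : Q X -> 0 < r ->
  msr A -> msr B -> r <= mmass X A -> r <= mmass X B ->
  ~ has_clusters Q 2 (r / 2) c -> rlip f -> `|med A f - med B f| <= rho A B.
Proof.
move=> QX r0 mA mB rA rB ns lf.
have [_ h] := has_sup_rho QX r0 mA mB rA rB ns.
by apply: ub_le_sup => //; exists f.
Qed.

Lemma rho_triangle (X : mmSpace R) (A B C : set X) r c : Q X -> 0 < r ->
  msr A -> msr B -> msr C -> r <= mmass X A -> r <= mmass X B ->
    r <= mmass X C ->
  ~ has_clusters Q 2 (r / 2) c -> rho A C <= rho A B + rho B C.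
Proof.
move=> QX r0 mA mB mC rA rB rC ns.
have [h _] := has_sup_rho QX r0 mA mC rA rC ns.
apply: sup_le_ub => // _ [f lf <-].
have := med_le_rho QX r0 mA mB rA rB ns lf.
have := med_le_rho QX r0 mB mC rB rC ns lf.
have -> : med A f - med C f = (med A f - med B f) + (med B f - med C f) by lra.
have := ler_normD (med A f - med B f) (med B f - med C f); lra.
Qed.

(** The distance function of [A i] has median at most 0 on [A i] and at least [c] on [A j]. *)
Lemma rho_ge (X : mmSpace R) m (A : 'I_m -> set X) i j r c C : Q X -> 0 < r ->
  separated A r c -> i != j -> ~ has_clusters Q 2 (r / 2) C ->
    c <= rho (A i) (A j).
Proof.
move=> QX r0 [mA rA sA] ij ns.
have A0 l : 0 < mmass X (A l) := lt_le_trans r0 (rA l).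
have nA : A i !=set0.
  by apply/set0P/eqP => Ai0; have := A0 i; rewrite Ai0 mass0 ltxx.
have [f [lf f0 fge fc]] := exists_dist_fun nA.
apply: le_trans (med_le_rho QX r0 (mA i) (mA j) (rA i) (rA j) ns lf).
have h1 : med (A i) f <= 0.
  apply: med_le => //; rewrite (_ : _ `&` _ = set0) ?mass0 ?divr_gt0//.
  by rewrite -subset0 => x [/f0 fx] /=; rewrite fx ltxx.
have h2 : c <= med (A j) f.
  apply: med_ge => //; rewrite (_ : _ `&` _ = set0) ?mass0 ?divr_gt0//.
  rewrite -subset0 => x [Ax] /=; rewrite ltNge => /negP; apply;
    apply: fc => y Ay.
  by rewrite metric_sym; exact: (sA i j).
by rewrite distrC ler_normr; apply/orP; left; lra.
Qed.

(** If the part of [A i] where [f] lies at least [e] below its median had mass [e], that part and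
    the half above the median would split [A i] in two, giving [m.+1] clusters; the same holds for
    the upper tail. So each of the two tails has mass below [e]. *)
Lemma med_concentration (X : mmSpace R) m (A : 'I_m -> set X) i f r c e : Q X ->
  0 < r -> 0 < e -> e <= r / 2 -> e <= c -> separated A r c -> rlip f ->
  ~ has_clusters Q m.+1 e e ->
  mmass X (A i `&` [set x | e <= `|f x - med (A i) f|]) <= 2 * e.
Proof.
move=> QX r0 e0 er ec sA lf ns.
have [mA rA _] := sA; have A0 : 0 < mmass X (A i) := lt_le_trans r0 (rA i).
set M := med _ _.
have sA' : separated A e e.
  case: sA => _ _ s; split => // [j|j l jl x y Ax Ay].
    by rewrite (le_trans er)// (le_trans _ (rA j))//; lra.
  by rewrite (le_trans ec)//; exact: (s j l).
have mlo : msr (A i `&` [set x | f x <= M - e]) by apply: measurableI => //;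
  exact: msr_rlip_le.
have mhi : msr (A i `&` [set x | M + e <= f x]) by apply: measurableI => //;
  exact: msr_rlip_ge.
have lo : mmass X (A i `&` [set x | f x <= M - e]) < e.
  rewrite ltNge; apply/negP => h; apply: ns.
  apply: (@has_clusters_split _ Q m X A _ (A i `&` [set x | M <= f x]) i e e QX
    sA' mlo) => //.
  - by apply: measurableI => //; exact: msr_rlip_ge.
  - have := mass_ge_med (mA i) A0 lf; rewrite -/M; have := rA i; lra.
  - by move=> x y [_ /= fx] [_ /= fy]; rewrite metric_sym; have := lf y x; lra.
have hi : mmass X (A i `&` [set x | M + e <= f x]) < e.
  rewrite ltNge; apply/negP => h; apply: ns.
  apply: (@has_clusters_split _ Q m X A _ (A i `&` [set x | f x <= M]) i e e QX
    sA' mhi) => //.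
  - by apply: measurableI => //; exact: msr_rlip_le.
  - have := mass_le_med (mA i) A0 lf; rewrite -/M; have := rA i; lra.
  - by move=> x y [_ /= fx] [_ /= fy]; have := lf x y; lra.
rewrite (_ : _ `&` _ = (A i `&` [set x | f x <= M - e]) `|` (A i `&` [set x | M
  + e <= f x])).
  by rewrite (le_trans (mass_subU _ mlo mhi))//; lra.
rewrite -setIUr; congr (_ `&` _); apply/seteqP; split => x /=.
  by rewrite ler_normr => /orP[h|h]; [right|left]; lra.
by rewrite ler_normr => -[h|h]; apply/orP; [right|left]; lra.
Qed.

End rho.

                                                        

(** * Good configurations, and approximation of the spaces dominated by X *)

Section rlip_lattice.
Context (R : realType) (X : completeMetricType R).

Lemma rlip_max (f g : X -> R) : rlip f -> rlip g -> rlip (fun x =>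
  Num.max (f x) (g x)).
Proof.
move=> lf lg x y; have := lf x y; have := lg x y; have := mdist_ge0 x y.
by rewrite !maxEle; do 2 case: ifPn; rewrite -?ltNge; lra.
Qed.

Lemma rlip_min (f g : X -> R) : rlip f -> rlip g -> rlip (fun x =>
  Num.min (f x) (g x)).
Proof.
move=> lf lg x y; have := lf x y; have := lg x y; have := mdist_ge0 x y.
by rewrite !minEle; do 2 case: ifPn; rewrite -?ltNge; lra.
Qed.

Lemma rlip_cst a : rlip (fun _ : X => a).
Proof. by move=> x y; rewrite subrr mdist_ge0. Qed.

Lemma rlipDl a (f : X -> R) : rlip f -> rlip (fun x => a + f x).
Proof. by move=> lf x y; have := lf x y; lra. Qed.

Lemma rlip_abs a (f : X -> R) : rlip f -> rlip (fun x => `|f x - a|).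
Proof.
move=> lf x y; have := lf x y; have := lf y x; rewrite [mdist y x]metric_sym.
have := ler_normD (f x - f y) (f y - a).
have := rlip_norm x y lf; rewrite (_ : f x - f y + (f y - a) = f x - a); lra.
Qed.

Lemma rlip_bigmax (I : Type) (s : seq I) (f : I -> X -> R) a :
  (forall i, rlip (f i)) -> rlip (fun x => \big[Num.max/a]_(i <- s) f i x).
Proof.
move=> lf; elim: s => [|i s ih] x y.
  by rewrite !big_nil; exact: rlip_cst.
by rewrite !big_cons; exact: (rlip_max (lf i) ih).
Qed.

Lemma rlip_bigmin (I : Type) (s : seq I) (f : I -> X -> R) (f0 : X -> R) :
  rlip f0 -> (forall i, rlip (f i)) ->
  rlip (fun x => \big[Num.min/f0 x]_(i <- s) f i x).
Proof.
move=> l0 lf; elim: s => [|i s ih] x y; first by rewrite !big_nil; exact: l0.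
by rewrite !big_cons; exact: (rlip_min (lf i) ih).
Qed.

End rlip_lattice.

                                                                           
                                                              
(** The supremum distance of the coordinates [H] is only a pseudometric. The second term supplies
    the lower bound that [is_remetric] asks for and is at most [e]. *)
Definition coord_dist (R : realType) (X : completeMetricType R) (I : finType)
    (H : I -> X -> R) (e : R) (x y : X) : R :=
  Num.max (\big[Num.max/0]_i `|H i x - H i y|) (e * Num.min (mdist x y) 1).

Section coord_dist.
Context (R : realType) (X : completeMetricType R) (I : finType).
Context (H : I -> X -> R) (e : R).
Hypotheses (lH : forall i, rlip (H i)) (e0 : 0 < e) (e1 : e <= 1).

Lemma coord_dist_remetric : is_remetric (coord_dist H e).
Proof.
have m0 (x y : X) : 0 <= Num.min (mdist x y) 1
  by rewrite le_min mdist_ge0 ler01.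
split.
- move=> x y; rewrite /coord_dist metric_sym; congr Num.max.
  by apply: eq_bigr => i _; rewrite distrC.
- move=> y x z; rewrite /coord_dist ge_max; apply/andP; split.
    apply: bigmax_le => [|i _].
      by rewrite addr_ge0// le_max; apply/orP; right; rewrite mulr_ge0// ltW.
    apply: le_trans (ler_distD (H i y) _ _) _; apply: lerD.
      by rewrite le_max (le_bigmax _ (fun i => `|H i x - H i y|) i).
    by rewrite le_max (le_bigmax _ (fun i => `|H i y - H i z|) i).
  apply: le_trans (_ : e * Num.min (mdist x y) 1 + e * Num.min (mdist y z) 1 <=
    _); last first.
    by apply: lerD; rewrite le_max lexx orbT.
  rewrite -mulrDr ler_pM2l//; have := metric_triangle x y z.
  have := mdist_ge0 x y; have := mdist_ge0 y z.
  by rewrite !minEle; do 3 case: ifPn; rewrite -?ltNge; lra.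
- move=> x y; rewrite ge_max; apply/andP; split.
    by apply: bigmax_le => [|i _]; [exact: mdist_ge0|exact: rlip_norm].
  apply: le_trans (_ : 1 * Num.min (mdist x y) 1 <= _).
    by rewrite ler_wpM2r.
  by rewrite mul1r ge_min lexx.
- by exists e => // x y; rewrite le_max lexx orbT.
Qed.

Lemma coord_dist_approx (x y : X) a eta : 0 <= a -> 0 <= eta ->
  (forall i, `|H i x - H i y| <= a + eta) ->
  (exists i, a - eta <= `|H i x - H i y|) ->
  `|a - coord_dist H e x y| <= eta + e.
Proof.
move=> a0 eta0 hle [i hge]; rewrite distrC ler_norml /coord_dist.
have m0 : 0 <= e * Num.min (mdist x y) 1.
  by rewrite mulr_ge0 ?le_min ?mdist_ge0 ?ler01// ltW.
have m1 : e * Num.min (mdist x y) 1 <= e.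
  by rewrite ger_pMr// ge_min lexx orbT.
have b1 : \big[Num.max/0]_i `|H i x - H i y| <= a + eta.
  by apply: bigmax_le => //; rewrite addr_ge0.
have b2 := le_trans hge (le_bigmax 0 (fun i => `|H i x - H i y|) i).
move: b1 b2; set b := \big[_/_]_i _ => b1 b2.
by rewrite !maxEle; case: ifPn; rewrite -?ltNge; lra.
Qed.

End coord_dist.

Section good.
Context (R : realType) (k : nat).
Variables (d : 'I_k -> 'I_k -> R) (w : 'I_k -> R) (r c C : R).

                                                                                
                                                               
(** Clusters that look like the points of a finite space with distances [d] and weights [w], up to
    [e]. The field [good_max] says that these distances are almost the largest possible: pulling the
    clusters back to a dominating space of [Q] does not push [rho] above [d] by more than [e]. *)
Record good_config (Q : set (mmSpace R)) (e : R) (Y : mmSpace R) (A : 'I_k ->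
  set Y) :
    Prop := GoodConfig {
  good_in : Q Y;
  good_sep : separated A r c;
  good_resid : mmass Y (~` \big[setU/set0]_i A i) <= e;
  good_mass : forall i, `|mmass Y (A i) - w i| <= e;
  good_rho : forall i j, `|rho (A i) (A j) - d i j| <= e;
  good_max : forall Z, Q Z -> forall p : Z -> Y, mm_map p ->
    forall i j, rho (p @^-1` A i) (p @^-1` A j) <= d i j + e
}.

Definition good (Q : set (mmSpace R)) (e : R) :=
  [/\ exists (Y : mmSpace R) (A : 'I_k -> set Y), good_config Q e A,
      ~ has_clusters Q 2 (r / 2) C & ~ has_clusters Q k.+1 e e].

End good.

Section good_functions.
Context (R : realType) (k : nat).
Variables (d : 'I_k -> 'I_k -> R) (w : 'I_k -> R) (r c C e : R).
Variables (Q : set (mmSpace R)) (Y : mmSpace R) (A : 'I_k -> set Y).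
Hypotheses (r0 : 0 < r) (e0 : 0 < e) (er : e <= r / 2) (ec : e <= c).
Hypotheses (gA : good_config d w r c Q e A).
Hypotheses (nC : ~ has_clusters Q 2 (r / 2) C) (ne : ~ has_clusters Q k.+1 e e).

(** For every pair of clusters take a function that nearly attains their [rho], and let [F i] be the
    maximum over all pairs of the deviation from the median on [A i]. Removing from [A j] the k * k
    sets where one of the functions is far from its median on [A j] leaves [G j]. There the pair (i,
    j) bounds [F i] from below by about [d i j], and [rho] bounds every pair from above. *)
Lemma good_coords : exists (F : 'I_k -> Y -> R) (G : 'I_k -> set Y),
  [/\ forall i, rlip (F i), forall i, msr (G i), forall i, G i `<=` A i,
      forall i, mmass Y (A i) - 2 * e * (k * k)%:R <= mmass Y (G i) &
      forall i j z, G j z -> `|F i z - d i j| <= 3 * e].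
Proof.
have [QY [mA rA sA] _ _ rhoE _] := gA.
have ex (ab : 'I_k * 'I_k) : exists f : Y -> R, rlip f /\
    rho (A ab.1) (A ab.2) - e <= `|med (A ab.1) f - med (A ab.2) f|.
  have hs := has_sup_rho QY r0 (mA ab.1) (mA ab.2) (rA ab.1) (rA ab.2) nC.
  have [_ [f lf <-] hf] := sup_adherent e0 hs.
  by exists f; split => //; rewrite ltW.
have /choice[f hf] := ex.
have lf p : rlip (f p) by have [] := hf p.
pose m i p := med (A i) (f p).
pose bad j p := A j `&` [set z | e <= `|f p z - m j p|].
have mbad j p : msr (bad j p).
  apply: measurableI => //.
  exact: (msr_rlip_ge _ (rlip_abs _ (lf p))).
pose G j := A j `\` \big[setU/set0]_p bad j p.
have mU j : msr (\big[setU/set0]_p bad j p) by exact: bigsetU_measurable.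
have mG j : msr (G j) by exact: measurableD.
pose F i z := \big[Num.max/0]_p `|f p z - m i p|.
have nG j z p : G j z -> `|f p z - m j p| < e.
  move=> [Az nz]; rewrite ltNge; apply/negP => h; apply: nz.
  by apply/in_bigsetU; exists p.
exists F, G; split => //.
- by move=> i; apply: rlip_bigmax => p; exact: rlip_abs.
- by move=> i x [].
- move=> j; rewrite /G massD// lerD2l lerN2.
  apply: le_trans (_ : mmass Y (\big[setU/set0]_p bad j p) <= _).
    by apply: le_mass => //; exact: measurableI.
  apply: le_trans (mass_bigsetU _ _ _ _) _ => //.
  apply: le_trans (_ : \sum_(p : 'I_k * 'I_k) 2 * e <= _).
    by apply: ler_sum => p _;
      exact: (@med_concentration R Q Y k A j (f p) r c e QY r0 e0 er ec
        (good_sep gA) (lf p) ne).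
  by rewrite sumr_const cardT -cardE card_prod card_ord mulr_natr.
- move=> i j z Gz; rewrite ler_norml.
  have rE := rhoE i j; rewrite ler_norml in rE.
  have hm p : `|m i p - m j p| <= rho (A i) (A j).
    exact: (med_le_rho QY r0 (mA i) (mA j) (rA i) (rA j) nC (lf p)).
  apply/andP; split.
    have h1 : `|f (i, j) z - m i (i, j)| <= F i z.
      exact: (le_bigmax _ (fun p => `|f p z - m i p|) (i, j)).
    have [_ /= h2] := hf (i, j).
    have h3 := ler_distD (f (i, j) z) (m i (i, j)) (m j (i, j)).
    have h4 := nG j z (i, j) Gz.
    rewrite [X in _ <= X + _]distrC in h3.
    move: h2 h3 h4 rE; rewrite -/(m i (i, j)) -/(m j (i, j)); lra.
  rewrite lerBlDr; apply: bigmax_le.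
    have := hm (i, j); have := normr_ge0 (m i (i, j) - m j (i, j)); lra.
  move=> p _; have h1 := ler_distD (m j p) (f p z) (m i p).
  have h2 := nG j z p Gz; have h3 := hm p; rewrite distrC in h3.
  lra.
Qed.

End good_functions.

Lemma box_to_le (R : realType) (X Y : mmSpace R) (Q : set (mmSpace R)) (e
  : \bar R) :
  Q Y -> (box X Y <= e)%E -> (box_to X Q <= e)%E.
Proof. by move=> QY; apply: le_trans; apply: ereal_inf_lbound; exists Y. Qed.

Section good_box.
Context (R : realType) (n : nat).
Notation k := n.+1.
Variables (d : 'I_k -> 'I_k -> R) (w : 'I_k -> R) (r c C e : R).
Variables (Q : set (mmSpace R)).
Variables (X X' : mmSpace R) (pt : 'I_k -> X) (g : X -> X').
Hypotheses (ptd : forall i j, mdist (pt i) (pt j) = d i j).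
Hypotheses (ptw : forall A : set X, mmass X A = \sum_(i | `[< A (pt i) >]) w i).
Hypotheses (w0 : forall i, 0 <= w i) (mg : mm_map g).
Hypotheses (dQ : forall Y Z, Q Y -> mm_le Z Y -> Q Z).
Hypotheses (r0 : 0 < r) (e0 : 0 < e) (e1 : e <= 1) (er : e <= r / 2) (ec : e <=
  c).
Hypothesis (gQ : good d w r c C Q e).

Let w1 : \sum_i w i = 1.
Proof.
have := ptw setT; rewrite massT => ->; apply: eq_bigl => i.
by apply/esym/asboolP.
Qed.

Let label_param (phi : R -> 'I_k) :
  (forall i, measurable [set x : measurableTypeR R | phi x = i]) ->
  (forall i, mass (unif01 R) [set x : measurableTypeR R | phi x = i] = w i) ->
  parameter (fun s => g (pt (phi s))).
Proof.
move=> mphi hphi.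
have key B := @mass_fiber _ _ R (unif01 R) k phi [set i | B (g (pt i))] mphi.
apply: parameter_unif01 => [_ B mB|B bB].
  by rewrite setTI; have [] := key B.
have [mB hB] := key B.
apply: etrans (massE (unif01 R) mB) _;
  apply: etrans _ (esym (massE (mm_measure X') bB)).
congr _%:E; apply: etrans hB _; rewrite -(mmass_preimage mg bB) ptw.
by apply: eq_bigr => i _; exact: hphi.
Qed.

Let dxx i : d i i = 0. Proof. by rewrite -ptd mdistxx. Qed.

Let h l i := mdist (g (pt i)) (g (pt l)).

Let h_lip l i j : h l i <= h l j + d i j.
Proof.
rewrite -ptd addrC; apply: le_trans (metric_triangle _ (g (pt j)) _) _.
by rewrite lerD2r; case: mg => lg _; exact: lg.
Qed.

(** [F i] plays the role of the distance to the i-th point of X, and [h l] is 1-Lipschitz for [d].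
    Hence the McShane extension, the minimum over [i] of [h l i + F i z], is a 1-Lipschitz function
    that nearly equals [h l j] on [G j]. *)
Lemma good_extend : exists Y : mmSpace R, Q Y /\
  exists (H : 'I_k -> Y -> R) (G : 'I_k -> set Y),
  [/\ forall l, rlip (H l), forall i, msr (G i),
      forall i j, i != j -> G i `&` G j = set0,
      \sum_i Num.min (w i) (mmass Y (G i)) >=
        1 - e * (1 + k%:R * (1 + 2 * (k * k)%:R)) &
      forall l j z, G j z -> `|H l z - h l j| <= 3 * e].
Proof.
have [[Y [A gA]] nC ne] := gQ.
have [F [G [lF mG GA massG FG]]] := good_coords r0 e0 er ec gA nC ne.
have [QY sA resid massA _ _] := gA; have [mA rA _] := sA.
exists Y; split => //.
exists (fun l z => \big[Num.min/(h l ord0 + F ord0 z)]_i (h l i + F i z)), G;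
  split => //.
- by move=> l; apply: rlip_bigmin => [|i]; exact: rlipDl.
- move=> i j ij; have := separated_disj (lt_le_trans e0 ec) sA ij.
  by rewrite -!subset0 => AA z [/GA Ai /GA Aj]; exact: (AA z).
- set K := 2 * (k * k)%:R.
  have K0 : 0 <= K by rewrite mulr_ge0.
  (* Each cluster loses at most [e * K] in passing to [G i] and differs from [w i] by at most [e];
     the clusters together miss at most [e]. *)
  apply: le_trans (_ : \sum_i (mmass Y (A i) - e * (1 + K)) <= _); last first.
    apply: ler_sum => i _; rewrite le_min; apply/andP; split.
      have := massA i; rewrite ler_norml.
      have : 0 <= e * K by rewrite mulr_ge0// ltW.
      by rewrite mulrDr; lra.
    have := massG i; rewrite /K; set u := (k * k)%:R => hu.
    apply: le_trans hu; rewrite mulrDr; have := e0; lra.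
  rewrite sumrB sumr_const card_ord -(mulr_natl _ k).
  have dA i j : i != j -> A i `&` A j = set0.
    exact: (separated_disj (lt_le_trans e0 ec) sA).
  have := mass_bigsetU_disj (mm_measure Y) predT mA dA.
  have mU : msr (\big[setU/set0]_i A i) by exact: bigsetU_measurable.
  have := massC (mm_measure Y) mU; move: resid.
  move=> /[swap] -> /[swap] ->; set s := \sum_i _.
  set c1 := k%:R; set c2 := 1 + K; rewrite mulrDr mulr1; lra.
- move=> l j z Gz; rewrite ler_norml; apply/andP; split; last first.
    rewrite lerBlDr; apply: le_trans (bigmin_le_cond _ (fun i =>
      h l i + F i z) (isT : xpredT j)) _.
    have := FG j j z Gz; rewrite dxx subr0 ler_norml; lra.
  have key i : h l j - 3 * e <= h l i + F i z.
    have := FG i j z Gz; have := h_lip l j i;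
      rewrite -(ptd j i) metric_sym ptd ler_norml; lra.
  suff : h l j - 3 * e <= \big[Num.min/(h l ord0 + F ord0 z)]_i (h l i + F i z)
    by lra.
  by apply: le_bigmin => [|i _]; exact: key.
Qed.

Lemma good_box_to_le (eta : R) :
  e * (8 + k%:R * (1 + 2 * (k * k)%:R)) <= eta -> (box_to X' Q <= eta%:E)%E.
Proof.
move=> he.
have kk0 : 0 <= e * (k%:R * (1 + 2 * (k * k)%:R)).
  by rewrite mulr_ge0 ?ltW// mulr_ge0 ?addr_ge0 ?mulr_ge0.
have [Y [QY [H [G [lH mG dG sG HG]]]]] := good_extend.
(* The candidate close to X': the space Y with the distance read off from the coordinates. It is
   dominated by Y, hence belongs to [Q]. *)
pose Y' := mm_remetric (coord_dist_remetric lH e0 e1).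
apply: (@box_to_le _ _ Y'); first by apply: dQ QY _; exact: mm_remetric_le.
have [psi mpsi hpsi] := exists_parameter Y.
pose B i : set (measurableTypeR R) := psi @^-1` G i.
have mB i : measurable (B i).
  by have := mpsi measurableT _ (mG i); rewrite setTI.
have massB i : mass (unif01 R) (B i) = mmass Y (G i).
  exact: (congr1 fine (hpsi _ (mG i))).
have dB i j : i != j -> B i `&` B j = set0.
  by move=> /dG; rewrite -!subset0 => GG s [Bi Bj]; exact: (GG (psi s)).
(* The label [phi s] names the cluster that contains [psi s], except on a set of small mass. *)
have [phi [mphi phiw hphi]] := unif01_labels w0 w1 mB dB.
pose J i := B i `&` [set s : measurableTypeR R | phi s = i].
have mJ i : measurable (J i) by exact: measurableI.
apply: (@box_le R X' Y' eta (fun s => g (pt (phi s))) (psi : R -> Y')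
  (\big[setU/set0]_i J i)).
- by have := e0; move: he kk0; rewrite mulrDr; lra.
- exact: label_param.
- exact: mm_remetric_parameter.
- exact: bigsetU_measurable.
- rewrite mass_bigsetU_disj//; last first.
    by move=> i j /dB; rewrite -!subset0 => BB s [[Bi _] [Bj _]]; exact: (BB s).
  apply: le_trans (_ : \sum_i Num.min (w i) (mass (unif01 R) (B i)) <= _);
    last first.
    by apply: ler_sum => i _; exact: hphi.
  under eq_bigr do rewrite massB.
  apply: le_trans sG; have := e0; move: he; rewrite !mulrDr mulr1; lra.
move=> s t /in_bigsetU[i _ [Bi /= pi]] /in_bigsetU[j _ [Bj /= pj]].
have Bs : G (phi s) (psi s) by rewrite pi.
have Bt : G (phi t) (psi t) by rewrite pj.
rewrite mdist_remetricE.
have hd l : `|H l (psi s) - H l (psi t) - (h l (phi s) - h l (phi t))| <= 6 * e.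
  have := HG l _ _ Bs; have := HG l _ _ Bt; rewrite !ler_norml; lra.
apply: le_trans (_ : 6 * e + e <= _); last first.
  by have := e0; move: he kk0; rewrite mulrDr; lra.
apply: coord_dist_approx => //.
- exact: mdist_ge0.
- by rewrite mulr_ge0 ?ltW.
- move=> l; have h1 : `|h l (phi s) - h l (phi t)| <= mdist (g (pt (phi s))) (g
    (pt (phi t))).
    rewrite ler_norml /h; have := metric_triangle (g (pt (phi s))) (g (pt (phi
      t))) (g (pt l)).
    have := metric_triangle (g (pt (phi t))) (g (pt (phi s))) (g (pt l)).
    rewrite [mdist (g (pt (phi t))) (g (pt (phi s)))]metric_sym; lra.
  have := hd l; move: h1; rewrite !ler_norml; lra.
(* As in the Fréchet embedding, the distance of two points is attained by the coordinate that
   measures the distance to one of them. *)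
exists (phi t); have := hd (phi t); rewrite {2}/h mdistxx subr0 => h1.
rewrite ler_normr; apply/orP; left; move: h1; rewrite /h ler_norml; lra.
Qed.

End good_box.

                                                       

(** * Spaces approximated by good pyramids are dominated by X *)

Lemma exists_pos_lb (R : realType) (I : finType) (f : I -> R) :
  (forall i, 0 < f i) -> exists2 e, 0 < e & forall i, e <= f i.
Proof.
move=> f0; exists (\big[Num.min/1]_i f i); last by move=> i;
  exact: bigmin_le_cond.
by apply: lt_bigmin.
Qed.

Lemma pigeonhole_small (R : realType) (I : finType) (P : I -> R -> Prop) :
  (forall i e e', e <= e' -> P i e -> P i e') ->
  (forall e, 0 < e -> exists i, P i e) -> exists i, forall e, 0 < e -> P i e.
Proof.
move=> Pm Pe; apply: contrapT => /forallNP h.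
have /choice[f hf] i : exists e, 0 < e /\ ~ P i e.
  by have /existsNP[e /not_implyP] := h i; exists e.
have [e e0 ef] := exists_pos_lb (fun i => proj1 (hf i)).
have [i Pi] := Pe e e0; have [_] := hf i; apply; exact: Pm (ef i) Pi.
Qed.

Section points.
Context (R : realType) (X : mmSpace R).

Lemma exists_points (k : nat) :
  ~ (exists x : 'I_k.+1 -> X, injective x) ->
  exists (l : nat) (x : 'I_l -> X), injective x /\ forall z, exists a, x a = z.
Proof.
move=> nk; pose P l := `[< exists x : 'I_l -> X, injective x >].
have P0 : exists l, P l.
  exists 0%N; apply/asboolP; exists (fun=> point) => -[i i0]; exfalso;
    by rewrite ltn0 in i0.
have Pk l : P l -> (l <= k)%N.
  move=> /asboolP[x xinj]; rewrite leqNgt; apply/negP => kl; apply: nk.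
  exists (fun i => x (widen_ord kl i)) => i j /xinj /(congr1 val) /= ij.
  exact: val_inj.
have [l /asboolP[x xinj] lmax] := ex_maxnP P0 Pk; exists l, x; split => // z.
apply: contrapT => /forallNP nz.
suff /lmax : P l.+1 by rewrite ltnn.
apply/asboolP; exists (fun i => if unlift ord0 i is Some j then x j else z).
move=> i j; case: unliftP => [i' ->|->]; case: unliftP => [j' ->|->] //.
- by move=> /xinj ->.
- by move=> xz; case: (nz i').
- by move=> /esym xz; case: (nz j').
Qed.

Lemma msr_ball (x : X) e : msr [set z | mdist z x < e].
Proof. by apply: sub_sigma_algebra; exact: open_mdist_lt. Qed.

Lemma mmass_ball_gt0 (x : X) e : 0 < e -> 0 < mmass X [set z | mdist z x < e].
Proof.
move=> e0; have : supp (mm_measure X : set X -> \bar R) x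
  by rewrite mm_full_supp.
move=> /(_ [set z | mdist z x < e]) h; rewrite -lte_fin.
rewrite -(massE (mm_measure X) (@msr_ball x e)); apply: h.
by split; [exact: open_mdist_lt|rewrite /= mdistxx].
Qed.

Lemma msr_point (x : X) : msr [set x].
Proof.
rewrite (_ : [set x] = [set z | mdist z x <= 0]).
  apply: msr_rlip_le => y z; have := metric_triangle y z x; lra.
apply/seteqP; split => [_ ->|z /= h]; first by rewrite /= mdistxx.
by apply: mdist_positivity; apply/eqP; rewrite eq_le h mdist_ge0.
Qed.

Lemma exists_sep_points (m : nat) (x : 'I_m -> X) : injective x ->
  exists2 D, 0 < D & forall a b, a != b -> D <= mdist (x a) (x b).
Proof.
move=> xinj.
pose f (ab : 'I_m * 'I_m) := if ab.1 == ab.2 then 1 else mdist (x ab.1) (x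
  ab.2).
have f0 ab : 0 < f ab.
  rewrite /f; case: ifPn => // ab12; rewrite mdist_gt0.
  by apply: contra ab12 => /eqP/xinj ->.
have [D D0 hD] := exists_pos_lb f0.
by exists D => // a b /negbTE ab; have := hD (a, b); rewrite /f /= ab.
Qed.

End points.

Lemma closure_mdist (R : realType) (X : completeMetricType R) (A : set X) x e :
  closure A x -> 0 < e -> exists2 y, A y & mdist x y < e.
Proof.
move=> Ax e0; have [y [Ay xy]] := Ax (ball x e) (nbhsx_ballx x _ e0).
by exists y => //; move: xy; rewrite ballEmdist.
Qed.

(** Sets are transported from X to Y through the two parameters, restricted to the large set where
    distances nearly agree. This costs at most [e] in mass and in distance. *)
Lemma box_lt_clusters (R : realType) (X Y : mmSpace R) (e : R) (m : nat)
    (S : 'I_m -> set X) : (box X Y < e%:E)%E -> (forall a, msr (S a)) ->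
  exists B : 'I_m -> set Y, [/\ forall a, msr (B a),
    forall a, mmass X (S a) - e <= mmass Y (B a) &
    forall a b D, (forall u v, S a u -> S b v -> D <= mdist u v) ->
      forall x y, B a x -> B b y -> D - e <= mdist x y].
Proof.
move=> /ereal_inf_lt[_ [e' [e'0 [phi [psi [I0 [pphi ppsi [mI I01] hI hd]]]]]
  <-]].
rewrite lte_fin => e'e mS.
have arith (x1 x2 x3 x4 : R) :
    1 - e' <= x2 -> x3 <= x1 + (1 - x2) -> x1 <= x4 -> x3 - e <= x4.
  by clear -e'e; lra.
(* The image need not be Borel. Its closure is, and satisfies the same lower bounds on distances. *)
exists (fun a => closure (psi @` (I0 `&` phi @^-1` S a))).
have mB (A : set Y) : msr (closure A).
  rewrite -[closure A]setCK; apply: measurableC; apply: sub_sigma_algebra.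
  by apply: closed_openC; exact: closed_closure.
split => //.
- move=> a; set B := closure _.
  have [mphi hphi] := pphi; have [mpsi hpsi] := ppsi.
  have m01 : measurable (`[0, 1[%classic : set (measurableTypeR R))
    by exact: measurable_itv.
  pose T : set (measurableTypeR R) := `[0, 1[%classic `&` phi @^-1` S a.
  pose U : set (measurableTypeR R) := `[0, 1[%classic `&` psi @^-1` B.
  have mT : measurable T by exact: mphi.
  have mU : measurable U by apply: mpsi => //; exact: mB.
  have TE : mass (unif01 R) T = mmass X (S a).
    apply: (congr1 fine); apply: etrans (unif01E _) _.
    by rewrite /T setIA setIid; exact: hphi (mS a).
  have UE : mass (unif01 R) U = mmass Y B.
    apply: (congr1 fine); apply: etrans (unif01E _) _.
    by rewrite /U setIA setIid; apply: hpsi; exact: mB.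
  have IE : 1 - e' <= mass (unif01 R) I0.
    rewrite -lee_fin -massE//; apply: le_trans hI _.
    by rewrite [leRHS]unif01E setIidr.
  have IT : mass (unif01 R) T <= mass (unif01 R) (I0 `&` T) + (1 - mass (unif01
    R) I0).
    rewrite -massC// -[X in mass _ X <= _](setUIDK T I0).
    rewrite [I0 `&` T]setIC; apply: le_trans (mass_subU _ _ _) _.
    - exact: measurableI.
    - exact: measurableD.
    rewrite lerD2l; apply: le_mass; [exact: measurableD|exact: measurableC|].
    by move=> s [].
  have IU : mass (unif01 R) (I0 `&` T) <= mass (unif01 R) U.
    apply: le_mass => //; first exact: measurableI.
    move=> s [Is [s01 Ss]]; split => //; apply: subset_closure.
    by exists s.
  rewrite -TE -UE; exact: arith IE IT IU.
- move=> a b D hD x y Bx By.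
  clear hI pphi ppsi mI; apply/ler_addgt0Pl => h h0.
  have h2 : 0 < h / 2 by rewrite divr_gt0.
  have [_ [s [Is Ss] <-] xs] := closure_mdist Bx h2.
  have [_ [t [It St] <-] yt] := closure_mdist By h2.
  have := hd _ _ Is It; have := hD _ _ Ss St; rewrite ler_norml.
  have := metric_triangle x (psi s) y; have := metric_triangle x y (psi t).
  have := metric_triangle (psi s) x (psi t);
    rewrite [mdist (psi s) x]metric_sym; lra.
Qed.

Definition directed (R : realType) (Q : set (mmSpace R)) :=
  forall Y Y', Q Y -> Q Y' -> exists Z, [/\ Q Z, mm_le Y Z & mm_le Y' Z].

Section good_dominated.
Context (R : realType) (k : nat).
Variables (d : 'I_k -> 'I_k -> R) (w : 'I_k -> R) (r c C : R).
Variables (X X1 : mmSpace R) (pt : 'I_k -> X).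
Hypotheses (ptd : forall i j, mdist (pt i) (pt j) = d i j).
Hypotheses (pt_bij : bijective pt) (bX : forall A : set X, borel A).
Hypotheses (ptw : forall A : set X, mmass X A = \sum_(i | `[< A (pt i) >]) w i).
Hypotheses (r0 : 0 < r) (c0 : 0 < c).
Hypothesis near : forall e, 0 < e -> exists Q,
  [/\ directed Q, good d w r c C Q e &
      exists2 Y, Q Y & (box X1 Y < e%:E)%E].

(** Small balls around k+1 distinct points have positive mass by full support; transported to a
    nearby member of [Q] they would be k+1 clusters. *)
Let few_points : ~ (exists x : 'I_k.+1 -> X1, injective x).
Proof.
move=> [x /exists_sep_points[D D0 xD]].
have D3 : 0 < D / 3 by rewrite divr_gt0.
have [b b0 hb] := exists_pos_lb (fun a => mmass_ball_gt0 (x a) D3).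
have [|Q [_ [_ _ ne] [Y QY bY]]] := near (_ : 0 < Num.min (b / 2) (D / 6)).
  by rewrite lt_min !divr_gt0.
set e := Num.min _ _ in ne bY.
have eb : e <= b / 2 by rewrite /e ge_min lexx.
have eD : e <= D / 6 by rewrite /e ge_min lexx orbT.
have [B [mB hB dB]] := box_lt_clusters bY (fun a => msr_ball (x a) (D / 3)).
apply: ne; exists Y => //; exists B; split => //.
  by move=> a; apply: le_trans (hB a); have := hb a; lra.
move=> a a' aa' y y' By By'; apply: le_trans (dB _ _ (D / 3) _ _ _ By By');
  first lra.
move=> u v /= xu xv; have := xD _ _ aa'.
have := metric_triangle (x a) u (x a'); have := metric_triangle u v (x a').
by move: xu xv; rewrite [mdist (x a) u]metric_sym; lra.
Qed.

Section with_points.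
Variables (l : nat) (x : 'I_l -> X1) (x_inj : injective x).
Hypothesis (x_surj : forall z, exists a, x a = z).

Let v a := mmass X1 [set x a].

Let mass_points (B : set X1) : mmass X1 B = \sum_(a | `[< B (x a) >]) v a.
Proof.
rewrite -mass_bigsetU_disj; last 2 first.
- by move=> a; exact: msr_point.
- move=> a b /eqP ab; rewrite -subset0 => z [/= -> xx]; apply: ab; exact: x_inj.
congr mass; apply/seteqP; split => z.
  by have [a <-] := x_surj z => Bx; apply/in_bigsetU; exists a => //;
    exact/asboolP.
by move=> /in_bigsetU[a /asboolP Ba /= ->].
Qed.

Let sum_v : \sum_a v a = 1.
Proof.
have := mass_points setT; rewrite massT => ->; apply: eq_bigl => a.
by apply/esym/asboolP.
Qed.

Let sum_w : \sum_i w i = 1.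
Proof.
have := ptw setT; rewrite massT => ->; apply: eq_bigl => i.
by apply/esym/asboolP.
Qed.

Let approx_map (e : R) (g : {ffun 'I_k -> 'I_l}) :=
  (forall a, v a <= \sum_(i | g i == a) w i + (2 * k%:R + 2) * e) /\
  (forall i j, mdist (x (g i)) (x (g j)) <= d i j + 2 * e).

(** In a space Z of [Q] above both the clustered space and one close to X1, each cluster [A' i]
    lies, up to small mass, over a single point [x (g i)]. Masses then compare by counting, and
    distances by testing [rho] against the distance function of the part over [x (g i)], where
    [good_max] bounds [rho] from above. *)
Let exists_approx_map (e D : R) : 0 < e -> 0 < D ->
  (forall a b, a != b -> D <= mdist (x a) (x b)) -> e <= D / 2 ->
  e <= c -> (4 * l%:R + 2) * e <= r -> exists g, approx_map e g.
Proof.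
move=> e0 D0 hD eD ec erl.
have [Q [dQ [[Y [A gA]] nC ne] [Y1 QY1 bY1]]] := near e0.
have [B1 [mB1 hB1 dB1]] := box_lt_clusters bY1 (fun a => msr_point (x a)).
have [QY sA0 resid0 massA0 rhoA0 maxA0] := gA.
have [Z [QZ [p lp mp] [q lq mq]]] := dQ Y Y1 QY QY1.
have mapp : mm_map p by split.
have mapq : mm_map q by split.
pose A' i := p @^-1` A i; pose B a := q @^-1` B1 a.
have sA : separated A' r c by exact: separated_preimage.
have [mA rA sepA] := sA.
have mB a : msr (B a) by exact: msr_preimage.
have vB a : v a - e <= mmass Z (B a) by rewrite (mmass_preimage mapq (mB1 a));
  exact: hB1.
have massA i : mmass Z (A' i) <= w i + e.
  have mA0i : msr (A i) by case: sA0.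
  rewrite (mmass_preimage mapp mA0i).
  by have := massA0 i; rewrite ler_norml; lra.
have mUA0 : msr (\big[setU/set0]_i A i) by apply: bigsetU_measurable => i _;
  case: sA0.
have resid : mmass Z (p @^-1` (~` \big[setU/set0]_i A i)) <= e.
  by rewrite mmass_preimage//; exact: measurableC.
have dB a b z z' : B a z -> B b z' -> mdist (x a) (x b) - e <= mdist z z'.
  move=> Bz Bz'; apply: le_trans (lq z z').
  by apply: (dB1 a b _ _ _ _ Bz Bz') => _ _ -> ->.
have sB a b z z' : a != b -> B a z -> B b z' -> e <= mdist z z'.
  by move=> /hD ab Bz Bz'; have := dB a b z z' Bz Bz'; lra.
have disjB a b : a != b -> B a `&` B b = set0.
  move=> ab; rewrite -subset0 => z [Bz Bz']; have := sB _ _ _ _ ab Bz Bz'.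
  by rewrite mdistxx; lra.
have l0 : 0 <= l%:R :> R by [].
have le0 : 0 <= l%:R * e by rewrite mulr_ge0// ltW.
have er : e <= r / 2 by lra.
have sAe : separated A' e e.
  split => // [i|i j ij y z Ay Az]; first by rewrite (le_trans _ (rA i))//; lra.
  by rewrite (le_trans ec)// (sepA i j).
have mUB : msr (\big[setU/set0]_a B a) by exact: bigsetU_measurable.
have massUB : mmass Z (~` \big[setU/set0]_a B a) <= l%:R * e.
  rewrite massC// mass_bigsetU_disj//.
  have : \sum_a (v a - e) <= \sum_a mmass Z (B a) by apply: ler_sum.
  rewrite sumrB sum_v sumr_const card_ord -mulr_natl; lra.
have mAB i a : msr (A' i `&` B a) by exact: measurableI.
have Asub i (T : set Z) : msr T -> mmass Z (A' i `&` T) <=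
    \sum_a mmass Z ((A' i `&` T) `&` B a) + l%:R * e.
  move=> mT; have mAT : msr (A' i `&` T) by exact: measurableI.
  apply: le_trans (_ : mmass Z (\big[setU/set0]_a ((A' i `&` T) `&` B a) `|`
      ~` \big[setU/set0]_a B a) <= _).
    apply: le_mass => //.
      apply: measurableU; last exact: measurableC.
      by apply: bigsetU_measurable => a _; exact: measurableI.
    move=> z Az; have [/in_bigsetU[a _ Ba]|nB] := pselect ((\big[setU/set0]_a B
      a) z).
      by left; apply/in_bigsetU; exists a.
    by right.
  apply: le_trans (mass_subU _ _ _) _.
  - by apply: bigsetU_measurable => a _; exact: measurableI.
  - exact: measurableC.
  - by apply: lerD => //; apply: mass_bigsetU => a; exact: measurableI.
(* Otherwise [A' i] would have mass at most [2 * l * e], which is less than [r]. *)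
have /choice[g0 hg0] i : exists a, e <= mmass Z (A' i `&` B a).
  apply: contrapT => /forallNP h.
  have h1 : \sum_a mmass Z ((A' i `&` setT) `&` B a) <= \sum_(a < l) e.
    apply: ler_sum => a _; rewrite setIT leNgt; apply/negP => /ltW; exact: h.
  have := Asub i setT measurableT; rewrite setIT in h1 *.
  move: h1; rewrite sumr_const card_ord -mulr_natl; have := rA i; lra.
(* Two parts of mass [e] over different points would split the cluster and give k+1 clusters. *)
have small i b : b != g0 i -> mmass Z (A' i `&` B b) < e.
  move=> bg; rewrite ltNge; apply/negP => h; apply: ne.
  apply: (@has_clusters_split _ Q k Z A' (A' i `&` B b) (A' i `&` B (g0 i)) i e
    e) => //.
  by move=> z z' [_ Bz] [_ Bz']; exact: (sB b (g0 i)).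
have Aout i : mmass Z (A' i `&` ~` B (g0 i)) <= 2 * (l%:R * e).
  have := Asub i (~` B (g0 i)) (measurableC (mB _)).
  have : \sum_a mmass Z ((A' i `&` ~` B (g0 i)) `&` B a) <= \sum_(a < l) e.
    apply: ler_sum => a _; have [->|/small/ltW h] := eqVneq a (g0 i).
      by rewrite -setIA setICl setI0 mass0 ltW.
    apply: le_trans h; apply: le_mass => //; last by move=> z [[]].
    by apply: measurableI => //; apply: measurableI => //; exact: measurableC.
  rewrite sumr_const card_ord -mulr_natl; lra.
exists [ffun i => g0 i]; split.
  move=> a; under eq_bigl do rewrite ffunE.
  have h1 : mmass Z (B a) <= \sum_i mmass Z (A' i `&` B a) + e.
    apply: le_trans (_ : mmass Z (\big[setU/set0]_i (A' i `&` B a) `|`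
      p @^-1` (~` \big[setU/set0]_i A i)) <= _).
      apply: le_mass => //.
        apply: measurableU; first exact: bigsetU_measurable.
        by apply: msr_preimage => //; exact: measurableC.
      move=> z Bz; have [/in_bigsetU[i _ Ai]|nA] := pselect ((\big[setU/set0]_i
        A i) (p z)).
        by left; apply/in_bigsetU; exists i.
      by right.
    apply: le_trans (mass_subU _ _ _) _.
    - exact: bigsetU_measurable.
    - by apply: msr_preimage => //; exact: measurableC.
    - by apply: lerD => //; exact: mass_bigsetU.
  have h2 : \sum_i mmass Z (A' i `&` B a) <=
      \sum_i ((if g0 i == a then w i else 0) + 2 * e).
    apply: ler_sum => i _; case: eqP => [_|/eqP ga].
      apply: le_trans (_ : mmass Z (A' i) <= _); first exact: le_mass.
      by have := massA i; lra.
    by rewrite eq_sym in ga; have := small _ _ ga; lra.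
  rewrite big_split/= -big_mkcond/= sumr_const card_ord -mulr_natl in h2.
  have := vB a; rewrite mulrDl; lra.
move=> i j; rewrite !ffunE.
have [->|ab] := eqVneq (g0 i) (g0 j).
  by rewrite mdistxx -ptd addr_ge0 ?mdist_ge0// mulr_ge0// ltW.
have nB : B (g0 i) !=set0.
  apply/set0P/eqP => B0; have := hg0 i; rewrite B0 setI0 mass0; lra.
have [f [lf f0 fge fc]] := exists_dist_fun nB.
have := maxA0 Z QZ p mapp i j.
have := med_le_rho QZ r0 (mA i) (mA j) (rA i) (rA j) nC lf.
have h1 : med (A' i) f <= 0.
  (* The cluster lies over its point up to mass [2 * l * e], less than half of its own mass, so its
     median is governed by the values on [B (g0 i)]. *)
  apply: med_le => //; apply: le_lt_trans (_ : mmass Z (A' i `&` ~` B (g0 i)) <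
    _).
    apply: le_mass.
    - by apply: measurableI => //; exact: msr_rlip_gt.
    - by apply: measurableI => //; exact: measurableC.
    - by move=> z [Az /= fz]; split => // /f0 fz0; rewrite fz0 ltxx in fz.
  by have := Aout i; have := rA i; lra.
have h2 : mdist (x (g0 i)) (x (g0 j)) - e <= med (A' j) f.
  apply: med_ge => //; apply: le_lt_trans (_ : mmass Z (A' j `&` ~` B (g0 j)) <
    _).
    apply: le_mass.
    - by apply: measurableI => //; exact: msr_rlip_lt.
    - by apply: measurableI => //; exact: measurableC.
    - move=> z [Az /=]; rewrite ltNge => /negP fz; split => // Bz; apply: fz.
      by apply: fc => y By; rewrite metric_sym; exact: dB.
  by have := Aout j; have := rA j; lra.
rewrite distrC ler_norml; lra.
Qed.

(** There are finitely many maps [g], so one of them works for all errors; then the error tends to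
    0. *)
Let exists_map : exists g : {ffun 'I_k -> 'I_l},
  (forall a, v a <= \sum_(i | g i == a) w i) /\
  (forall i j, mdist (x (g i)) (x (g j)) <= d i j).
Proof.
have [D D0 hD] := exists_sep_points x_inj.
have [||g hg] := @pigeonhole_small R {ffun 'I_k -> 'I_l} (fun g e =>
  approx_map e g).
- move=> g e e' ee' [h1 h2]; split => [a|i j].
    by apply: le_trans (h1 a) _; rewrite lerD2l ler_wpM2l// addr_ge0// mulr_ge0.
  by apply: le_trans (h2 i j) _; lra.
- move=> e e0.
  have l0 : 0 < 4 * l%:R + 2 :> R by rewrite ltr_wpDl// mulr_ge0.
  pose e' := Num.min e (Num.min (D / 2) (Num.min c (r / (4 * l%:R + 2)))).
  have e'0 : 0 < e' by rewrite !lt_min e0 c0 !divr_gt0.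
  have [|||g hg] := @exists_approx_map e' D e'0 D0 hD.
  - by rewrite /e' !ge_min lexx orbT.
  - by rewrite /e' !ge_min lexx !orbT.
  - rewrite mulrC -ler_pdivlMr//; by rewrite /e' !ge_min lexx !orbT.
  exists g; have [h1 h2] := hg.
  have e'e : e' <= e by rewrite /e' ge_min lexx.
  split => [a|i j].
    by apply: le_trans (h1 a) _; rewrite lerD2l ler_wpM2l// addr_ge0// mulr_ge0.
  by apply: le_trans (h2 i j) _; lra.
exists g; split => [a|i j]; apply/ler_addgt0Pr => e e0.
  have K0 : 0 < 2 * k%:R + 2 :> R by rewrite ltr_wpDl// mulr_ge0.
  have [h _] := hg (e / (2 * k%:R + 2)) (divr_gt0 e0 K0).
  by apply: le_trans (h a) _; rewrite mulrC divfK// gt_eqF.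
have e2 : 0 < e / 2 by rewrite divr_gt0.
by have [_ h] := hg _ e2; apply: le_trans (h i j) _; lra.
Qed.

Lemma mm_le_of_points : mm_le X1 X.
Proof.
have [g [hv hd]] := exists_map.
have [pt' ptK pt'K] := pt_bij.
(* Both families of masses have total 1, so the inequalities between them are equalities. *)
have sv : forall a, v a = \sum_(i | g i == a) w i.
  have h0 : \sum_a (\sum_(i | g i == a) w i - v a) = 0.
    apply/eqP; rewrite sumrB sum_v subr_eq0 -sum_w; apply/eqP/esym.
    exact: (partition_big g predT).
  move/eqP : h0; rewrite psumr_eq0 => [/allP h a|a _]; last by rewrite subr_ge0.
  by have := h a (mem_index_enum _); rewrite /= subr_eq0 => /eqP.
exists (fun z => x (g (pt' z))).
  by move=> z z'; rewrite -{2}(pt'K z) -{2}(pt'K z') ptd.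
move=> B bB.
have -> : pushforward (mm_measure X) ((fun z =>
  x (g (pt' z))) : borelType X -> borelType X1) B =
    (mmass X ((fun z => x (g (pt' z))) @^-1` B))%:E.
  by rewrite /pushforward massE//; exact: bX.
apply: etrans _ (esym (massE (mm_measure X1) bB)); congr _%:E.
rewrite ptw mass_points (eq_bigr _ (fun a _ => sv a)).
rewrite [LHS](partition_big g (fun a => `[< B (x a) >]))/=; last first.
  by move=> i; rewrite /preimage/= ptK.
apply: eq_bigr => a /asboolP Ba; apply: eq_bigl => i.
rewrite /preimage/= ptK; case: eqP => [->|]; last by rewrite andbF.
by rewrite andbT; apply/asboolP.
Qed.

End with_points.

Lemma good_dominated : mm_le X1 X.
Proof.
have [l [x [x_inj x_surj]]] := exists_points few_points.
exact: mm_le_of_points x_inj x_surj.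
Qed.

End good_dominated.

                                           

(** * Separation distance, observable diameter and scaling of pyramids *)

Section pyramid_invariants.
Context (R : realType).
Implicit Types (P : set (mmSpace R)).

Lemma le_sep (X : mmSpace R) N (kappa kappa' : 'I_N.+1 -> R) :
  (forall i, kappa' i <= kappa i) -> (sep X kappa <= sep X kappa')%E.
Proof.
move=> kk; apply: le_ereal_sup => y [->|[A hA <-]]; first by left.
right; exists A => // i; have [bA h] := hA i; split => //.
by apply: le_trans h; rewrite lee_fin.
Qed.

(** The expression is monotone in [delta], so its limit from the right is an infimum. For the
    observable diameter the monotonicity is reversed and the limit is a supremum
    ([pyramid_obs_diamE]). *)
Lemma pyramid_sepE P N (kappa : 'I_N.+1 -> R) : pyramid_sep P kappa =
  ereal_inf [set ereal_sup [set sep X (fun i => kappa i - delta) | X in P]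
    | delta in `]0, +oo[%classic].
Proof.
apply/cvg_lim => //; apply: (@nondecreasing_at_right_cvge _ _ 0 +oo%O) => //.
move=> a b _ _ ab; apply: ge_ereal_sup => _ [X PX <-].
apply: le_trans (_ : sep X (fun i => (kappa i - b)%R) <= _)%E.
  by apply: le_sep => i; rewrite lerD2l lerN2.
by apply: ereal_sup_ubound; exists X.
Qed.

Lemma has_clusters_le_pyramid_sep P N (r c : R) :
  has_clusters P N.+1 r c -> (c%:E <= pyramid_sep P (fun _ : 'I_N.+1 => r))%E.
Proof.
move=> [X PX [A [mA rA sA]]]; rewrite pyramid_sepE.
apply: le_ereal_inf_tmp => _ [delta /= d0 <-]; move: d0;
  rewrite in_itv/= andbT => d0.
apply: le_trans (_ : sep X (fun _ : 'I_N.+1 => (r - delta)%R) <= _)%E;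
  last first.
  by apply: ereal_sup_ubound; exists X.
apply: le_trans (_ : \big[mine/+oo%E]_(ij : 'I_N.+1 * 'I_N.+1 | ij.1 != ij.2)
        set_dist (A ij.1) (A ij.2) <= _)%E.
  apply: le_bigmin => [|[i j] /= ij]; first exact: leey.
  apply: le_ereal_inf_tmp => _ [x Ax [y Ay <-]]; rewrite lee_fin.
  exact: (sA i j).
apply: ereal_sup_ubound; right; exists A => // i; split; first exact: mA.
rewrite (massE (mm_measure X) (mA i)) lee_fin; have := rA i; lra.
Qed.

Lemma lt_pyramid_sep P N (kappa : 'I_N.+1 -> R) (r c : R) : 0 <= c ->
  (forall i, r < kappa i) -> (c%:E < pyramid_sep P kappa)%E ->
    has_clusters P N.+1 r c.
Proof.
move=> c0 rk; rewrite pyramid_sepE => hc.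
have k0 i : 0 < kappa i - r by rewrite subr_gt0.
have [delta d0 hd] := exists_pos_lb k0.
have : (c%:E < ereal_sup [set sep X (fun i => (kappa i - delta)%R) | X in P])%E.
  apply: lt_le_trans hc _; apply: ereal_inf_lbound; exists delta => //.
  by rewrite /= in_itv/= d0.
move=> /ereal_sup_gt[_ [X PX <-]] /ereal_sup_gt[_ [->|[A hA <-]] hcA].
  by move: hcA; rewrite lte_fin ltNge c0.
exists X => //; exists A; split => [i|i|i j ij x y Ax Ay].
- by have [] := hA i.
- have [mA] := hA i; rewrite (massE (mm_measure X) mA) lee_fin; have := hd i;
    lra.
have := lt_le_trans hcA (bigmin_le_cond _ (fun ij => set_dist (A ij.1) (A ij.2))
  (ij : (fun ij => ij.1 != ij.2) (i, j))).
rewrite -lee_fin => /ltW/le_trans; apply; apply: ereal_inf_lbound.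
by exists x => //; exists y.
Qed.

Lemma le_obs_diam (X : mmSpace R) (kappa kappa' : R) :
  kappa <= kappa' -> (obs_diam X kappa' <= obs_diam X kappa)%E.
Proof.
move=> kk; apply: ge_ereal_sup => _ [f lf <-].
apply: le_trans (ereal_sup_ubound _); last by exists f.
apply: le_ereal_inf => _ [A [bA hA] <-]; exists A => //; split => //.
by apply: le_trans hA; rewrite lee_fin lerD2l lerN2.
Qed.

Lemma pyramid_obs_diamE P (kappa : R) : pyramid_obs_diam P kappa =
  ereal_sup [set ereal_sup [set obs_diam X (kappa + delta) | X in P]
    | delta in `]0, +oo[%classic].
Proof.
apply/cvg_lim => //; apply: (@nonincreasing_at_right_cvge _ _ 0 +oo%O) => //.
move=> a b _ _ ab; apply: ge_ereal_sup => _ [X PX <-].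
apply: le_trans (_ : obs_diam X (kappa + a)%R <= _)%E.
  by apply: le_obs_diam; rewrite lerD2l.
by apply: ereal_sup_ubound; exists X.
Qed.

(** A set whose preimage has mass at least [1 - kappa] meets the images of both clusters, and the
    distance function of the first one takes values 0 and at least [c] on them. *)
Lemma separated_le_obs_diam (X : mmSpace R) (A : 'I_2 ->
  set X) (r c kappa : R) :
  0 < r -> 0 <= c -> kappa < r -> separated A r c ->
    (c%:E <= obs_diam X kappa)%E.
Proof.
move=> r0 c0 kr [mA rA sA].
have nA : A ord0 !=set0.
  by apply/set0P/eqP => A0; have := rA ord0; rewrite A0 mass0; lra.
have [f [lf f0 fge fc]] := exists_dist_fun nA.
have lf1 : lip1 (f : X -> R^o).
  by move=> x y; rewrite /mdist/= distrC rlip_norm.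
apply: le_trans (ereal_sup_ubound _); last by exists f.
apply: le_ereal_inf_tmp => _ [B [bB hB] <-].
have mfB : msr (f @^-1` B).
  by apply: borel_preimage bB => V; exact: (@open_lip1_preimage _ X R^o).
have hfB : 1 - kappa <= mmass X (f @^-1` B).
  by rewrite -lee_fin -(massE (mm_measure X) mfB).
have meets i : exists2 x, A i x & B (f x).
  apply: contrapT => /forall2NP h.
  have : mmass X (A i `|` f @^-1` B) = mmass X (A i) + mmass X (f @^-1` B).
    apply: massU => //; rewrite -subset0 => x [Ax Bx]; by have [] := h x.
  have := mass_le1 (mm_measure X) (measurableU _ _ (mA i) mfB).
  by move=> + E; rewrite E; have := rA i; lra.
have [x Ax Bx] := meets ord0; have [y Ay By] := meets ord_max.
apply: le_trans (_ : (mdist (f x : R^o) (f y : R^o))%:E <= _)%E.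
  rewrite lee_fin /mdist/= (f0 _ Ax) subr0 ger0_norm//; apply: fc => z Az.
  by apply: (sA ord_max ord0).
by apply: ereal_sup_ubound; right; exists (f x) => //; exists (f y).
Qed.

Lemma obs_diam_bound P (r : R) : 0 < r ->
  (forall kappa : R, 0 < kappa < 1 -> (pyramid_obs_diam P kappa < +oo)%E) ->
  exists M, forall c, M < c -> ~ has_clusters P 2 r c.
Proof.
move=> r0 fin; pose s := Num.min r 1.
have s0 : 0 < s by rewrite lt_min r0 ltr01.
have s1 : s <= 1 by rewrite ge_min lexx orbT.
have sr : s <= r by rewrite ge_min lexx.
(* With [kappa] and [delta] both equal to [s / 3], their sum stays below the mass [s] of the
   clusters. *)
have := fin (s / 3); rewrite pyramid_obs_diamE.
set L := ereal_sup _ => hL; exists (Num.max 0 (fine L)) => c.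
rewrite gt_max => /andP[c0 Lc] /(has_clusters_mono sr (lexx c))[X PX [A sA]].
have : (c%:E <= L)%E.
  apply: le_trans (_ : obs_diam X (s / 3 + s / 3)%R <= _)%E.
    by apply: separated_le_obs_diam sA => //; [exact: ltW|lra].
  apply: le_trans (_ : ereal_sup [set obs_diam X (s / 3 + s / 3)%R | X in P] <=
    _)%E.
    by apply: ereal_sup_ubound; exists X.
  by apply: ereal_sup_ubound; exists (s / 3) => //;
    rewrite /= in_itv/= andbT divr_gt0.
have : (L < +oo)%E by apply: hL; apply/andP; split; lra.
move: Lc; case: L {hL} => [l /=|//|//] lc _.
by rewrite lee_fin leNgt lc.
Qed.

End pyramid_invariants.

Section pyramid_scale.
Context (R : realType) (t : {posnum R}) (P : set (mmSpace R)).
Hypothesis pP : pyramid P.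

Let tV : {posnum R} := (t%:num^-1)%:pos.

Lemma mdist_mm_scale (s : {posnum R}) (X : mmSpace R) (x y : X) :
  mdist (x : mm_scale s X) (y : mm_scale s X) = s%:num * mdist x y.
Proof. by []. Qed.

Lemma borel_mm_scale (s : {posnum R}) (X : mmSpace R) :
  @borel (mm_scale s X) = @borel X.
Proof. by rewrite /borel open_scaledE. Qed.

(** Membership in the scaled pyramid is membership of the inversely scaled space; the isomorphism in
    [pyramid_scale] is absorbed by downward closure. *)
Lemma pyramid_scaleE (Y : mmSpace R) :
  pyramid_scale t P Y <-> P (mm_scale tV Y).
Proof.
have [_ _ dP _] := pP; split.
  move=> [X PX [f [_ df mf]]]; apply: dP PX _; exists (f : X -> mm_scale tV Y).
    by move=> x y; rewrite mdist_mm_scale df mdist_mm_scale/= mulKf.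
  by move=> B; rewrite borel_mm_scale => bB; exact: mf.
move=> PY; exists (mm_scale tV Y) => //; exists id; split.
- by exists id.
- by move=> x y; rewrite !mdist_mm_scale/= mulVKf.
- by move=> B bB.
Qed.

Lemma pyramid_scale_in (X : mmSpace R) : P X ->
  pyramid_scale t P (mm_scale t X).
Proof. by move=> PX; exists X => //; exists id; split => //; exists id. Qed.

Lemma mm_le_scale (s : {posnum R}) (X Y : mmSpace R) :
  mm_le X Y -> mm_le (mm_scale s X) (mm_scale s Y).
Proof.
move=> [f lf mf]; exists (f : mm_scale s Y -> mm_scale s X).
  by move=> x y; rewrite !mdist_mm_scale ler_pM2l.
by move=> B; rewrite borel_mm_scale => bB; exact: mf.
Qed.

Lemma pyramid_scale_down (X Y : mmSpace R) :
  pyramid_scale t P X -> mm_le Y X -> pyramid_scale t P Y.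
Proof.
have [_ _ dP _] := pP; rewrite !pyramid_scaleE => PX YX; apply: dP PX _.
exact: mm_le_scale.
Qed.

Lemma pyramid_scale_directed : directed (pyramid_scale t P).
Proof.
have [_ _ _ dirP] := pP; move=> X Y; rewrite !pyramid_scaleE => PX PY.
have [Z [PZ XZ YZ]] := dirP _ _ PX PY; exists (mm_scale t Z).
have unscale W : mm_le (mm_scale tV W) Z -> mm_le W (mm_scale t Z).
  move=> [f lf mf]; exists (f : mm_scale t Z -> W).
    move=> x y; rewrite mdist_mm_scale; have := lf x y.
    by rewrite mdist_mm_scale/= ler_pdivrMl.
  by move=> B bB; apply: mf; rewrite borel_mm_scale.
by split; [exact: pyramid_scale_in|exact: unscale|exact: unscale].
Qed.

Lemma has_clusters_scale m r c :
  has_clusters (pyramid_scale t P) m r c <-> has_clusters P m r (c / t%:num).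
Proof.
split => [[X]|[X PX [A [mA rA sA]]]].
  rewrite pyramid_scaleE => PX [A [mA rA sA]]; exists (mm_scale tV X) => //.
  exists A; split => // [i|i j ij x y Ax Ay].
    by have := mA i; rewrite /measurable/= -/(@borel X) -(borel_mm_scale tV).
  by rewrite mdist_mm_scale/= mulrC ler_pM2l// (sA i j).
exists (mm_scale t X); first exact: pyramid_scale_in.
exists A; split => // [i|i j ij x y Ax Ay].
  by have := mA i; rewrite /measurable/= -/(@borel X) -(borel_mm_scale t).
by rewrite mdist_mm_scale mulrC -ler_pdivrMr// (sA i j).
Qed.

End pyramid_scale.

                         

(** * Producing a further cluster, and existence of good configurations *)

Section clusters.
Context (R : realType).
Implicit Types (Q : set (mmSpace R)) (X Y Z : mmSpace R).

Lemma nbhd_sep (X : mmSpace R) (A B : set X) (f g : X -> R) (s a b : R) :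
  (forall x c, (forall y, A y -> c <= mdist x y) -> c <= f x) ->
  (forall x c, (forall y, B y -> c <= mdist x y) -> c <= g x) ->
  (forall x y, A x -> B y -> s <= mdist x y) ->
  forall x y, f x < a -> g y < b -> s - a - b <= mdist x y.
Proof.
move=> fA gB sAB x y fx gy.
have [x' Ax xx'] : exists2 x', A x' & mdist x x' < a.
  apply: contrapT => /forall2NP h; move: fx; apply/negP; rewrite -leNgt.
  by apply: fA => x' Ax; have [//|/negP] := h x'; rewrite -leNgt.
have [y' By yy'] : exists2 y', B y' & mdist y y' < b.
  apply: contrapT => /forall2NP h; move: gy; apply/negP; rewrite -leNgt.
  by apply: gB => y' By; have [//|/negP] := h y'; rewrite -leNgt.
have := sAB _ _ Ax By; have := metric_triangle x' x y';
  have := metric_triangle x y y'.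
rewrite [mdist x' x]metric_sym; lra.
Qed.

Lemma mmass_gt0_neq0 (X : mmSpace R) (A : set X) : 0 < mmass X A -> A !=set0.
Proof. by move=> h; apply/set0P/eqP => A0; move: h; rewrite A0 mass0 ltxx. Qed.

                                                                              
                                                                          
(** Above both spaces, neighbourhoods of radius 7/5 s of two sets at distance 4 s are at distance 4
    s - 14/5 s = 6/5 s. So one of them has mass below [r / 2]. Removing it from the m clusters
    leaves mass at least [r / 2] in each, and the set at its centre becomes a further cluster. *)
Lemma far_cluster Q m (r r' c s : R) : directed Q -> 0 < c -> c <= s ->
  0 < r -> 0 < r' -> has_clusters Q m r c ->
    ~ has_clusters Q 2 (r / 2) (6 / 5 * s) ->
  has_clusters Q 2 r' (4 * s) -> has_clusters Q m.+1 (Num.min (r / 2) r') c.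
Proof.
move=> dQ c0 cs r0 r'0 [X QX [B sB]] ns [Y QY [A sA]].
have [Z [QZ [p lp mp] [q lq mq]]] := dQ X Y QX QY.
have {lp mp}mapp : mm_map p by split.
have {lq mq}mapq : mm_map q by split.
have [mB' rB' sepB'] := separated_preimage mapp sB.
have [mA' rA' sepA'] := separated_preimage mapq sA.
set B' := fun i => p @^-1` B i in mB' rB' sepB'.
set A' := fun i => q @^-1` A i in mA' rA' sepA'.
have nA i : A' i !=set0 by apply: mmass_gt0_neq0; exact: lt_le_trans (rA' i).
have [f0 [lf0 f00 _ fc0]] := exists_dist_fun (nA ord0).
have [f1 [lf1 f10 _ fc1]] := exists_dist_fun (nA ord_max).
pose V0 := [set z | f0 z < 7 / 5 * s]; pose V1 := [set z | f1 z < 7 / 5 * s].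
have mV0 : msr V0 by exact: msr_rlip_lt.
have mV1 : msr V1 by exact: msr_rlip_lt.
have conclude (E V : set Z) (f : Z -> R) : msr E -> msr V -> r' <= mmass Z E ->
    mmass Z V < r / 2 -> rlip f -> (forall x, E x -> f x = 0) ->
    (forall x, ~ V x -> 7 / 5 * s <= f x) ->
      has_clusters Q m.+1 (Num.min (r / 2) r') c.
  move=> mE mV rE hV lf fE fV.
  apply: (@has_clusters_extend _ Q m Z (fun i => B' i `\` V) E) => //.
  - split => [i|i|i j ij x y [Bx _] [By _]].
    + exact: (measurableD (mB' i) mV).
    + rewrite (massD _ (mB' i) mV) ge_min; apply/orP; left.
      have : mmass Z (B' i `&` V) <= mmass Z V by apply: le_mass => //;
        exact: (measurableI _ _ (mB' i) mV).
      by have := rB' i; lra.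
    + exact: (sepB' i j).
  - by rewrite ge_min rE orbT.
  - move=> i x y [_ /fV fx] /fE fy; have := lf x y; rewrite fy; lra.
have [h0|h0] := ltP (mmass Z V0) (r / 2).
  apply: (conclude _ _ f0 (mA' ord0) mV0 (rA' ord0) h0 lf0 f00) => x;
    rewrite /V0 /= => /negP.
  by rewrite -leNgt.
have [h1|h1] := ltP (mmass Z V1) (r / 2).
  apply: (conclude _ _ f1 (mA' ord_max) mV1 (rA' ord_max) h1 lf1 f10) => x;
    rewrite /V1 /= => /negP.
  by rewrite -leNgt.
exfalso; apply: ns; apply: (has_clusters2 QZ mV0 mV1 h0 h1) => x y V0x V1y.
apply: le_trans (nbhd_sep fc0 fc1 (sepA' ord0 ord_max _) V0x V1y) => //; lra.
Qed.

End clusters.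

Section rho_preimage.
Context (R : realType) (Y Z : mmSpace R) (p : Z -> Y).
Hypothesis mapp : mm_map p.

Lemma med_preimage (A : set Y) f : msr A -> rlip f ->
  med (p @^-1` A) (f \o p) = med A f.
Proof.
move=> mA lf; rewrite /med /quantile; congr inf; apply/seteqP.
have E a : distr_fun (mm_measure Z) (p @^-1` A) (f \o p) a = distr_fun
  (mm_measure Y) A f a.
  rewrite /distr_fun -(mmass_preimage mapp)//.
  by apply: measurableI => //; exact: msr_rlip_le.
by split => a /=; rewrite E (mmass_preimage mapp mA).
Qed.

(** Composition with [p] preserves medians and turns 1-Lipschitz functions on Y into some of those
    on Z, so the supremum over Z is the larger one. *)
Lemma rho_le_preimage (Q : set (mmSpace R)) (A B : set Y) (r c : R) : Q Z ->
  0 < r ->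
  msr A -> msr B -> r <= mmass Y A -> r <= mmass Y B ->
    ~ has_clusters Q 2 (r / 2) c ->
  rho A B <= rho (p @^-1` A) (p @^-1` B).
Proof.
move=> QZ r0 mA mB rA rB ns; have [lp _] := mapp.
apply: sup_le_ub.
  by exists `|med A (fun=> 0) - med B (fun=> 0)|, (fun=> 0) => //;
    exact: rlip_cst.
move=> _ [f lf <-]; rewrite -(med_preimage mA lf) -(med_preimage mB lf).
apply: (med_le_rho QZ r0 _ _ _ _ ns).
- exact: msr_preimage.
- exact: msr_preimage.
- by rewrite (mmass_preimage mapp mA).
- by rewrite (mmass_preimage mapp mB).
- exact: rlip_comp.
Qed.

End rho_preimage.

Section exists_good.
Context (R : realType) (k : nat) (Q : set (mmSpace R)) (r c C e : R).
Hypotheses (r0 : 0 < r) (c0 : 0 < c) (e0 : 0 < e) (er : e <= r) (ec : e <= c).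
Hypotheses (nC : ~ has_clusters Q 2 (r / 2) C) (ne : ~ has_clusters Q k.+1 e e).

Let config (Z : mmSpace R) (A : 'I_k -> set Z) :=
  [/\ Q Z, separated A r c & mmass Z (~` \big[setU/set0]_i A i) <= e].

                                                                                
                                                                             
(** The quantity to be maximised: a configuration nearly maximal for the sum is nearly maximal for
    every [rho] at once, as none of them decreases under pullback. *)
Let energy (Z : mmSpace R) (A : 'I_k -> set Z) : R :=
  \sum_i \sum_j rho (A i) (A j).

(** Thickening clusters at distance [3 * c] by [c] on either side keeps them [c] apart. What lies
    outside the thickened sets is at distance at least [c] from the original clusters, so with mass
    [e] it would be a cluster number k+1. *)
Let exists_config : has_clusters Q k r (3 * c) ->
  exists (Z : mmSpace R) (A : 'I_k -> set Z), config A.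
Proof.
have [e0' c0' ec' er'] := And4 e0 c0 ec er; have ec3 : e <= 3 * c by lra.
move=> [Z QZ [A [mA rA sA]]].
have nA i : A i !=set0 by apply: mmass_gt0_neq0; exact: lt_le_trans (rA i).
have /choice[f hf] i := exists_dist_fun (nA i).
have lf i : rlip (f i) by have [] := hf i.
have fc i : forall x s, (forall y, A i y -> s <= mdist x y) -> s <= f i x.
  by have [] := hf i.
pose V i := [set z | f i z < c].
have mV i : msr (V i) by exact: msr_rlip_lt.
have AV i : A i `<=` V i.
  by move=> x Ax; rewrite /V /=; have [_ -> //] := hf i; rewrite divr_gt0.
have mU : msr (\big[setU/set0]_i V i) by exact: bigsetU_measurable.
have mUC : msr (~` \big[setU/set0]_i V i) by exact: measurableC.
exists Z, V; split => //.
  split => // [i|i j ij x y Vx Vy].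
    by apply: le_trans (rA i) _; exact: le_mass.
  by have := nbhd_sep (fc i) (fc j) (sA i j ij) Vx Vy; lra.
rewrite leNgt; apply/negP => /ltW h; apply: ne.
apply: (has_clusters_extend QZ _ mUC h) => [|i x y Ax nVy].
  split => // [i|i j ij x y Ax Ay]; first exact: le_trans (rA i).
  exact: le_trans ec3 (sA i j ij x y Ax Ay).
have fy : c <= f i y.
  by rewrite leNgt; apply/negP => fy; apply: nVy; apply/in_bigsetU; exists i.
have fx : f i x = 0 by have [_ h0 _ _] := hf i; exact: h0.
have := lf i y x; rewrite fx subr0 => h1; rewrite metric_sym.
exact: le_trans (le_trans ec fy) h1.
Qed.

Lemma exists_good : has_clusters Q k r (3 * c) ->
  exists (d : 'I_k -> 'I_k -> R) (w : 'I_k -> R), [/\ good d w r c C Q e,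
    forall i j, 0 <= d i j <= C &
    forall i, 0 <= w i <= 1].
Proof.
move=> /exists_config[Z0 [A0 cA0]].
pose S := [set x | exists (Z : mmSpace R) (A : 'I_k -> set Z),
  config A /\ energy A = x].
have rhoC (Z : mmSpace R) (A : 'I_k -> set Z) i j : config A ->
  rho (A i) (A j) <= C.
  by move=> [QZ [mA rA _] _];
    exact: (rho_le QZ r0 (mA i) (mA j) (rA i) (rA j) nC).
have hS : has_sup S.
  split; first by exists (energy A0), Z0, A0.
  exists (\sum_(i < k) \sum_(j < k) C) => _ [Z [A [cA <-]]].
  by apply: ler_sum => i _; apply: ler_sum => j _; exact: rhoC.
have [_ [Y [A [cA <-]]] hA] := sup_adherent e0 hS.
have [QY sA resA] := cA; have [mA rA sepA] := sA.
have rho0 i j : 0 <= rho (A i) (A j).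
  have lf0 : rlip (fun _ : Y => 0 : R) by exact: rlip_cst.
  have := med_le_rho QY r0 (mA i) (mA j) (rA i) (rA j) nC lf0.
  exact: le_trans.
exists (fun i j => rho (A i) (A j)), (fun i => mmass Y (A i)); split.
- split => //; exists Y, A; split => //.
  + by move=> i; rewrite subrr normr0 ltW.
  + by move=> i j; rewrite subrr normr0 ltW.
  move=> Z QZ p mapp; pose B i := p @^-1` A i.
  have cB : config B.
    split => //; first exact: separated_preimage.
    rewrite (_ : ~` _ = p @^-1` (~` \big[setU/set0]_i A i)).
      by rewrite mmass_preimage//; apply: measurableC;
        exact: bigsetU_measurable.
    rewrite preimage_setC; congr (~` _); apply/seteqP; split => z.
      by move=> /in_bigsetU[i _ Bi]; apply/in_bigsetU; exists i.
    by move=> /in_bigsetU[i _ Bi]; apply/in_bigsetU; exists i.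
  have hB : energy B <= sup S by apply: ub_le_sup; [case: hS|exists Z, B].
  have le_rho i j : rho (A i) (A j) <= rho (B i) (B j).
    exact: (rho_le_preimage mapp QZ r0 (mA i) (mA j) (rA i) (rA j) nC).
  (* The pullback is again a configuration, so its total gain is at most [e]; all single gains are
     nonnegative, hence each is at most [e]. *)
  have : energy B - energy A <= e by move: hA hB; lra.
  rewrite /energy -sumrB => hE i j.
  have hi l : 0 <= \sum_j rho (B l) (B j) - \sum_j rho (A l) (A j).
    by rewrite -sumrB sumr_ge0// => ? _; rewrite subr_ge0.
  have h1 : \sum_j rho (B i) (B j) - \sum_j rho (A i) (A j) <= e.
    by apply: le_trans hE; rewrite [leRHS](bigD1 i)//= lerDl sumr_ge0.
  have : rho (B i) (B j) - rho (A i) (A j) <= e.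
    apply: le_trans h1; rewrite -sumrB [leRHS](bigD1 j)//= lerDl sumr_ge0// =>
      ? _.
    by rewrite subr_ge0.
  by rewrite lerBlDl addrC.
- by move=> i j; rewrite rho0 rhoC.
- by move=> i; rewrite mass_ge0 mass_le1.
Qed.

End exists_good.

Lemma good_approx (R : realType) (k : nat) (d d' : 'I_k -> 'I_k -> R)
    (w w' : 'I_k -> R) (r c C e h : R) (Q : set (mmSpace R)) : 0 <= h ->
  (forall i j, `|d i j - d' i j| <= h) -> (forall i, `|w i - w' i| <= h) ->
  good d w r c C Q e -> good d' w' r c C Q (e + h).
Proof.
move=> h0 dd ww [[Y [A [QY sA resA mA rA maxA]]] nC ne]; split => //;
  last first.
  by move=> /(@has_clusters_mono _ _ _ _ _ e e) sw; apply: ne; apply: sw;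
    rewrite lerDl.
exists Y, A; split => //.
- by apply: le_trans resA _; rewrite lerDl.
- by move=> i; rewrite (le_trans (ler_distD (w i) _ _))// lerD.
- by move=> i j; rewrite (le_trans (ler_distD (d i j) _ _))// lerD.
- move=> Z QZ p mp i j; apply: le_trans (maxA Z QZ p mp i j) _.
  by have := dd i j; rewrite ler_norml; lra.
Qed.

Lemma good_le (R : realType) (k : nat) (d : 'I_k -> 'I_k -> R)
    (w : 'I_k -> R) (r c C e e' : R) (Q : set (mmSpace R)) : e <= e' ->
  good d w r c C Q e -> good d w r c C Q e'.
Proof.
move=> ee' hg; rewrite -(subrKC e e'); apply: good_approx hg.
- by rewrite subr_ge0.
- by move=> i j; rewrite subrr normr0 subr_ge0.
- by move=> i; rewrite subrr normr0 subr_ge0.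
Qed.

                                     

(** * Ultrafilters, and the choice of the scale and of the number of clusters *)

Lemma exists_ultra (E : set nat) : (forall m : nat, exists2 n,
  (m <= n)%N & E n) ->
  exists U : set_system nat, [/\ UltraFilter U, U E & forall S, \oo S -> U S].
Proof.
move=> hE.
have PF : ProperFilter (within E \oo).
  apply: Build_ProperFilter_ex => S [m _ hm].
  by have [n mn En] := hE m; exists n; exact: hm.
have [U [UU sU]] := ultraFilterLemma PF.
exists U; split => //.
  by apply: sU; exists 0%N.
by move=> S [m _ hm]; apply: sU; exists m => // n /hm.
Qed.

Lemma ultra_notin (U : set_system nat) (UU : UltraFilter U) (S : set nat) :
  ~ U S -> U (~` S).
Proof. by move=> nS; have [] := in_ultra_setVsetC S UU. Qed.

Lemma ultra_infinite (U : set_system nat) (UU : UltraFilter U) (S : set nat) :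
  (forall S, \oo S -> U S) -> U S -> forall m : nat, exists2 n,
    (m <= n)%N & S n.
Proof.
move=> Uoo US m.
have /filter_ex[n [Sn mn]] : U (S `&` [set n | (m <= n)%N]).
  by apply: filterI => //; apply: Uoo; exists m.
by exists n.
Qed.

Lemma ultra_limit (R : realType) (U : set_system nat) (UU : UltraFilter U)
    (a : nat -> R) (C : R) : (forall n, `|a n| <= C) ->
  exists l, forall e, 0 < e -> U [set n | `|a n - l| <= e].
Proof.
move=> aC.
have FA : (a @ U) `[- C, C]%classic.
  by rewrite /fmap /=; apply: filterS filterT => n _ /=;
    rewrite in_itv/= -ler_norml.
have [l [_ cl]] := @segment_compact R (- C) C (a @ U) _ FA.
exists l => e e0.
have [|nU] := in_ultra_setVsetC [set n | `|a n - l| <= e] UU; first exact.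
have [x [nx lx]] := cl (~` [set x | `|x - l| <= e]) _ nU (nbhsx_ballx l _ e0).
by exfalso; apply: nx; move: lx; rewrite /ball/= distrC => /ltW.
Qed.

(** Diagonal choice: the m-th index satisfies the m-th requirement and exceeds all previous
    indices. *)
Lemma increasing_choice (T : nat -> nat -> Prop) :
  (forall m K : nat, exists2 n, (K <= n)%N & T m n) ->
  exists ni : nat -> nat, {homo ni : i j / (i < j)%N} /\ forall m, T m (ni m).
Proof.
move=> h.
have /choice[f hf] mK : exists n, (mK.2 <= n)%N /\ T mK.1 n.
  by have [n] := h mK.1 mK.2; exists n.
pose fix ni m := if m is m'.+1 then f (m, (ni m').+1) else f (0%N, 0%N).
exists ni; split.
  by apply: homo_ltn => [? ? ?|m];
    [exact: ltn_trans|have [] := hf (m.+1, (ni m).+1)].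
by case=> [|m]; [have [] := hf (0%N, 0%N)|have [] := hf (m.+1, (ni m).+1)].
Qed.

Lemma homo_lt_ge (ni : nat -> nat) : {homo ni : i j / (i < j)%N} ->
  forall m, (m <= ni m)%N.
Proof. by move=> h; elim=> // m ih;
  exact: leq_ltn_trans ih (h _ _ (ltnSn m)). Qed.

Lemma bounded_subsequence (R : realType) (I : finType) (a : nat -> I ->
  R) (C : R) :
  (forall n i, `|a n i| <= C) ->
  exists (ni : nat -> nat) (l : I -> R), {homo ni : i j / (i < j)%N} /\
    forall m i, `|a (ni m) i - l i| <= m.+1%:R^-1.
Proof.
move=> aC.
have [|U [UU _ Uoo]] := @exists_ultra setT; first by move=> m; exists m.
have /choice[l hl] i := ultra_limit UU (fun n => aC n i).
have [|ni [nih hni]] := @increasing_choice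
    (fun m n => forall i, `|a n i - l i| <= m.+1%:R^-1); last by exists ni, l.
move=> m K; apply: ultra_infinite Uoo _ K.
apply: filter_forall => i.
by apply: hl; rewrite invr_gt0.
Qed.

Section selection.
Context (R : realType) (N : nat) (P : nat -> set (mmSpace R)).
Context (U : set_system nat) (UU : UltraFilter U).
Hypothesis dP : forall n, directed (P n).
Hypothesis levyN : forall r c,
  0 < r -> 0 < c -> U [set n | ~ has_clusters (P n) N.+1 r c].
Hypothesis widthP : forall n r, 0 < r -> exists M, forall c,
  M < c -> ~ has_clusters (P n) 2 r c.
Variables (r0 c0 : R) (r0_gt0 : 0 < r0) (c0_gt0 : 0 < c0).
Hypothesis levy1 : U [set n | has_clusters (P n) 2 r0 c0].

Let UI A B : U A -> U B -> U (A `&` B).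
Proof. exact: filterI. Qed.

(** The separation distance for two weights [r]; the value 0 is added to keep the set nonempty. *)
Let width n r : R := sup [set c | c = 0 \/ has_clusters (P n) 2 r c].

Let has_sup_width n r : 0 < r ->
  has_sup [set c | c = 0 \/ has_clusters (P n) 2 r c].
Proof.
move=> rp; split; first by exists 0; left.
have [M hM] := widthP n rp; exists (Num.max 0 M) => c [->|sc].
  by rewrite le_max lexx.
rewrite le_max; apply/orP; right; rewrite leNgt; apply/negP => Mc.
exact: hM Mc sc.
Qed.

Let le_width n r c : 0 < r -> has_clusters (P n) 2 r c -> c <= width n r.
Proof. by move=> rp sc; apply: ub_le_sup;
  [case: (has_sup_width n rp)|right]. Qed.

Let lt_width n r c : 0 < r -> 0 <= c -> c < width n r ->
  has_clusters (P n) 2 r c.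
Proof.
move=> rp cp cw; have [x [->|sx] cx] := sup_gt (proj1 (has_sup_width n rp)) cw.
  by move: cx; rewrite ltNge cp.
exact: has_clusters_mono (lexx _) (ltW cx) sx.
Qed.

                                                                             
(** Otherwise, whenever [m.+2] clusters of mass [r] exist, the width for [r / 2] is beaten by an
    arbitrary factor at some smaller mass. The factor 4 suffices for [far_cluster], which adds a
    cluster at the same distance [c0]. Iteration contradicts the N-Lévy condition. *)
Let exists_scale : exists r, [/\ 0 < r, U [set n | c0 <= width n r] &
  forall s, 0 < s -> exists D, 0 < D /\ U [set n | width n s <= D * width n r]].
Proof.
apply: contrapT => nscale.
suff hm m : exists r, 0 < r /\ U [set n | has_clusters (P n) m.+2 r c0].
  have [r [rp Ur]] := hm N; have Ul := levyN rp c0_gt0.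
  have /filter_ex[n /= [sn []]] := UI Ur Ul.
  by apply: has_clusters_leq sn; rewrite ltnW.
elim: m => [|m [r [rp Ur]]]; first by exists r0.
have r2 : 0 < r / 2 by rewrite divr_gt0.
have Uw : U [set n | c0 <= width n (r / 2)].
  apply: filterS Ur => n /= sn; apply: le_width => //.
  apply: has_clusters_mono (lexx c0) (has_clusters_leq _ sn) => //; lra.
have [s [sp hs]] : exists s, 0 < s /\
    forall D, 0 < D -> U [set n | D * width n (r / 2) < width n s].
  apply: contrapT => ns; apply: nscale; exists (r / 2); split => // s sp.
  apply: contrapT => nD; apply: ns; exists s; split => // D Dp.
  have /(ultra_notin UU) : ~ U [set n | width n s <= D * width n (r / 2)].
    by move=> h; apply: nD; exists D.
  by apply: filterS => n /= /negP; rewrite -ltNge.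
exists (Num.min (r / 2) s); split; first by rewrite lt_min r2.
have U4 := hs 4 (ltr0n _ 4).
apply: filterS (UI (UI Ur Uw) U4) => n /= [[sn cw] w4].
set w := width n (r / 2) in cw w4.
have cp := c0_gt0.
apply: (@far_cluster _ (P n) m.+2 r s c0 w) => //.
  move=> /(le_width r2); rewrite -/w; lra.
apply: lt_width => //; first by rewrite mulr_ge0// (le_trans (ltW cp)).
Qed.

Lemma exists_selection : exists (t : nat -> {posnum R}) (k : nat) (r c C : R),
  [/\ forall n, (t n)%:num <= 1, (2 <= k <= N)%N, 0 < r /\ 0 < c &
      [/\ U [set n | has_clusters (P n) k r (c / (t n)%:num)],
          U [set n | ~ has_clusters (P n) 2 (r / 2) (C / (t n)%:num)] &
          forall e, 0 < e -> U [set n | ~ has_clusters (P n) k.+1 e (e / (t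
            n)%:num)]]].
Proof.
have [rs [rsp Uw hD]] := exists_scale.
have mx0 n : 0 < Num.max 1 (width n rs) by rewrite lt_max ltr01.
have mxV0 n : 0 < (Num.max 1 (width n rs))^-1 by rewrite invr_gt0.
pose t n : {posnum R} := PosNum (mxV0 n).
have tE n c : c / (t n)%:num = c * Num.max 1 (width n rs) by rewrite /= invrK.
have t1 n : (t n)%:num <= 1.
  by rewrite /= (invf_le1 (mx0 n)) le_max lexx.
(* The number of clusters that persist at a fixed mass and distance after scaling; its largest value
   becomes the number of points of the limit. *)
pose good_k k := `[< exists r c, [/\ 0 < r, 0 < c &
  U [set n | has_clusters (P n) k r (c / (t n)%:num)]] >].
(* Scaling by a factor at most 1 shrinks distances, so N+1 clusters remain excluded. *)
have Ut r c : 0 < r -> 0 < c ->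
  U [set n | ~ has_clusters (P n) N.+1 r (c / (t n)%:num)].
  move=> rp cp; apply: filterS (levyN rp cp) => n /= h h'; apply: h.
  apply: has_clusters_mono (lexx r) _ h'; rewrite tE.
  by apply: ler_peMr; [exact: ltW|rewrite le_max lexx].
have kN k : good_k k -> (k <= N)%N.
  move=> /asboolP[r [c [rp cp Uk]]]; rewrite leqNgt; apply/negP => Nk.
  have /filter_ex[n /= [sk []]] := UI Uk (Ut _ _ rp cp).
  exact: has_clusters_leq sk.
have k2 : good_k 2.
  apply/asboolP; have cp := c0_gt0.
  have m0 : 0 < Num.min c0 1 by rewrite lt_min cp ltr01.
  (* Two clusters need a distance strictly below the width, whether it is larger or smaller than 1;
     hence the half. *)
  exists rs, (Num.min c0 1 / 2); split => //; first by rewrite divr_gt0.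
  apply: filterS Uw => n /= cw; apply: lt_width => //.
    by rewrite divr_ge0 ?ltW// divr_gt0.
  rewrite tE; set w := width n rs in cw *.
  have m1 : Num.min c0 1 <= c0 by rewrite ge_min lexx.
  have m2 : Num.min c0 1 <= 1 by rewrite ge_min lexx orbT.
  rewrite maxEle; case: ifPn => [w1|]; last by rewrite -ltNge; lra.
  have w0 : 0 < w by lra.
  have : Num.min c0 1 * w <= w by rewrite ger_pMl.
  by rewrite mulrAC; lra.
have exk : exists k, good_k k by exists 2%N.
have [k /asboolP[r [c [rp cp Uk]]] kmax] := ex_maxnP exk kN.
have r2 : 0 < r / 2 by rewrite divr_gt0.
have [D [Dp UD]] := hD _ r2.
(* [D] compares the width for mass [r / 2] with the one defining the scale; adding 1 makes the bound
   strict. *)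
exists t, k, r, c, (D + 1); split => //.
  by rewrite kmax// kN//; apply/asboolP; exists r, c.
split => //.
  apply: filterS UD => n /= h; rewrite tE => /(le_width r2) h'.
  have : D * width n rs <= D * Num.max 1 (width n rs).
    by rewrite ler_pM2l// le_max lexx orbT.
  by have := mx0 n; move: h h'; rewrite mulrDl; lra.
(* Clusters on a set of the ultrafilter would contradict the maximality of [k]; an ultrafilter
   contains the complement otherwise. *)
move=> e ep; apply: ultra_notin => // Ue.
suff /kmax : good_k k.+1 by rewrite ltnn.
by apply/asboolP; exists e, e.
Qed.

End selection.

                        

(** * Passage to the limit space *)

Section cvg0.
Context (R : realType).

Lemma ge0_cvge0 (u : nat -> \bar R) : (forall n, 0 <= u n)%E ->
  (forall e : R, 0 < e -> exists M, forall n, (M <= n)%N -> (u n <= e%:E)%E) ->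
  u n @[n --> \oo] --> 0%E.
Proof.
move=> u0 ue; apply/fine_cvgP; split.
  have [M hM] := ue 1 ltr01; exists M => // n /= /hM h.
  by rewrite ge0_fin_numE// (le_lt_trans h)// ltry.
apply/cvgrPdist_le => e e0; have [M hM] := ue e e0; exists M => // n /= /hM h.
have fu : u n \is a fin_num by rewrite ge0_fin_numE// (le_lt_trans h)// ltry.
by rewrite sub0r normrN ger0_norm ?fine_ge0// -lee_fin fineK.
Qed.

Lemma limn_einf_lt (u : nat -> \bar R) : ~ (0 < limn_einf u)%E ->
  forall (e : R) (M : nat), 0 < e -> exists2 n, (M <= n)%N & (u n < e%:E)%E.
Proof.
move=> nu e M e0; apply: contrapT => /forall2NP h; apply: nu.
apply: (@lt_le_trans _ _ e%:E); first by rewrite lte_fin.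
rewrite limn_einf_lim; apply: lime_ge; first exact: is_cvg_einfs.
exists M => // n /= Mn; apply: le_ereal_inf_tmp => _ [m /= nm <-].
have [|/negP] := h m; first by rewrite (leq_trans Mn nm).
by rewrite -leNgt.
Qed.

End cvg0.

Section main.
Context (R : realType).
Implicit Types (P : nat -> set (mmSpace R)) (Q : set (mmSpace R)).

Lemma box_ge0 (X Y : mmSpace R) : (0 <= box X Y)%E.
Proof. by apply: le_ereal_inf_tmp => _ [e [e0 _] <-]; rewrite lee_fin. Qed.

Lemma box_to_ge0 (X : mmSpace R) Q : (0 <= box_to X Q)%E.
Proof. by apply: le_ereal_inf_tmp => _ [Y _ <-]; exact: box_ge0. Qed.

Lemma pyramid_directed Q : pyramid Q -> directed Q.
Proof. by case. Qed.

Lemma pyramid_sep_ge0 Q N (kappa : 'I_N.+1 -> R) : Q !=set0 ->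
  (0 <= pyramid_sep Q kappa)%E.
Proof.
move=> [X QX]; rewrite pyramid_sepE; apply: le_ereal_inf_tmp => _ [delta _ <-].
apply: le_trans (_ : sep X (fun i => (kappa i - delta)%R) <= _)%E.
  by apply: ereal_sup_ubound; left.
by apply: ereal_sup_ubound; exists X.
Qed.

Lemma levy_has_clusters N P (r c : R) : levy_family N P -> 0 < r -> 0 < c ->
  \forall n \near \oo, ~ has_clusters (P n) N.+1 r c.
Proof.
(* The mass is lowered so that the N+1 equal weights have sum at most 1/2, as the Lévy condition
   needs a sum below 1. *)
move=> lP r0 c0; pose s := Num.min r ((2 * N.+1%:R)^-1).
have s0 : 0 < s by rewrite lt_min r0 invr_gt0 mulr_gt0.
have s1 : \sum_(i < N.+1) s < 1.
  rewrite sumr_const card_ord -mulr_natl.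
  apply: (@le_lt_trans _ _ (N.+1%:R * (2 * N.+1%:R)^-1)).
    by rewrite ler_wpM2l// ge_min lexx orbT.
  by rewrite invfM mulrCA mulfV// mulr1 invf_lt1// ltr1n.
have /fine_cvgP[fin /cvgrPdist_lt/(_ c c0) cvg0] := lP (fun=> s) (fun=> s0) s1.
apply: filterS2 fin cvg0 => n fn; rewrite sub0r normrN => hn sw.
have sr : s <= r by rewrite ge_min lexx.
have := has_clusters_le_pyramid_sep (has_clusters_mono sr (lexx c) sw).
rewrite -(fineK fn) lee_fin; move: hn; rewrite /comp /=.
by move=> /(le_lt_trans (ler_norm _)) h1 h2; have := lt_le_trans h1 h2;
  rewrite ltxx.
Qed.

Lemma not_levy1_has_clusters P : (forall n, P n !=set0) -> ~ levy_family 1 P ->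
  exists r c : R, [/\ 0 < r, 0 < c &
    forall M : nat, exists2 n, (M <= n)%N & has_clusters (P n) 2 r c].
Proof.
move=> P0 nl; apply: contrapT => nrc; apply: nl => kappa k0 _.
have [r r0 rk] := exists_pos_lb k0.
have r2 : 0 < r / 2 by rewrite divr_gt0.
apply: ge0_cvge0 => [n|e e0]; first exact: pyramid_sep_ge0.
apply: contrapT => /forallNP nM; apply: nrc; exists (r / 2), e; split => // M.
have /existsNP[n /not_implyP[Mn /negP]] := nM M; rewrite -ltNge => hn.
exists n => //; apply: lt_pyramid_sep hn; first exact: ltW.
by move=> i; have := rk i; lra.
Qed.

(** In a good configuration the metric axioms hold for [rho], which is within [e] of [d], and the
    clusters carry all but [e] of the mass; letting [e] tend to 0 gives the exact statements. *)
Lemma good_metric_data k (d : 'I_k -> 'I_k -> R) (w : 'I_k -> R) (r c C : R) :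
  0 < r -> 0 < c -> (forall e, 0 < e -> exists Q, good d w r c C Q e) ->
  [/\ forall i, d i i = 0, forall i j, d i j = d j i,
      forall j i l, d i l <= d i j + d j l,
      forall i j, i != j -> c <= d i j &
      (forall i, 0 < w i) /\ \sum_i w i = 1].
Proof.
move=> r0 c0 hg; split.
- move=> i; apply/eqP; rewrite -normr_le0; apply/ler_addgt0Pl => e e0;
    rewrite addr0.
  have [Q [[Y [A gA]] _ _]] := hg e e0.
  by have := good_rho gA i i; rewrite rhoxx sub0r normrN.
- move=> i j; apply/eqP; rewrite -subr_eq0 -normr_le0;
    apply/ler_addgt0Pl => e e0.
  have e2 : 0 < e / 2 by rewrite divr_gt0.
  have [Q [[Y [A gA]] _ _]] := hg _ e2.
  have := good_rho gA i j; have := good_rho gA j i;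
    rewrite (rho_sym (A j)) !ler_norml; lra.
- move=> j i l; apply/ler_addgt0Pl => e e0;
    have e3 : 0 < e / 3 by rewrite divr_gt0.
  have [Q [[Y [A gA]] nC _]] := hg _ e3; have [mA rA _] := good_sep gA.
  have := rho_triangle (good_in gA) r0 (mA i) (mA j) (mA l) (rA i) (rA j) (rA
    l) nC.
  have := good_rho gA i j; have := good_rho gA j l; have := good_rho gA i l.
  by rewrite !ler_norml; lra.
- move=> i j ij; apply/ler_addgt0Pl => e e0.
  have [Q [[Y [A gA]] nC _]] := hg _ e0.
  have := rho_ge (good_in gA) r0 (good_sep gA) ij nC.
  by have := good_rho gA i j; rewrite ler_norml; lra.
split.
  move=> i; have r2 : 0 < r / 2 by rewrite divr_gt0.
  have [Q [[Y [A gA]] _ _]] := hg _ r2; have [_ rA _] := good_sep gA.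
  by have := rA i; have := good_mass gA i; rewrite ler_norml; lra.
apply/eqP; rewrite -subr_eq0 -normr_le0; apply/ler_addgt0Pl => e e0;
  rewrite addr0.
have k0 : 0 < k%:R + 1 :> R by rewrite ltr_wpDl.
have [Q [[Y [A gA]] _ _]] := hg _ (divr_gt0 e0 k0).
set h := e / (k%:R + 1) in gA.
have he : h * k%:R + h = e by rewrite -{2}[h]mulr1 -mulrDr divfK// gt_eqF.
have [mA rA sA] := good_sep gA.
have dA i j : i != j -> A i `&` A j = set0
  by exact: separated_disj (good_sep gA).
have mU : msr (\big[setU/set0]_i A i) by exact: bigsetU_measurable.
have E1 : mmass Y (\big[setU/set0]_i A i) = \sum_i mmass Y (A i).
  exact: mass_bigsetU_disj.
have E2 : 1 - \sum_i mmass Y (A i) <= h.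
  by have := good_resid gA; rewrite massC// E1.
have E3 : \sum_i mmass Y (A i) <= 1 by rewrite -E1 mass_le1.
have E4 : `|\sum_i (mmass Y (A i) - w i)| <= h * k%:R.
  apply: le_trans (ler_norm_sum _ _ _) _.
  rewrite mulr_natr -[X in _ *+ X]card_ord -sumr_const; apply: ler_sum => i _.
  exact: good_mass gA i.
move: E4; rewrite sumrB !ler_norml; lra.
Qed.

Lemma exists_good_subsequence N P : (1 <= N)%N -> (forall n, pyramid (P n)) ->
  levy_family N P ->
  (forall kappa : R, 0 < kappa < 1 -> forall n,
     (pyramid_obs_diam (P n) kappa < +oo)%E) ->
  ~ levy_family 1 P ->
  exists (ni : nat -> nat) (t : nat -> {posnum R}) (k : nat)
    (d : 'I_k -> 'I_k -> R) (w : 'I_k -> R) (r c C : R),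
  [/\ {homo ni : i j / (i < j)%N}, forall i, (t i)%:num <= 1, (2 <= k <= N)%N,
      0 < r /\ 0 < c &
      forall e, 0 < e -> exists M, forall m, (M <= m)%N ->
        good d w r c C (pyramid_scale (t m) (P (ni m))) e].
Proof.
move=> N1 pP lN hobs nl.
have P0 n : P n !=set0 by case: (pP n).
have [r0 [c0 [r0_gt0 c0_gt0 hE]]] := not_levy1_has_clusters P0 nl.
have [U [UU UE Uoo]] := exists_ultra hE.
have dP n : directed (P n) by exact: pyramid_directed.
have levyN r c : 0 < r -> 0 < c -> U [set n | ~ has_clusters (P n) N.+1 r c].
  by move=> rp cp; apply: Uoo; exact: levy_has_clusters.
have widthP n r : 0 < r -> exists M, forall c,
  M < c -> ~ has_clusters (P n) 2 r c.
  by move=> rp; apply: obs_diam_bound => // kappa k01; exact: hobs.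
have [t [k [r [c [C [t1 kN [rp cp] [Uk UC Ue]]]]]]] :=
  exists_selection UU dP levyN widthP r0_gt0 c0_gt0 UE.
pose Q n := pyramid_scale (t n) (P n).
have c3 : 0 < c / 3 by rewrite divr_gt0.
(* The third compensates for the thickening in [exists_good], which starts from clusters at three
   times the final distance. *)
pose e1 := Num.min r (c / 3).
have e1p : 0 < e1 by rewrite lt_min rp.
pose e_ m : R := Num.min e1 m.+1%:R^-1.
have e_p m : 0 < e_ m by rewrite lt_min e1p invr_gt0 ltr0n.
pose T m n := exists dw : ('I_k -> 'I_k -> R) * ('I_k -> R),
  [/\ good dw.1 dw.2 r (c / 3) C (Q n) (e_ m), forall i j, 0 <= dw.1 i j <= C &
      forall i, 0 <= dw.2 i <= 1].
have hT m n : has_clusters (P n) k r (c / (t n)%:num) ->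
    ~ has_clusters (P n) 2 (r / 2) (C / (t n)%:num) ->
    ~ has_clusters (P n) k.+1 (e_ m) (e_ m / (t n)%:num) -> T m n.
  rewrite -!(has_clusters_scale _ (pP n)) -/(Q n) => sk nC ne.
  have er : e_ m <= r by rewrite /e_ /e1 !ge_min lexx.
  have ec : e_ m <= c / 3 by rewrite /e_ /e1 !ge_min lexx orbT.
  have cE : 3 * (c / 3) = c by rewrite mulrC divfK.
  rewrite -{1}cE in sk.
  have [d [w [g1 g2 g3]]] := exists_good rp c3 (e_p m) er ec nC ne sk.
  by exists (d, w).
(* First subsequence: the m-th pyramid has a good configuration with error [e_ m], for data that
   still depend on m. *)
have [|n1 [n1h hn1]] := @increasing_choice T.
  move=> m K; apply: (ultra_infinite UU Uoo) => //.
  have UA : U ([set n | has_clusters (P n) k r (c / (t n)%:num)] `&`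
      [set n | ~ has_clusters (P n) 2 (r / 2) (C / (t n)%:num)])
        by exact: filterI.
  have UB := Ue _ (e_p m).
  by apply: filterS2 UA UB => n [sk nC] ne; exact: hT.
have /choice[dw hdw] := hn1.
(* Distances and weights form one bounded finite family; a second subsequence makes it converge, and
   [good_approx] replaces the data by their limits. *)
pose a m (x : 'I_k * 'I_k + 'I_k) : R :=
  match x with inl ij => (dw m).1 ij.1 ij.2 | inr i => (dw m).2 i end.
have aC m x : `|a m x| <= Num.max C 1.
  have [_ hd hw] := hdw m; rewrite le_max; case: x => [[i j]|i] /=.
    by have /andP[d0 dC] := hd i j; rewrite ger0_norm// dC.
  by have /andP[w0 w1] := hw i; rewrite ger0_norm// w1 orbT.
have [n2 [l [n2h hl]]] := bounded_subsequence aC.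
exists (n1 \o n2), (t \o (n1 \o n2)), k, (fun i j => l (inl (i, j))), (fun i =>
  l (inr i)),
  r, (c / 3), C; split => //.
- by move=> i j ij /=; apply: n1h; exact: n2h.
- by move=> i; exact: t1.
move=> e e0; have e2 : 0 < e / 2 by rewrite divr_gt0.
have [M hM] := exists_invS_lt e2; exists M => m Mm.
have small : m.+1%:R^-1 <= e / 2.
  by apply: le_trans (ltW hM); rewrite lef_pV2 ?posrE// ler_nat.
have [hg _ _] := hdw (n2 m).
have := @good_approx _ _ _ (fun i j => l (inl (i, j))) _ (fun i =>
  l (inr i)) _ _ _ _ (e / 2)
  _ (ltW e2) _ _ hg.
move=> /(_ (fun i j => le_trans (hl m (inl (i, j))) small)).
move=> /(_ (fun i => le_trans (hl m (inr i)) small)); apply: good_le.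
rewrite [leRHS](splitr e) lerD2r; apply: le_trans small.
rewrite /e_ ge_min; apply/orP; right.
by rewrite lef_pV2 ?posrE// ler_nat ltnS homo_lt_ge.
Qed.

End main.

Unset Implicit Arguments.

Theorem corollary5p9 (R : realType) (N : nat) (P : nat -> set (mmSpace R))
    (N_ge1 : (1 <= N)%N)
    (P_pyramid : forall n, pyramid (P n))
    (P_levy : levy_family N P)
    (P_obs_diam : forall kappa : R, 0 < kappa < 1 -> forall n,
       (pyramid_obs_diam (P n) kappa < +oo)%E) :
  levy_family 1 P \/
  exists (ni : nat -> nat) (t : nat -> {posnum R}) (X : mmSpace R) (k : nat),
    [/\ {homo ni : i j / (i < j)%N},
        forall i, (t i)%:num <= 1,
        (2 <= k <= N)%N /\ ([set: X] #= `I_k)%card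
      & weakly_converges (fun i => pyramid_scale (t i) (P (ni i)))
          (pyramid_of X)].
Proof.
have [?|nl] := pselect (levy_family 1 P); [by left|right].
have [ni [t [k [d [w [r [c [C [nih t1 kN [r0 c0] hg]]]]]]]]] :=
  exists_good_subsequence N_ge1 P_pyramid P_levy P_obs_diam nl.
have ex e : 0 < e -> exists Q, good d w r c C Q e.
  by move=> /hg[M hM]; eexists; exact: (hM M (leqnn M)).
have [dxx dsym dtri dsep [w0 w1]] := good_metric_data r0 c0 ex.
case: k => [|n] in d w kN hg ex dxx dsym dtri dsep w0 w1 *; first by [].
pose D := @FiniteMetricData R n d dxx dsym dtri (ex_intro2 _ _ c c0 dsep).
have [X [pt [pt_bij ptd bX ptw]]] := exists_finite_mm D w0 w1.
exists ni, t, X, n.+1; split => //.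
  split => //.
  have [pt' ptK pt'K] := pt_bij.
  apply/card_set_bijP; exists (fun z => nat_of_ord (pt' z)); split.
  - by move=> z _ /=; exact: ltn_ord.
  - by move=> z z' _ _ /val_inj /(can_inj pt'K).
  - move=> i /= ik; exists (pt (Ordinal ik)) => //=.
    by rewrite ptK.
split.
  (* First half: a space dominated by X is approximated by the pyramids, with an error that is a
     constant times [e]. *)
  move=> X' [g lg mg]; apply: ge0_cvge0 => [m|eta eta0];
    first exact: box_to_ge0.
  set K : R := 8 + n.+1%:R * (1 + 2 * (n.+1 * n.+1)%:R).
  have K0 : 0 < K by rewrite ltr_wpDr// mulr_ge0// addr_ge0// mulr_ge0.
  pose e := Num.min (eta / K) (Num.min 1 (Num.min (r / 2) c)).
  have e0 : 0 < e by rewrite !lt_min ltr01 c0 !divr_gt0.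
  have [M hM] := hg e e0; exists M => m Mm.
  have dQ Y Z : pyramid_scale (t m) (P (ni m)) Y -> mm_le Z Y ->
      pyramid_scale (t m) (P (ni m)) Z by exact: pyramid_scale_down.
  apply: (good_box_to_le ptd ptw (fun i =>
    ltW (w0 i)) (conj lg mg) dQ r0 e0 _ _ _ (hM m Mm)).
  - by rewrite /e !ge_min lexx !orbT.
  - by rewrite /e !ge_min lexx !orbT.
  - by rewrite /e !ge_min lexx !orbT.
  - by rewrite -ler_pdivlMr// /e ge_min lexx.
(* Second half: if the lower limit vanishes, arbitrarily late pyramids come arbitrarily close to X1
   while being good for arbitrarily small errors. *)
move=> X1 nX1; apply: contrapT => /limn_einf_lt hlt; apply: nX1.
apply: (good_dominated ptd pt_bij bX ptw r0 c0) => e e0.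
have [M hM] := hg e e0; have [m Mm hm] := hlt e M e0.
exists (pyramid_scale (t m) (P (ni m))); split.
- exact: pyramid_scale_directed.
- exact: hM.
by have [_ [Y QY <-] hY] := ereal_inf_lt hm; exists Y.
Qed.
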